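(* Let $\mathbb{G}$ be a stratified group with $N$ the dimension of its first stratum, and let $1<p<\infty$. For any $k,m\in\mathbb{N}$ we have $$\frac{|N-\gamma|}{p}\left\|\frac{f}{|x'|^{\gamma/p}}\right\|_{L^p(\mathbb{G})}^p\le\widetilde A_{\alpha,m}\widetilde A_{\beta,k}\left\|\frac{1}{|x'|^{\alpha-m}}\nabla_H^{m+1}f\right\|_{L^p(\mathbb{G})}\left\|\frac{1}{|x'|^{\frac{\beta}{p-1}-k}}\nabla_H^{k}f\right\|_{L^p(\mathbb{G})}^{p-1}$$ for any $f\in C_0^\infty(\mathbb{G}\setminus\{x'=0\})$, where $\gamma=\alpha+\beta+1$, for $\alpha\in\mathbb{R}$ such that $\prod_{j=0}^{m-1}|N-p(\alpha-j)|\ne0$, with $$\widetilde A_{\alpha,m}:=p^m\left[\prod_{j=0}^{m-1}|N-p(\alpha-j)|\right]^{-1},$$ and for $\beta\in\mathbb{R}$ such that $\prod_{j=0}^{k-1}\left|N-p\left(\frac{\beta}{p-1}-j\right)\right|\neq0$, with $$\widetilde A_{\beta,k}:=p^{k(p-1)}\left[\prod_{j=0}^{k-1}\left|N-p\left(\tfrac{\beta}{p-1}-j\right)\right|\right]^{-(p-1)}.$$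
   Context: A stratified group (homogeneous Carnot group) is a Lie group $\mathbb{G}=(\mathbb{R}^n,\circ)$ such that: (a) for some natural numbers $N=N_1,N_2,\dots,N_r$ with $N_1+\dots+N_r=n$, writing $\mathbb{R}^n=\mathbb{R}^{N}\times\mathbb{R}^{N_2}\times\dots\times\mathbb{R}^{N_r}$, for every $\lambda>0$ the dilation $\delta_\lambda(x',x^{(2)},\dots,x^{(r)})=(\lambda x',\lambda^2x^{(2)},\dots,\lambda^r x^{(r)})$ is an automorphism of $\mathbb{G}$, where $x'\in\mathbb{R}^N$ and $x^{(k)}\in\mathbb{R}^{N_k}$; (b) if $X_1,\dots,X_N$ are the left-invariant vector fields on $\mathbb{G}$ with $X_k(0)=\partial/\partial x'_k|_0$, then the iterated commutators of $X_1,\dots,X_N$ span the Lie algebra of $\mathbb{G}$ (rank $n$ at every point). $N$ is the dimension of the first stratum. Points are written $x=(x',x'')$ with $x'\in\mathbb{R}^N$ the first-stratum variables, and $|x'|$ is the Euclidean norm on $\mathbb{R}^N$. $\nabla_H=(X_1,\dots,X_N)$ is the horizontal gradient and $|\nabla_H f|=(\sum_k|X_kf|^2)^{1/2}$. The iterated horizontal gradients are understood as $\nabla_H^1f=\nabla_Hf$, $\nabla_H^2f=\nabla_H|\nabla_Hf|$, and in general $\nabla_H^{m}f=\nabla_H|\nabla_H^{m-1}f|$. $L^p(\mathbb{G})$ is with respect to Lebesgue measure $dx$ on $\mathbb{R}^n$ (the Haar measure of $\mathbb{G}$); the $L^p$ norm of a vector-valued function is that of its Euclidean length. $C_0^\infty(U)$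 denotes smooth functions with compact support in the open set $U$. *)

(* Defs.v *)
From HB Require Import structures.
From mathcomp Require Import all_boot all_order all_algebra.
From mathcomp Require Import all_classical all_reals all_analysis.

Set Implicit Arguments.
Unset Strict Implicit.
Unset Printing Implicit Defensive.

Import Order.TTheory GRing.Theory Num.Theory.
Import numFieldNormedType.Exports.

Local Open Scope classical_set_scope.
Local Open Scope ring_scope.

(** ['rV[R]_n] carries the sigma-algebra generated by the coordinate maps (the
    library's construction for [n.-tuple R]), that is, the Borel one. *)

Definition measure_rV_display : measure_display -> measure_display.
Proof. exact. Qed.

Section measurable_rV.
Context {d : measure_display} {T : measurableType d}.
Variable n : nat.

Let coord : 'I_n -> 'rV[T]_n -> T := fun i v => v ord0 i.

Let rV_set0 : g_sigma_preimage coord set0.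
Proof. exact: sigma_algebra0. Qed.

Let rV_setC A : g_sigma_preimage coord A -> g_sigma_preimage coord (~` A).
Proof. exact: sigma_algebraC. Qed.

Let rV_bigcup (F : (set 'rV[T]_n)^nat) :
  (forall i, g_sigma_preimage coord (F i)) ->
  g_sigma_preimage coord (\bigcup_i (F i)).
Proof. exact: sigma_algebra_bigcup. Qed.

HB.instance Definition _ := @isMeasurable.Build (measure_rV_display d)
  'rV[T]_n (g_sigma_preimage coord) rV_set0 rV_setC rV_bigcup.

End measurable_rV.

Section measurable_coord.
Context {d d' : measure_display} {T : measurableType d} {S : measurableType d'}.

Lemma measurable_coord n (i : 'I_n) :
  measurable_fun [set: 'rV[T]_n] (fun v : 'rV[T]_n => v ord0 i).
Proof.
move=> _ Y mY; rewrite setTI; apply: sub_sigma_algebra => /=.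
rewrite -bigcup_seq/=; exists i => /=; first by rewrite mem_index_enum.
by exists Y => //; rewrite setTI.
Qed.

Lemma measurable_fun_rV n (f : S -> 'rV[T]_n) :
  (forall i, measurable_fun [set: S] (fun x => f x ord0 i)) ->
  measurable_fun [set: S] f.
Proof.
move=> mf _ A mA; rewrite setTI.
have : (g_sigma_preimage (fun (i : 'I_n) x => f x ord0 i)) (f @^-1` A).
  rewrite (_ : g_sigma_preimage _ =
    preimage_set_system setT f
      (g_sigma_preimage (fun (i : 'I_n) (v : 'rV[T]_n) => v ord0 i))).
    by exists A => //; rewrite setTI.
  exact: (g_sigma_preimage_comp (fun (i : 'I_n) (v : 'rV[T]_n) => v ord0 i) f).
apply: smallest_sub; first exact: sigma_algebra_measurable.
rewrite -bigcup_seq/= => B [i _ [C mC <-]].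
exact: mf.
Qed.

End measurable_coord.

Section lebesgue_rV.
Variable R : realType.

Definition cons_rV n (p : R * 'rV[R]_n) : 'rV[R]_n.+1 :=
  \row_i oapp (p.2 ord0) p.1 (unlift ord0 i).

Definition uncons_rV n (v : 'rV[R]_n.+1) : R * 'rV[R]_n :=
  (v ord0 ord0, \row_i v ord0 (lift ord0 i)).

Lemma cons_rVK n : cancel (@cons_rV n) (@uncons_rV n).
Proof.
move=> [t v]; congr pair; first by rewrite mxE unlift_none.
by apply/rowP => i; rewrite !mxE liftK.
Qed.

Lemma uncons_rVK n : cancel (@uncons_rV n) (@cons_rV n).
Proof.
by move=> v; apply/rowP => i; rewrite mxE; case: unliftP => [j|] -> //=; rewrite mxE.
Qed.

Lemma measurable_cons_rV n : measurable_fun [set: R * 'rV[R]_n] (@cons_rV n).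
Proof.
apply: measurable_fun_rV => i; under eq_fun do rewrite mxE.
case: unliftP => [j|] _ /=; last exact: measurable_fst.
exact: measurableT_comp (measurable_coord j) measurable_snd.
Qed.

Lemma measurable_uncons_rV n : measurable_fun [set: 'rV[R]_n.+1] (@uncons_rV n).
Proof.
apply: measurable_fun_pair; first exact: measurable_coord.
by apply: measurable_fun_rV => i; under eq_fun do rewrite mxE; exact: measurable_coord.
Qed.

Section lebesgue_rVS.
Variables (n : nat) (mu : {sigma_finite_measure set 'rV[R]_n -> \bar R}).


Definition lebesgue_rVS : set 'rV[R]_n.+1 -> \bar R :=
  pushforward (@lebesgue_measure R \x mu)%E (@cons_rV n).

Let measurable_preimage (A : set 'rV[R]_n.+1) : measurable A ->
  measurable (@cons_rV n @^-1` A : set (measurableTypeR R * 'rV[R]_n)).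
Proof. by move=> mA; rewrite -[X in measurable X]setTI; exact: measurable_cons_rV. Qed.

Let lebesgue_rVS0 : lebesgue_rVS set0 = 0%E.
Proof. by rewrite /lebesgue_rVS /pushforward preimage_set0 measure0. Qed.

Let lebesgue_rVS_ge0 A : (0 <= lebesgue_rVS A)%E.
Proof. by rewrite /lebesgue_rVS /pushforward measure_ge0. Qed.

Let lebesgue_rVS_sigma_additive : semi_sigma_additive lebesgue_rVS.
Proof.
move=> F mF tF mUF; rewrite /lebesgue_rVS /pushforward preimage_bigcup.
apply: measure_semi_sigma_additive.
- by move=> k; exact: measurable_preimage.
- apply/trivIsetP => /= i j _ _ ij; rewrite -preimage_setI.
  by move/trivIsetP : tF => /(_ _ _ _ _ ij) ->//; rewrite preimage_set0.
- by rewrite -preimage_bigcup; exact: measurable_preimage.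
Qed.

HB.instance Definition _ := isMeasure.Build _ _ _ lebesgue_rVS
  lebesgue_rVS0 lebesgue_rVS_ge0 lebesgue_rVS_sigma_additive.

Let lebesgue_rVS_sigma_finite : sigma_finite setT lebesgue_rVS.
Proof.
have /sigma_finiteP[F [TF ndF Foo]] := sigma_finiteT (@lebesgue_measure R).
have /sigma_finiteP[G [TG ndG Goo]] := sigma_finiteT mu.
exists (fun k => @uncons_rV n @^-1` (F k `*` G k)).
  apply/seteqP; split=> // v _; have [t w] := uncons_rV v.
  have [i _ Fi] : (\bigcup_i F i) (uncons_rV v).1 by rewrite -TF.
  have [j _ Gj] : (\bigcup_j G j) (uncons_rV v).2 by rewrite -TG.
  exists (maxn i j) => //; split.
    exact: (subsetPset _ _ (ndF _ _ (leq_maxl i j))).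
  exact: (subsetPset _ _ (ndG _ _ (leq_maxr i j))).
move=> k; have [? ?] := Foo k; have [? ?] := Goo k; split.
  rewrite -[X in measurable X]setTI; apply: measurable_uncons_rV => //.
  exact: measurableX.
rewrite /lebesgue_rVS /pushforward -comp_preimage.
rewrite (_ : _ \o _ = id); last by apply/funext => p /=; rewrite cons_rVK.
by rewrite preimage_id product_measure1E// lte_mul_pinfty// ge0_fin_numE.
Qed.

HB.instance Definition _ := Measure_isSigmaFinite.Build _ _ _ lebesgue_rVS
  lebesgue_rVS_sigma_finite.

End lebesgue_rVS.

Fixpoint lebesgue_rV (n : nat) : {sigma_finite_measure set 'rV[R]_n -> \bar R} :=
  match n with
  | 0 => \d_(0 : 'rV[R]_0)
  | m.+1 => lebesgue_rVS (lebesgue_rV m)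
  end.

End lebesgue_rV.

Lemma lebesgue_rV_box (R : realType) n (A : 'I_n -> set R) :
  (forall i, measurable (A i)) ->
  lebesgue_rV R n [set v | forall i, A i (v ord0 i)] =
  (\prod_(i < n) lebesgue_measure (A i))%E.
Proof.
elim: n A => [|n ih] A mA.
  by rewrite big_ord0 /= /dirac indicE mem_set// => -[].
rewrite big_ord_recl -(ih (fun i => A (lift ord0 i)))//=.
rewrite -product_measure1E//; last first.
- rewrite [X in measurable X](_ : _ =
      \big[setI/setT]_(i < n) [set v : 'rV[R]_n | A (lift ord0 i) (v ord0 i)]).
    apply: bigsetI_measurable => i _; rewrite -[X in measurable X]setTI.
    exact: measurable_coord.
  by rewrite -bigcap_seq; apply/seteqP; split => v /= + i => /(_ i);
    [move=> + _|apply; rewrite /= mem_index_enum].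
- exact: (mA ord0).
congr (product_measure1 _ _ _); apply/seteqP; split => -[t v] /=.
  by move=> Atv; split => [|i]; [have := Atv ord0|have := Atv (lift ord0 i)];
    rewrite mxE ?unlift_none ?liftK.
by move=> [At Av] i; rewrite mxE; case: unliftP => [j|] ->.
Qed.

Section smooth.
Context {R : realType}.

(** Meant for finite-dimensional [V], where continuity of x |-> 'D_v f x for every
    fixed v amounts to continuity of the differential. *)
Fixpoint Ck (V W : normedModType R) (k : nat) (f : V -> W) : Prop :=
  match k with
  | 0 => continuous f
  | m.+1 => (forall x, differentiable f x) /\ forall v, Ck m ('D_v f)
  end.

Definition smooth (V W : normedModType R) (f : V -> W) := forall k, Ck k f.

Definition Cc_infty (V : normedModType R) (U : set V) : set (V -> R) :=
  [set f | [/\ smooth (f : V -> R^o), compact (closure [set x | f x != 0])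
             & closure [set x | f x != 0] `<=` U]].

End smooth.

Definition enorm {R : realType} {n} (v : 'rV[R]_n) : R :=
  Num.sqrt (\sum_i v ord0 i ^+ 2).

Section vector_fields.
Context {R : realType} {n : nat}.
Implicit Types X Y : 'rV[R]_n -> 'rV[R]_n.

Definition lie_bracket X Y : 'rV[R]_n -> 'rV[R]_n :=
  fun x => 'D_(X x) Y x - 'D_(Y x) X x.

Inductive iterated_commutator m (X : 'I_m -> 'rV[R]_n -> 'rV[R]_n) :
    ('rV[R]_n -> 'rV[R]_n) -> Prop :=
  | iterated_commutator1 k : iterated_commutator X (X k)
  | iterated_commutatorS k Y :
      iterated_commutator X Y -> iterated_commutator X (lie_bracket (X k) Y).

(** The field [x |-> d(y |-> op x y)_0 e_k]: when [op] is a group law with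
    identity 0, it is the left-invariant field with value e_k at 0. *)
Definition left_invariant_field (op : 'rV[R]_n -> 'rV[R]_n -> 'rV[R]_n) (k : 'I_n) :
    'rV[R]_n -> 'rV[R]_n :=
  fun x => 'D_(delta_mx ord0 k) (op x) 0.

End vector_fields.

(** The coordinates of R^N x R^N_2 x ... x R^N_r, with dims = N :: N_2 :: ...,
    are numbered consecutively; the i-th one is scaled by the power of l given by
    the (1-based) index of the block in which it lies. *)
Definition dilation {R : realType} (dims : seq nat) (l : R)
    (x : 'rV[R]_(sumn dims)) : 'rV[R]_(sumn dims) :=
  \row_i (l ^+ (reshape_index dims i).+1 * x ord0 i).

(** The first stratum has dimension [hdim], the others those listed in [vdims];
    [sumn (hdim :: vdims)] is [hdim + sumn vdims] by computation. The identity
    need not be assumed to be 0, being fixed by the dilations ([gone0]). *)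
Record stratified_group (R : realType) := StratifiedGroup {
  hdim : nat;
  vdims : seq nat;
  gmul : 'rV[R]_(hdim + sumn vdims) -> 'rV[R]_(hdim + sumn vdims) ->
         'rV[R]_(hdim + sumn vdims);
  gone : 'rV[R]_(hdim + sumn vdims);
  ginv : 'rV[R]_(hdim + sumn vdims) -> 'rV[R]_(hdim + sumn vdims);
  dims_gt0 : all (fun d => 0 < d)%N (hdim :: vdims);
  gmulA : associative gmul;
  gmul1x : left_id gone gmul;
  gmulVx : left_inverse gone ginv gmul;
  gmul_smooth : smooth (fun z : 'rV[R]_(hdim + sumn vdims) *
                                'rV[R]_(hdim + sumn vdims) => gmul z.1 z.2);
  ginv_smooth : smooth ginv;
  dilationM : forall l : R, 0 < l ->
    {morph @dilation R (hdim :: vdims) l : x y / gmul x y};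
  hormander : forall x, exists Y : 'I_(hdim + sumn vdims) ->
                'rV[R]_(hdim + sumn vdims) -> 'rV[R]_(hdim + sumn vdims),
    (forall i, iterated_commutator
       (fun k : 'I_hdim => left_invariant_field gmul (lshift (sumn vdims) k)) (Y i)) /\
    \rank (\matrix_i Y i x) = (hdim + sumn vdims)%N
}.

Lemma gone0 (R : realType) (G : stratified_group R) : gone G = 0.
Proof.
set e := gone G; pose a := @dilation R (hdim G :: vdims G) 2 e.
have aa : @gmul R G a a = a by rewrite /a -dilationM ?ltr0n// gmul1x.
have : gmul (ginv a) (gmul a a) = @gmul R G (ginv a) a by rewrite aa.
rewrite gmulA gmulVx gmul1x => ae.
apply/rowP => i; rewrite mxE; move/rowP : ae => /(_ i).
rewrite mxE -{2}[e ord0 i]mul1r => /eqP; rewrite -subr_eq0 -mulrBl mulf_eq0.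
rewrite subr_eq0 => /orP[|/eqP//]; by rewrite pexpr_eq1// pnatr_eq1.
Qed.

Section horizontal.
Context {R : realType} (G : stratified_group R).

Definition gpoint := 'rV[R]_(hdim G + sumn (vdims G)).

Definition haar : {sigma_finite_measure set gpoint -> \bar R} :=
  lebesgue_rV R (hdim G + sumn (vdims G)).

(** |x'| *)
Definition hnorm (x : gpoint) : R := enorm (lsubmx x).

Definition hfield (k : 'I_(hdim G)) : gpoint -> gpoint :=
  left_invariant_field (@gmul R G) (lshift (sumn (vdims G)) k).

Definition hderive (k : 'I_(hdim G)) (f : gpoint -> R) : gpoint -> R :=
  fun x => 'D_(hfield k x) (f : gpoint -> R^o) x.

Definition hgrad (f : gpoint -> R) : gpoint -> 'rV[R]_(hdim G) :=
  fun x => \row_k hderive k f x.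

Definition locally_L1 (u : gpoint -> R) :=
  measurable_fun setT u /\
  forall K : set gpoint, compact K -> haar.-integrable K (EFin \o u).

(** [V] is a horizontal gradient of [u] in the sense of distributions; the
    fields X_k are divergence free, so the formal adjoint of X_k is - X_k. *)
Definition is_weak_hgrad (u : gpoint -> R) (V : gpoint -> 'rV[R]_(hdim G)) :=
  locally_L1 u /\ forall k : 'I_(hdim G),
    locally_L1 (fun x => V x ord0 k) /\
    forall phi, Cc_infty [set: gpoint] phi ->
      (\int[haar]_x (u x * hderive k phi x)%:E =
       - \int[haar]_x (V x ord0 k * phi x)%:E)%E.

(** [is_abs_hgrad f m u]: [u] is a version of |nabla_H^m f|, where
    nabla_H^0 f = f, nabla_H^1 f = nabla_H f and
    nabla_H^(m+1) f = nabla_H |nabla_H^m f|. Since |nabla_H^m f| is not smooth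
    where it vanishes, the gradient is a weak one from the second on. *)
Inductive is_abs_hgrad (f : gpoint -> R) : nat -> (gpoint -> R) -> Prop :=
  | is_abs_hgrad0 : is_abs_hgrad f 0 (fun x => `|f x|)
  | is_abs_hgrad1 : is_abs_hgrad f 1 (fun x => enorm (hgrad f x))
  | is_abs_hgradS m u V : is_abs_hgrad f m.+1 u -> is_weak_hgrad u V ->
      is_abs_hgrad f m.+2 (fun x => enorm (V x)).

Definition wLnorm (p a : R) (f : gpoint -> R) : \bar R :=
  Lnorm haar p%:E (fun x => (f x / hnorm x `^ a)%:E).

(** The L^p norm of nabla_H^m f / |x'|^a. All versions of |nabla_H^m f| are equal
    almost everywhere, so that the infimum is over a single value when nabla_H^m f
    exists; when it does not, it is +oo, as usual for Sobolev norms. *)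
Definition wLnorm_hgrad (p a : R) (m : nat) (f : gpoint -> R) : \bar R :=
  ereal_inf [set wLnorm p a u | u in is_abs_hgrad f m].

End horizontal.

Section constants.
Context {R : realType} (N : nat) (p : R).

Definition A_alpha (alpha : R) (m : nat) : R :=
  p ^+ m * (\prod_(j < m) `|N%:R - p * (alpha - j%:R)|)^-1.

Definition A_beta (beta : R) (k : nat) : R :=
  p `^ (k%:R * (p - 1)) *
  (\prod_(j < k) `|N%:R - p * (beta / (p - 1) - j%:R)|) `^ (- (p - 1)).

End constants.

(* Main.v *)
(** The coefficients of X_k = sum_j a_kj d_j satisfy a_kj = delta_kj for j in the
    first stratum and, by homogeneity, d_j a_kj = 0; hence X_k is divergence free and
    sum_k X_k (x'_k |x'|^-s) = (N - s) |x'|^-s. Integrating F(v) against this identity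
    and using Cauchy-Schwarz and Hoelder gives, for s = a + b + 1,
      |N - s| / p || v / |x'|^(s/p) ||^p <=
        || nabla_H v / |x'|^a || || v / |x'|^(b/(p-1)) ||^(p-1),
    and the choice s = p a', a = a' - 1 is the Hardy inequality
      || v / |x'|^a' || <= p / |N - p a'| || nabla_H v / |x'|^(a'-1) ||.
    The theorem is the first inequality for f, whose two factors are then bounded by
    iterating the second along the |nabla_H^m f|.

    The latter functions only have weak horizontal gradients, so both inequalities
    are needed for L^1 limits of C^1 functions supported away from x' = 0. Replacing |v|
    by |v| / (1 + d |v|) makes the powers bounded and the limit possible, and d tends to
    0 at the end. A weak gradient is approximated by Euclidean mollification; the kernels
    of the commutators [X_k, *rho_e] have mean zero because d_j a_kj = 0, and the
    commutators therefore tend to 0 in L^1. In particular weak gradients vanish almost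
    everywhere outside the support, which keeps the iteration away from x' = 0. *)

Require Import Defs.
From mathcomp Require Import all_boot all_order all_algebra.
From mathcomp Require Import all_classical all_reals all_analysis.
From mathcomp Require Import measurable_realfun.
From mathcomp Require Import ring lra.

Set Implicit Arguments.
Unset Strict Implicit.
Unset Printing Implicit Defensive.

Import Order.TTheory GRing.Theory Num.Theory.
Import numFieldNormedType.Exports.

Local Open Scope classical_set_scope.
Local Open Scope ring_scope.

(** * Affine changes of variables *)

(** Damping has a second use. The Hardy inequality comes from the first one by cancelling the
    (p-1)-th power of a weighted norm of v, which must be known to be finite beforehand. An L^1
    limit need not lie in L^p, whereas its damped version is bounded, vanishes near x' = 0 and has
    bounded support.

    In the commutator, differentiating rho_e costs a factor 1/e, and the increment of the C^1
    coefficient a_kj over a distance of order e gives a factor e back. The resulting kernel is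
    bounded in L^1 uniformly in e, but it is not small. Its mean zero turns u (x - e z) into u (x -
    e z) - u (x), and the continuity of translations in L^1 does the rest. Mollification error and
    commutator thus have majorants of the same form, with different kernels. *)

Lemma ge0_integral_affine1 (R : realType) (c b : R) (f : R -> \bar R) :
  c != 0 -> measurable_fun [set: R] f -> (forall x, 0 <= f x)%E ->
  (\int[lebesgue_measure]_x f (c * x + b)%R =
   `|c|^-1%:E * \int[lebesgue_measure]_x f x)%E.
Proof.
move=> c0 mf f0; pose phi := (fun x => c * x + b) : R -> measurableTypeR R.
have mphi : measurable_fun [set: R] phi.
  by apply: measurable_funD => //; exact: mulrl_measurable.
have c'0 : 0 <= `|c| by [].
(* This measure gives every interval []x, y]] its length, so it is Lebesgue measure; for c < 0 the
   preimage is closed at the other end. *)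
pose nu := mscale (NngNum c'0) (pushforward (@lebesgue_measure R) phi).
have nuE A : measurable A -> lebesgue_measure A = nu mphi A.
  move=> mA; apply: (@lebesgue_measure_unique R (nu mphi)) => // _ [[x y]] _ <-.
  rewrite /= /nu /mscale/= /pushforward/=.
  have [c_gt0|c_le0] := ltP 0 c.
    rewrite (_ : phi @^-1` _ = [set` Interval (BRight ((x - b) / c)) (BRight ((y - b) / c))]); last first.
      apply/seteqP; split => z /=; rewrite !in_itv/= /phi;
        by rewrite ltr_pdivrMr// ler_pdivlMr// ltrBlDr lerBrDr (mulrC z c).
    rewrite !lebesgue_measure_itv/= !lte_fin ltr_pM2r ?invr_gt0// ltrD2r.
    case: ifPn => xy; last by rewrite mule0.
    rewrite -!EFinB -EFinM; congr EFin; rewrite gtr0_norm//.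
    by field.
  have c_lt0 : c < 0 by rewrite lt_neqAle c0.
  rewrite (_ : phi @^-1` _ = [set` Interval (BLeft ((y - b) / c)) (BLeft ((x - b) / c))]); last first.
    apply/seteqP; split => z /=; rewrite !in_itv/= /phi;
      rewrite ltr_ndivlMr// ler_ndivrMr// ltrBlDr lerBrDr (mulrC z c);
      by rewrite andbC.
  rewrite !lebesgue_measure_itv/= !lte_fin ltr_nM2r ?invr_lt0// ltrD2r.
  case: ifPn => xy; last by rewrite mule0.
  rewrite -!EFinB -EFinM; congr EFin; rewrite ltr0_norm//.
  by field.
have -> : (\int[lebesgue_measure]_x f x = `|c|%:E * \int[lebesgue_measure]_x f (phi x))%E.
  rewrite (eq_measure_integral (nu mphi))//; last by move=> A mA _; exact: nuE.
  rewrite ge0_integral_mscale//=.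
  by rewrite ge0_integral_pushforward.
by rewrite muleA -EFinM mulVf ?normr_eq0// mul1e.
Qed.

Lemma measurable_addZ_rV (R : realType) n (c : R) (b : 'rV[R]_n) :
  measurable_fun [set: 'rV[R]_n] (fun x => c *: x + b).
Proof.
apply: measurable_fun_rV => i; under eq_fun do rewrite !mxE.
apply: measurable_funD => //; apply: measurable_funM => //.
exact: measurable_coord.
Qed.

Lemma ge0_integral_rVS (R : realType) n (f : 'rV[R]_n.+1 -> \bar R) :
  measurable_fun [set: 'rV[R]_n.+1] f -> (forall x, 0 <= f x)%E ->
  (\int[lebesgue_rV R n.+1]_x f x =
   \int[lebesgue_measure]_t \int[lebesgue_rV R n]_w f (cons_rV (t, w)))%E.
Proof.
move=> mf f0.
rewrite /= /lebesgue_rVS/=.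
rewrite ge0_integral_pushforward//=; last exact: measurable_cons_rV.
rewrite fubini_tonelli1//.
by apply: measurableT_comp => //; exact: measurable_cons_rV.
Qed.

(** Induction on n by Tonelli, with one factor 1/|c| per coordinate. *)
Lemma ge0_integral_affine (R : realType) n (c : R) (b : 'rV[R]_n)
    (f : 'rV[R]_n -> \bar R) :
  c != 0 -> measurable_fun [set: 'rV[R]_n] f -> (forall x, 0 <= f x)%E ->
  (\int[lebesgue_rV R n]_x f (c *: x + b)%R =
   (`|c|^-1 ^+ n)%:E * \int[lebesgue_rV R n]_x f x)%E.
Proof.
move=> c0; elim: n b f => [|n ih] b f mf f0.
  rewrite expr0 mul1e; apply: eq_integral => x _; congr f.
  by apply/rowP => -[].
rewrite !ge0_integral_rVS//; last first.
  by apply: (measurableT_comp mf); exact: measurable_addZ_rV.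
have consE t w : c *: cons_rV (t, w) + b =
    cons_rV (c * t + (uncons_rV b).1, c *: w + (uncons_rV b).2).
  apply/rowP => i; rewrite !mxE; case: unliftP => [j ->|->] /=; last by [].
  by rewrite !mxE.
under eq_integral => t _.
  under eq_integral => w _ do rewrite consE.
  rewrite (ih _ (fun w => f (cons_rV (c * t + (uncons_rV b).1, w))))//; last first.
    apply: (measurableT_comp mf); apply: (measurableT_comp (@measurable_cons_rV R n)).
    exact: measurable_fun_pair.
  over.
have mI : measurable_fun [set: R]
    (fun t => \int[lebesgue_rV R n]_w f (cons_rV (t, w)))%E.
  apply: (@measurable_fun_fubini_tonelli_F _ _ _ _ _ _ (fun z => f (cons_rV z))).
    apply: (measurableT_comp mf); exact: measurable_cons_rV.
  by move=> z; exact: f0.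
rewrite ge0_integralZl//; last 2 first.
- by apply: (measurableT_comp mI); apply: measurable_funD => //; exact: mulrl_measurable.
- by move=> t _; exact: integral_ge0.
rewrite (ge0_integral_affine1 _ c0 mI); last by move=> t; exact: integral_ge0.
by rewrite muleA -EFinM exprSr.
Qed.

(** * Topology and Borel sets of row vectors *)

Section rV_topology.
Context {R : realType} {n : nat}.
Implicit Types (x y : 'rV[R]_n) (A : set 'rV[R]_n) (M : R).

Lemma coord_le_norm x i : `|x ord0 i| <= `|x|.
Proof.
rewrite [leRHS]/Num.norm /= mx_normrE; apply/bigmax_geP; right => /=.
by exists (ord0, i).
Qed.

Lemma rV_norm_le x M : 0 <= M -> (forall i, `|x ord0 i| <= M) -> `|x| <= M.
Proof.
move=> M0 xM; rewrite [leLHS]/Num.norm /= mx_normrE.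
by apply/bigmax_leP; split => // -[i j] _ /=; rewrite ord1.
Qed.

Lemma rV_norm_lt x M : 0 < M -> (forall i, `|x ord0 i| < M) -> `|x| < M.
Proof.
move=> M0 xM; rewrite [ltLHS]/Num.norm /= mx_normrE.
by apply/bigmax_ltP; split => // -[i j] _ /=; rewrite ord1.
Qed.

Lemma measurable_rV_box (B : 'I_n -> set R) : (forall i, measurable (B i)) ->
  measurable [set x : 'rV[R]_n | forall i, B i (x ord0 i)].
Proof.
move=> mB; rewrite (_ : [set _ | _] =
    \big[setI/setT]_(i < n) [set x : 'rV[R]_n | B i (x ord0 i)]).
  apply: bigsetI_measurable => i _; rewrite -[X in measurable X]setTI.
  exact: (measurable_coord i).
by rewrite -bigcap_seq; apply/seteqP; split => v /= + i => /(_ i);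
  [move=> + _|apply; rewrite /= mem_index_enum].
Qed.

(** The sigma-algebra comes from the coordinates, so an open set has to be written as a countable
    union of boxes: those with rational centre and radius 1/(k+1) that lie in it. *)
Lemma open_measurable_rV A : open A -> measurable A.
Proof.
move=> oA.
pose q (v : 'rV[rat]_n) : 'rV[R]_n := \row_i ratr (v ord0 i).
pose B (p : 'rV[rat]_n * nat) := [set x : 'rV[R]_n |
  forall i, ball (q p.1 ord0 i) p.2.+1%:R^-1 (x ord0 i)].
rewrite (_ : A = \bigcup_p if pselect (B p `<=` A) then B p else set0).
  apply: countable_bigcupT_measurable => [|p]; first exact: countableP.
  case: (pselect _) => ? /=; last exact: measurable0.
  apply: (@measurable_rV_box (fun i => ball (q p.1 ord0 i) p.2.+1%:R^-1)) => i.
  exact: measurable_ball.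
apply/seteqP; split => [x Ax|x [p _]]; last by case: (pselect _) => // BA; exact: BA.
have /nbhs_ballP[e/= e0 xeA] : nbhs x A by exact: open_nbhs_nbhs.
(* Half of e, because the triangle inequality passes through the centre of the box. *)
have [k ke] : exists k : nat, k.+1%:R^-1 < e / 2.
  have [k _ kP] := near_infty_natSinv_lt (PosNum (divr_gt0 e0 (ltr0n _ 2))).
  by exists k; exact: (kP k (leqnn k)).
have k0 : 0 < k.+1%:R^-1 :> R by rewrite invr_gt0.
have /choice[r rP] : forall i, exists r : rat, `|ratr r - x ord0 i| < k.+1%:R^-1.
  move=> i; have /rat_in_itvoo[r] : x ord0 i < x ord0 i + k.+1%:R^-1 by rewrite ltrDl.
  rewrite in_itv/= => /andP[xr rx]; exists r.
  by rewrite ger0_norm ?subr_ge0 ?ltW// ltrBlDl.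
exists (\row_i r i, k) => //; case: (pselect _) => [? i|[]].
  by rewrite /= !mxE -ball_normE/=.
move=> y yB; apply: xeA; rewrite -ball_normE/=; apply: rV_norm_lt => // i.
rewrite !mxE; have := yB i; rewrite /= !mxE -ball_normE/= => yri.
rewrite (_ : _ - _ = (x ord0 i - ratr (r i)) + (ratr (r i) - y ord0 i)); last first.
  by rewrite addrA subrK.
rewrite (le_lt_trans (ler_normD _ _))// distrC.
by move: (rP i) yri ke; move: (k.+1%:R^-1) => t; lra.
Qed.

Lemma continuous_measurable_rV (f : 'rV[R]_n -> R) :
  continuous f -> measurable_fun [set: 'rV[R]_n] f.
Proof.
move=> /continuousP cf; apply: (measurability _ (RGenOpens.measurableE R)).
move=> _ [_ [a [b ->] <-]]; rewrite setTI; apply: open_measurable_rV.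
exact/cf/interval_open.
Qed.

(** Open sets are stable under intersection, so this permits a Dynkin induction that starts from
    them. *)
Lemma measurable_rVE : @measurable _ 'rV[R]_n = <<s @open 'rV[R]_n >>.
Proof.
apply/seteqP; split; last first.
  apply: smallest_sub; first exact: sigma_algebra_measurable.
  by move=> A; exact: open_measurable_rV.
apply: smallest_sub; first exact: smallest_sigma_algebra.
rewrite -bigcup_seq/= => _ [i _ [B mB <-]].
have : measurable_fun [set: g_sigma_algebraType (@open 'rV[R]_n)]
    (fun v : g_sigma_algebraType (@open 'rV[R]_n) => (v : 'rV[R]_n) ord0 i).
  apply: (measurability _ (RGenOpens.measurableE R)).
  move=> _ [_ [a [b ->] <-]]; rewrite setTI; apply: sub_sigma_algebra.
  have /continuousP := @coord_continuous R 1 n ord0 i.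
  by apply; exact: interval_open.
by move=> /(_ measurableT _ mB).
Qed.

Lemma measurable_rV_ball M : measurable [set x : 'rV[R]_n | `|x| <= M].
Proof.
rewrite -[X in measurable X]setTI.
have : measurable_fun [set: 'rV[R]_n] (@Num.norm _ 'rV[R]_n).
  by apply: continuous_measurable_rV => x; exact: norm_continuous.
move=> /(_ measurableT `]-oo, M]%classic (measurable_itv _)).
by congr measurable; apply/seteqP; split => x /=; rewrite in_itv.
Qed.

Lemma lebesgue_rV_ball_fin M : (lebesgue_rV R n [set x : 'rV[R]_n | (`|x| <= M)%R] < +oo)%E.
Proof.
pose B (_ : 'I_n) := [set` `[- M, M]].
apply: (@le_lt_trans _ _ (lebesgue_rV R n [set x | forall i, B i (x ord0 i)])).
  apply: le_measure; rewrite ?inE.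
  - exact: measurable_rV_ball.
  - by apply: (@measurable_rV_box B) => i; exact: measurable_itv.
  - move=> x xM i; rewrite /B /= in_itv/= -ler_norml.
    exact: le_trans (coord_le_norm _ _) xM.
rewrite lebesgue_rV_box; last by move=> i; exact: measurable_itv.
have : (\prod_(i < n) lebesgue_measure (B i))%E \is a fin_num.
  apply: (big_ind (fun u : \bar R => u \is a fin_num)) => // [x y|i _].
    exact: fin_numM.
  by rewrite /B lebesgue_measure_itv/=; case: ifP.
by rewrite fin_num_abs => /(le_lt_trans (lee_abs _)).
Qed.

Lemma compact_sub_ball A : compact A -> exists2 M, 0 < M & A `<=` [set x | `|x| <= M].
Proof.
move=> /compact_bounded[M [_ AM]]; exists (`|M| + 1).
  by rewrite ltr_wpDl.
by move=> x /AM; apply; rewrite (le_lt_trans (ler_norm _))// ltrDl.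
Qed.

Lemma compact_rV_ball M : compact [set x : 'rV[R]_n | `|x| <= M].
Proof.
apply: bounded_closed_compact.
  by exists M; split; [exact: num_real|move=> x Mx y /= /le_trans; apply; exact: ltW].
rewrite (_ : [set _ | _] = (@Num.norm _ 'rV[R]_n) @^-1` [set t | t <= M]) //.
by apply: closed_comp => [x _|]; [exact: norm_continuous|exact: closed_le].
Qed.

End rV_topology.

(** * Translations are continuous in L^1 *)

Section ereal_cvg0.
Context {R : realType}.
Local Open Scope ereal_scope.

Lemma cvge0_le (f : nat -> \bar R) : (forall k, 0 <= f k) ->
  (forall e : R, (0 < e)%R -> \forall k \near \oo, f k <= e%:E) -> f @ \oo --> 0.
Proof.
move=> f0 fe; apply/fine_cvgP; split.
  have := fe _ (@ltr01 R); apply: filterS => k fk.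
  by rewrite ge0_fin_numE// (le_lt_trans fk)// ltry.
apply/cvgrPdist_le => e e0; have := fe _ e0; apply: filterS => k fk.
rewrite sub0r normrN ger0_norm ?fine_ge0//= -lee_fin fineK//.
by rewrite ge0_fin_numE// (le_lt_trans fk)// ltry.
Qed.

Lemma near_cvge0 (f : nat -> \bar R) (e : R) : f @ \oo --> 0 -> (0 < e)%R ->
  \forall k \near \oo, f k < e%:E.
Proof.
move=> /fine_cvgP[ffin f0] e0.
move: f0 => /cvgr0_norm_lt /(_ _ e0); apply: filterS2 ffin => k fk.
by move=> /(le_lt_trans (ler_norm _)); rewrite -lte_fin fineK.
Qed.

End ereal_cvg0.

Section norm1.
Context d (T : measurableType d) (R : realType)
  (mu : {measure set T -> \bar R}).
Implicit Types u v w : T -> R.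
Local Open Scope ereal_scope.

Definition norm1 u : \bar R := \int[mu]_x `|u x|%:E.

Lemma measurable_normE u : measurable_fun setT u ->
  measurable_fun setT (fun x => `|u x|%:E).
Proof. by move=> mu_; apply/measurable_EFinP; exact: measurableT_comp. Qed.

Lemma norm1_ge0 u : 0 <= norm1 u. Proof. by apply: integral_ge0. Qed.

Lemma le_norm1 u v : measurable_fun setT u -> measurable_fun setT v ->
  (forall x, (`|u x| <= `|v x|)%R) -> norm1 u <= norm1 v.
Proof.
move=> mf mg uv; apply: ge0_le_integral => //; try exact: measurable_normE.
by move=> x _; rewrite lee_fin.
Qed.

Lemma norm1_triangle u v w : measurable_fun setT u -> measurable_fun setT v ->
  measurable_fun setT w -> (forall x, (`|w x| <= `|u x| + `|v x|)%R) ->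
  norm1 w <= norm1 u + norm1 v.
Proof.
move=> mf mg mh wuv; rewrite /norm1 -ge0_integralD//; try exact: measurable_normE.
apply: ge0_le_integral => //; first exact: measurable_normE.
  by apply: emeasurable_funD; exact: measurable_normE.
by move=> x _; rewrite -EFinD lee_fin.
Qed.

Lemma integrable_norm1 u : mu.-integrable setT (EFin \o u) ->
  measurable_fun setT u /\ norm1 u < +oo.
Proof.
move=> /integrableP[/measurable_EFinP mf uoo]; split => //.
Qed.

Lemma norm1_integrable u : measurable_fun setT u -> norm1 u < +oo ->
  mu.-integrable setT (EFin \o u).
Proof.
by move=> mf uoo; apply/integrableP; split => //; exact/measurable_EFinP.
Qed.

End norm1.

Section translation.
Context {R : realType} {n : nat}.
Local Notation mu := (lebesgue_rV R n).
Implicit Types u v : 'rV[R]_n -> R.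

Lemma measurable_shift_rV u (h : 'rV[R]_n) : measurable_fun setT u ->
  measurable_fun setT (fun x : 'rV[R]_n => u (x + h)).
Proof.
move=> mf; apply: (measurableT_comp mf).
by have := measurable_addZ_rV 1 h; under eq_fun do rewrite scale1r.
Qed.

Lemma norm1_shift u h : measurable_fun setT u ->
  norm1 mu (fun x : 'rV[R]_n => u (x + h)) = norm1 mu u.
Proof.
move=> mf; have := @ge0_integral_affine R n 1 h (fun x => `|u x|%:E).
rewrite normr1 invr1 expr1n mul1e /norm1 => <-//; last exact: measurable_normE.
by apply: eq_integral => x _; rewrite scale1r.
Qed.

Definition shift_dist u h : \bar R := norm1 mu (fun x : 'rV[R]_n => u (x + h) - u x).

(** Sequential, to match dominated convergence, by which it is both proved and used. *)
Definition shift_continuous u := forall h : nat -> 'rV[R]_n, h @ \oo --> (0 : 'rV[R]_n) ->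
  (fun k => shift_dist u (h k)) @ \oo --> 0%E.

Lemma shift_dist_ge0 u h : (0 <= shift_dist u h)%E.
Proof. exact: norm1_ge0. Qed.

Lemma measurable_shiftB u h : measurable_fun setT u ->
  measurable_fun setT (fun x : 'rV[R]_n => u (x + h) - u x).
Proof. by move=> mf; apply: measurable_funB => //; exact: measurable_shift_rV. Qed.

Lemma shift_dist_triangle u v w h : measurable_fun setT u -> measurable_fun setT v ->
  measurable_fun setT w -> (forall x, w x = u x + v x) ->
  (shift_dist w h <= shift_dist u h + shift_dist v h)%E.
Proof.
move=> mf mg mw wE; apply: norm1_triangle; try exact: measurable_shiftB.
move=> x; rewrite !wE (_ : _ - _ = (u (x + h) - u x) + (v (x + h) - v x)).
  exact: ler_normD.
by ring.
Qed.

Lemma shift_dist_le u h : measurable_fun setT u ->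
  (shift_dist u h <= norm1 mu u + norm1 mu u)%E.
Proof.
move=> mf; rewrite -{1}(norm1_shift h mf).
apply: norm1_triangle => //; [exact: measurable_shift_rV|exact: measurable_shiftB|].
by move=> x; exact: ler_normB.
Qed.

Lemma shift_continuousD u v w : measurable_fun setT u -> measurable_fun setT v ->
  (forall x, w x = u x + v x) ->
  shift_continuous u -> shift_continuous v -> shift_continuous w.
Proof.
move=> mf mg wE cu cv h h0.
have mw : measurable_fun setT w.
  by rewrite (_ : w = fun x => u x + v x) ?funeqE//; exact: measurable_funD.
apply: (@squeeze_cvge _ _ _ _ (cst 0%E) _
  (fun k => shift_dist u (h k) + shift_dist v (h k))%E).
- apply: nearW => k; rewrite shift_dist_ge0/=; exact: shift_dist_triangle.
- exact: cvg_cst.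
- by rewrite -[X in _ --> X]adde0; apply: cvgeD => //; [exact: cu|exact: cv].
Qed.

Lemma shift_continuousZ (c : R) u w : measurable_fun setT u ->
  (forall x, w x = c * u x) -> shift_continuous u -> shift_continuous w.
Proof.
move=> mf wE cu h h0.
rewrite (_ : (fun k => _) = (fun k => `|c|%:E * shift_dist u (h k))%E).
  by rewrite -[X in _ --> X](mule0 `|c|%:E); apply: cvgeZl => //; exact: cu.
apply/funext => k; rewrite /shift_dist /norm1 -ge0_integralZl//; last first.
  by apply: measurable_normE; exact: measurable_shiftB.
by apply: eq_integral => x _; rewrite !wE -mulrBr normrM EFinM.
Qed.

Lemma shift_continuous_closed u : measurable_fun setT u ->
  (forall e : R, 0 < e -> exists v, [/\ measurable_fun setT v, shift_continuous v
     & (norm1 mu (fun x : 'rV[R]_n => (u x - v x)%R) <= e%:E)%E]) ->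
  shift_continuous u.
Proof.
move=> mf app h h0; apply: cvge0_le => [k|e e0]; first exact: shift_dist_ge0.
have e4 : 0 < e / 4 by rewrite divr_gt0.
have [v [mg cv uv]] := app _ e4.
have := near_cvge0 (cv _ h0) e4; apply: filterS => k vk.
have muv : measurable_fun setT (fun x : 'rV[R]_n => u x - v x) by exact: measurable_funB.
have := @shift_dist_triangle v _ u (h k) mg muv mf.
move=> /(_ (fun x => esym (subrKC (v x) (u x)))) /le_trans; apply.
(* One quarter bounds the shift of v, two bound that of u - v through its norm, and the last is
   slack. *)
rewrite (_ : e%:E = (e / 4)%:E + ((e / 4)%:E + (e / 4)%:E + (e / 4)%:E))%E; last first.
  by rewrite -!EFinD; congr EFin; field.
apply: leeD; first exact: ltW.
apply: (le_trans (shift_dist_le _ muv)).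
by rewrite -[leLHS]adde0; apply: leeD; [exact: leeD|rewrite lee_fin ltW].
Qed.

End translation.

Section L1_translation.
Context {R : realType} {n : nat}.
Local Notation mu := (lebesgue_rV R n).
Implicit Types (u v : 'rV[R]_n -> R) (A B : set 'rV[R]_n).

Lemma norm1_indic A : measurable A -> norm1 mu \1_A = mu A.
Proof.
move=> mA; rewrite /norm1 -{2}(setIT A) -integral_indic//.
by apply: eq_integral => x _; rewrite ger0_norm.
Qed.

(** Openness gives pointwise convergence at the points of A; [d k] lives there and is dominated by
    [\1_A]. The other half of the symmetric difference of A and its translate has the same measure,
    because both sets have the same finite measure. [distE] expresses this by adding mu A to both
    sides, in translated form on the right. *)
Lemma shift_continuous_open A : open A -> (mu A < +oo)%E ->
  shift_continuous (\1_A : 'rV[R]_n -> R).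
Proof.
move=> oA muA h h0; have mA := open_measurable_rV oA.
have mf : measurable_fun setT (\1_A : 'rV[R]_n -> R) by exact/measurable_indicP.
have mfh k := measurable_shift_rV (h k) mf.
pose d (k : nat) (x : 'rV[R]_n) : R := \1_A x * (1 - \1_A (x + h k)).
have d0 k x : 0 <= d k x.
  by rewrite /d mulr_ge0// !indicE; case: (_ \in A); rewrite ?subrr ?subr0.
have md k : measurable_fun setT (d k).
  by apply: measurable_funM => //; apply: measurable_funB.
have distE k : shift_dist \1_A (h k) = (norm1 mu (d k) + norm1 mu (d k))%E.
  have muAfin : mu A \is a fin_num by rewrite ge0_fin_numE.
  rewrite -[LHS](addeK _ muAfin) -[RHS](addeK _ muAfin); congr (_ - _)%E.
  rewrite -{1}(norm1_indic mA) -[in RHS](norm1_indic mA) -[in RHS](norm1_shift (h k) mf).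
  have mdist := measurable_shiftB (h k) mf.
  rewrite /shift_dist /norm1 -!ge0_integralD//; try exact: measurable_normE.
    apply: eq_integral => x _; rewrite -!EFinD /d !indicE; congr EFin.
    by case: (_ \in A); case: (_ \in A);
      rewrite /= ?subrr ?subr0 ?sub0r ?normrN ?mulr0 ?mul0r ?mul1r ?normr0 ?normr1 ?addr0 ?add0r.
    by move=> x _; rewrite -EFinD lee_fin addr_ge0.
  by apply: emeasurable_funD; exact: measurable_normE.
rewrite (_ : (fun k => _) = (fun k => norm1 mu (d k) + norm1 mu (d k))%E); last first.
  by apply/funext.
have dcvg : (fun k => norm1 mu (d k)) @ \oo --> 0%E.
  rewrite -(integral0 mu setT).
  apply: (@dominated_cvg _ _ _ _ _ measurableT _ _ (EFin \o \1_A)) => //.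
  - by move=> k; exact: measurable_normE.
  - move=> x _; apply: cvg_near_cst.
    have [Ax|Ax] := pselect (A x); last first.
      by apply: nearW => k; rewrite /d indicE memNset// mul0r normr0.
    have xh : (fun k => x + h k) @ \oo --> x.
      by rewrite -[X in _ --> X]addr0; apply: cvgD => //; exact: cvg_cst.
    have : \forall k \near \oo, A (x + h k) by apply: xh; exact: open_nbhs_nbhs.
    by apply: filterS => k Axh; rewrite /d !indicE !mem_set// subrr mulr0 normr0.
  - by apply: norm1_integrable => //; rewrite norm1_indic.
  - move=> k x _ /=; rewrite lee_fin normr_id /d !indicE.
    by case: (_ \in A); case: (_ \in A); rewrite ?subrr ?subr0 ?mulr0 ?mul0r ?mul1r ?normr0 ?normr1.
by rewrite -[X in _ --> X]adde0; apply: cvgeD.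
Qed.

(** Dynkin induction on the open sets. The ball keeps all measures finite, so that complements
    become differences and countable disjoint unions become L^1 limits of finite ones. *)
Lemma shift_continuous_indic A M : measurable A ->
  shift_continuous (\1_(A `&` [set x : 'rV[R]_n | `|x| < M]) : 'rV[R]_n -> R).
Proof.
set B := [set x : 'rV[R]_n | `|x| < M] => mA.
have oB : open B.
  rewrite (_ : B = (@Num.norm _ 'rV[R]_n) @^-1` [set t | t < M])//.
  by apply: open_comp => [x _|]; [exact: norm_continuous|exact: open_lt].
have mB : measurable B by exact: open_measurable_rV.
have muB : (mu B < +oo)%E.
  apply: le_lt_trans (lebesgue_rV_ball_fin M); apply: le_measure; rewrite ?inE//.
    exact: measurable_rV_ball.
  by move=> x /ltW.
have muS S : measurable S -> (mu (S `&` B) < +oo)%E.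
  move=> mS; apply: le_lt_trans muB; apply: le_measure; rewrite ?inE//.
  exact: measurableI.
have mi S : measurable S -> measurable_fun setT (\1_S : 'rV[R]_n -> R).
  by move=> ?; exact/measurable_indicP.
move: A mA; rewrite measurable_rVE.
apply: (@dynkin_induction _ _ _ (fun A => shift_continuous (\1_(A `&` B)))).
- exact: measurable_rVE.
- by move=> S S' oS oS'; exact: openI.
- by rewrite setTI; exact: shift_continuous_open.
- by move=> S oS; apply: shift_continuous_open; [exact: openI|apply: muS; exact: open_measurable_rV].
- move=> S mS cS; have mSB : measurable (S `&` B) by exact: measurableI.
  apply: (@shift_continuousD _ _ \1_B (fun x => -1 * \1_(S `&` B) x)) => //.
  + by apply: measurable_funM => //; exact: (mi _ mSB).
  + move=> x; rewrite !indicE !in_setI in_setC.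
    by case: (_ \in S); case: (_ \in B); rewrite /= ?mulr0 ?mulr1 ?addr0 ?subrr.
  + exact: shift_continuous_open.
  + by apply: shift_continuousZ cS => //; exact: (mi _ mSB).
move=> F mF tF cF.
pose S (m : nat) := \big[setU/set0]_(k < m) F k.
have mS m : measurable (S m) by exact: bigsetU_measurable.
have cS m : shift_continuous (\1_(S m `&` B) : 'rV[R]_n -> R).
  elim: m => [|m ih].
    rewrite /S big_ord0 set0I.
    apply: (@shift_continuousZ _ _ 0 \1_B) => //.
    + by move=> x; rewrite mul0r indicE memNset.
    + exact: shift_continuous_open.
  apply: (@shift_continuousD _ _ \1_(S m `&` B) \1_(F m `&` B)) => //.
  + by apply: mi; exact: measurableI.
  + by apply: mi; exact: measurableI.
  + move=> x; rewrite !indicE !in_setI /S big_ord_recr /= in_setU -/(S m).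
    have : ~ (S m x /\ F m x).
      rewrite /S -bigcup_mkord => -[[k /= km Fk] Fm].
      by have := trivIsetP.1 tF k m I I; rewrite (ltn_eqF km) => /(_ isT) E; rewrite -[False]/(set0 x) -E.
    have [xS|xS] := boolP (x \in S m); have [xF|xF] := boolP (x \in F m);
      case: (x \in B); rewrite /= ?addr0 ?add0r//.
    by case; split; exact/set_mem.
have mUF : measurable (\bigcup_k F k) by exact: bigcupT_measurable.
apply: shift_continuous_closed; first by apply: mi; exact: measurableI.
move=> e e0.
have : (fun m => norm1 mu (fun x => \1_(\bigcup_k F k `&` B) x - \1_(S m `&` B) x)) @ \oo --> 0%E.
  rewrite -(integral0 mu setT).
  apply: (@dominated_cvg _ _ _ _ _ measurableT _ _ (EFin \o \1_B)) => //.
  - move=> m; apply: measurable_normE; apply: measurable_funB; apply: mi; exact: measurableI.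
  - move=> x _; apply: cvg_near_cst.
    have [[k _ Fk]|Fx] := pselect ((\bigcup_k F k) x); last first.
      apply: nearW => m; rewrite !indicE !in_setI (memNset Fx).
      rewrite (@memNset _ (S m))/= ?subrr ?normr0//.
      by rewrite /S -bigcup_mkord => -[k _ Fk]; apply: Fx; exists k.
    exists k.+1 => // m /= km; rewrite !indicE !in_setI (@mem_set _ (\bigcup_k F k)); last by exists k.
    rewrite (@mem_set _ (S m)) ?subrr ?normr0//.
    by rewrite /S -bigcup_mkord; exists k.
  - apply: norm1_integrable; first exact: (mi _ mB).
    by rewrite norm1_indic.
  - move=> m x _ /=; rewrite lee_fin normr_id !indicE !in_setI.
    case: (x \in B); case: (x \in S m); case: (x \in \bigcup_k F k);
      by rewrite /= ?subrr ?subr0 ?sub0r ?normrN ?normr0 ?normr1.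
move=> /near_cvge0 /(_ e0) [m _ mP]; exists \1_(S m `&` B); split => //.
  by apply: mi; exact: measurableI.
by apply: ltW; exact: (mP m (leqnn m)).
Qed.

Import HBSimple.

(** Simple functions approximate u. Multiplying them by [\1_B] brings them no further from u, which
    vanishes off B, and makes them combinations of the indicators of [shift_continuous_indic]. *)
Lemma shift_continuous_integrable u M : mu.-integrable setT (EFin \o u) ->
  (forall x, M <= `|x| -> u x = 0) -> shift_continuous u.
Proof.
move=> iu u0; have [mf _] := integrable_norm1 iu.
set B := [set x : 'rV[R]_n | `|x| < M].
have mB : measurable B.
  apply: open_measurable_rV.
  rewrite (_ : B = (@Num.norm _ 'rV[R]_n) @^-1` [set t | t < M])//.
  by apply: open_comp => [x _|]; [exact: norm_continuous|exact: open_lt].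
have [g [ig _ gu]] := approximation_sfun_integrable measurableT iu.
apply: shift_continuous_closed => // e e0.
have [m _ /(_ m (leqnn m)) mP] := near_cvge0 gu e0.
have mi S : measurable S -> measurable_fun setT (\1_S : 'rV[R]_n -> R).
  by move=> ?; exact/measurable_indicP.
have mgm : measurable_fun setT (g m : 'rV[R]_n -> R) by exact: measurable_funPT.
have mS i : measurable ((g m @^-1` [set i]) `&` B : set 'rV[R]_n).
  by apply: measurableI => //; rewrite -[X in measurable X]setTI; exact: mgm.
have mg : measurable_fun setT (fun x : 'rV[R]_n => g m x * \1_B x).
  by apply: measurable_funM => //; exact: (mi _ mB).
exists (fun x : 'rV[R]_n => g m x * \1_B x); split => //.
- pose s := finmap.enum_fset (fset_set (range (g m))).
  have gE (x : 'rV[R]_n) : g m x * \1_B x =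
      \sum_(i <- s) i * \1_((g m @^-1` [set i]) `&` B) x.
    rewrite {1}fimfunEord -(big_mkord xpredT (fun i => s`_i * \1_(g m @^-1` [set s`_i]) x)).
    rewrite -(big_nth 0 xpredT (fun i => i * \1_(g m @^-1` [set i]) x)) mulr_suml.
    by apply: eq_bigr => i _; rewrite -mulrA indicI.
  rewrite (funext gE); elim: s {gE} => [|c s ih].
    apply: (@shift_continuousZ _ _ 0 \1_B) => //.
      by move=> x; rewrite mul0r big_nil.
    by have := @shift_continuous_indic setT M measurableT; rewrite setTI.
  apply: (@shift_continuousD _ _ (fun x => c * \1_((g m @^-1` [set c]) `&` B) x)
    (fun x => \sum_(i <- s) i * \1_((g m @^-1` [set i]) `&` B) x)) => //.
  + by apply: measurable_funM => //; exact: (mi _ (mS c)).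
  + by apply: measurable_sum => i; apply: measurable_funM => //; exact: (mi _ (mS i)).
  + by move=> x; rewrite big_cons.
  + apply: (@shift_continuousZ _ _ c \1_((g m @^-1` [set c]) `&` B)) => //.
    apply: shift_continuous_indic; rewrite -[X in measurable X]setTI; exact: mgm.
- apply: le_trans (ltW mP); apply: ge0_le_integral => //.
  + by apply: measurable_normE; exact: measurable_funB.
  + have := @measurable_normE _ _ R (fun x : 'rV[R]_n => u x - g m x).
    by apply; exact: measurable_funB.
  + move=> x _ /=; rewrite lee_fin indicE.
    have [xB|xB] := boolP (x \in B); first by rewrite mulr1.
    by rewrite u0 ?mulr0 ?subr0 ?normr0// leNgt; apply: contra xB => ?; rewrite inE.
Qed.

End L1_translation.

(** * Directional derivatives on row vectors *)

Section eq_line.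
Context {R : realType} {U V W : normedModType R}.
Variables (f : U -> W) (g : V -> W) (x v : U) (y w : V).
Hypothesis fg : forall h : R, f (h *: v + x) = g (h *: w + y).

Let growthE : (fun h : R => h^-1 *: ((f \o shift x) (h *: v) - f x)) =
              (fun h : R => h^-1 *: ((g \o shift y) (h *: w) - g y)).
Proof.
apply/funext => h /=; rewrite fg; congr (_ *: (_ - _)).
by have := fg 0; rewrite !scale0r !add0r.
Qed.

(** A directional derivative sees only one line, so the two functions have to agree only there and
    may live on different spaces. *)
Lemma eq_derive_line : 'D_v f x = 'D_w g y.
Proof. by rewrite /derive growthE. Qed.

Lemma eq_derivable_line : derivable g y w -> derivable f x v.
Proof. by rewrite /derivable growthE. Qed.

End eq_line.

Section lines.
Context {R : realType} {V W : normedModType R}.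
Implicit Types (f : V -> W) (x v : V).

Lemma is_derive_line f x v (t : R) : derivable f (x + t *: v) v ->
  is_derive t (1 : R) (fun s : R => f (x + s *: v)) ('D_v f (x + t *: v)).
Proof.
move=> df.
have E : (fun h : R => h^-1 *: (((fun s : R => f (x + s *: v)) \o shift t) (h *: 1) - f (x + t *: v))) =
    (fun h : R => h^-1 *: ((f \o shift (x + t *: v)) (h *: v) - f (x + t *: v))).
  apply/funext => h /=; congr (_ *: (f _ - _)).
  by rewrite [h *: 1]mulr1 scalerDl addrCA addrA addrC addrA.
by apply: DeriveDef; rewrite /derivable /derive E.
Qed.

Lemma derive_addZ f (a : R) (b : V) v x :
  'D_v (fun y => f (a *: y + b)) x = 'D_(a *: v) f (a *: x + b).
Proof.
by apply: eq_derive_line => h; rewrite scalerDr -addrA !scalerA mulrC.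
Qed.

Lemma derivable_addZ f (a : R) (b : V) v x :
  derivable f (a *: x + b) (a *: v) -> derivable (fun y => f (a *: y + b)) x v.
Proof.
apply: eq_derivable_line => h; by rewrite scalerDr -addrA !scalerA mulrC.
Qed.

End lines.

Section rV_calculus.
Context {R : realType} {n : nat}.
Implicit Types (f g : 'rV[R]_n -> R) (x v : 'rV[R]_n) (M C : R).

Lemma MVT_line f x v (t : R) : 0 <= t -> (forall y, derivable f y v) ->
  exists2 c : R, 0 <= c <= t & f (x + t *: v) - f x = 'D_v f (x + c *: v) * t.
Proof.
move=> t0 df.
have dl (s : R) := is_derive_line (df (x + s *: v)).
have cl : {within `[0, t], continuous (fun s : R => f (x + s *: v))}.
  apply: derivable_within_continuous => s _; exact: (@ex_derive _ _ _ _ _ _ _ (dl s)).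
have [c] := MVT_segment t0 (fun s _ => dl s) cl.
by rewrite in_itv/= scale0r addr0 subr0; exists c.
Qed.

Lemma derive_coordE f x v : differentiable f x ->
  'D_v f x = \sum_j v ord0 j * 'D_'e_j f x.
Proof.
move=> df; rewrite deriveE// {1}(row_sum_delta v) linear_sum/=.
by apply: eq_bigr => j _; rewrite linearZ deriveE.
Qed.

Lemma rV_lipschitz f M C : 0 <= C -> (forall x, differentiable f x) ->
  (forall x j, `|x| <= M -> `|'D_'e_j f x| <= C) ->
  forall x y, `|x| <= M -> `|y| <= M -> `|f x - f y| <= C *+ n * `|x - y|.
Proof.
move=> C0 df fC x y xM yM.
have [c /andP[c0 c1]] := @MVT_line f y (x - y) 1 ler01 (fun z => diff_derivable (df z)).
rewrite scale1r mulr1 subrKC => ->.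
have zM : `|y + c *: (x - y)| <= M.
  rewrite (_ : _ + _ = (1 - c) *: y + c *: x); last first.
    by rewrite scalerBr scalerBl scale1r addrA addrAC.
  rewrite (le_trans (ler_normD _ _))// !normrZ ger0_norm ?subr_ge0// (ger0_norm c0).
  rewrite (_ : M = (1 - c) * M + c * M); last by ring.
  by rewrite lerD// ler_wpM2l// subr_ge0.
rewrite derive_coordE// (le_trans (ler_norm_sum _ _ _))//.
rewrite (le_trans (ler_sum _ (G := fun=> `|x - y| * C) _))//.
  by move=> j _; rewrite normrM ler_pM// ?fC// coord_le_norm.
by rewrite sumr_const card_ord mulrnAl mulrC.
Qed.

Lemma continuous_bounded_on_ball f M : continuous f ->
  exists2 C, 0 <= C & forall x, `|x| <= M -> `|f x| <= C.
Proof.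
move=> cf; have /compact_bounded : compact (f @` [set x | `|x| <= M]).
  apply: continuous_compact; last exact: compact_rV_ball.
  exact: continuous_subspaceT.
move=> [C [_ fC]]; exists (`|C| + 1); first by rewrite addr_ge0.
move=> x xM; apply: (fC (`|C| + 1)); last by exists x.
by rewrite (le_lt_trans (ler_norm _))// ltrDl.
Qed.

Lemma integrable_supp_ball f M C : measurable_fun setT f ->
  (forall x, `|f x| <= C) -> (forall x, M <= `|x| -> f x = 0) ->
  (lebesgue_rV R n).-integrable setT (EFin \o f).
Proof.
move=> mf fC f0.
have mB := @measurable_rV_ball R n M.
suff : (lebesgue_rV R n).-integrable [set x : 'rV[R]_n | `|x| <= M] (EFin \o f).
  move/(integrable_mkcond _ mB); congr (_.-integrable _ _); apply/funext => x.
  rewrite /patch; case: ifPn => // /negP xM; rewrite /= f0//.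
  by rewrite ltW// ltNge; apply/negP => xM'; apply: xM; rewrite inE.
apply: measurable_bounded_integrable => //; first exact: lebesgue_rV_ball_fin.
  exact: measurable_funTS.
by exists C; split; [exact: num_real|move=> y Cy x _ /=; rewrite (le_trans (fC x))// ltW].
Qed.

Lemma integrable_continuous_supp f M : continuous f ->
  (forall x, M <= `|x| -> f x = 0) ->
  (lebesgue_rV R n).-integrable setT (EFin \o f).
Proof.
move=> cf f0; have [C C0 fC] := continuous_bounded_on_ball M cf.
apply: (@integrable_supp_ball _ M C) => //.
  exact: continuous_measurable_rV.
move=> x; have [xM|xM] := leP `|x| M; first exact: fC.
by rewrite f0 ?normr0// ltW.
Qed.

Lemma integral_affine (u : 'rV[R]_n -> R) (c : R) (b : 'rV[R]_n) :
  c != 0 -> (lebesgue_rV R n).-integrable setT (EFin \o u) ->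
  (\int[lebesgue_rV R n]_x (u (c *: x + b)%R)%:E =
   (`|c|^-1 ^+ n)%:E * \int[lebesgue_rV R n]_x (u x)%:E)%E.
Proof.
move=> c0 iu; have mf : measurable_fun setT (EFin \o u) by case/integrableP : iu.
rewrite integralE [in RHS]integralE.
have -> : ((fun x => (u (c *: x + b)%R)%:E)^\+ = fun x => (EFin \o u)^\+ (c *: x + b)%R)%E.
  by apply/funext => x; rewrite !funeposE.
have -> : ((fun x => (u (c *: x + b)%R)%:E)^\- = fun x => (EFin \o u)^\- (c *: x + b)%R)%E.
  by apply/funext => x; rewrite !funenegE.
rewrite ge0_integral_affine//; last exact: measurable_funepos.
rewrite ge0_integral_affine//; last exact: measurable_funeneg.
rewrite -muleBr//.
by apply: fin_num_adde_defl; rewrite fin_numN; exact: integrable_neg_fin_num.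
Qed.

Lemma integral_shift (u : 'rV[R]_n -> R) (h : 'rV[R]_n) :
  (lebesgue_rV R n).-integrable setT (EFin \o u) ->
  (\int[lebesgue_rV R n]_x (u (x + h)%R)%:E = \int[lebesgue_rV R n]_x (u x)%:E)%E.
Proof.
move=> iu; have := @integral_affine u 1 h (oner_neq0 _) iu.
rewrite normr1 invr1 expr1n mul1e => <-.
by apply: eq_integral => x _; rewrite scale1r.
Qed.

Lemma derive_supp f v M : (forall x, M <= `|x| -> f x = 0) ->
  forall x, M < `|x| -> 'D_v f x = 0.
Proof.
move=> f0 x Mx; rewrite -(derive_cst (0 : R^o) x v).
apply: near_eq_derive.
have oB : open [set y : 'rV[R]_n | M < `|y|].
  rewrite (_ : [set _ | _] = (@Num.norm _ 'rV[R]_n) @^-1` [set t | M < t])//.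
  by apply: open_comp => [y _|]; [exact: norm_continuous|exact: open_gt].
have : nbhs x [set y : 'rV[R]_n | M < `|y|] by exact: open_nbhs_nbhs.
by apply: filterS => y /= /ltW /f0.
Qed.

(** The difference quotients along v have integral 0 by translation invariance, and converge
    boundedly by the mean value theorem. *)
Lemma integral_derive0 f v M : (forall x, derivable f x v) -> continuous f ->
  continuous ('D_v f) -> (forall x, M <= `|x| -> f x = 0) ->
  (\int[lebesgue_rV R n]_x ('D_v f x)%:E = 0)%E.
Proof.
move=> df cf cdf f0.
have mf := continuous_measurable_rV cf.
have iu := integrable_continuous_supp cf f0.
pose t (k : nat) : R := k.+1%:R^-1.
have t0 k : t k != 0 by rewrite invr_eq0 pnatr_eq0.
pose q k x := (t k)^-1 * (f (x + t k *: v) - f x).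
have mq k : measurable_fun setT (q k).
  by apply: measurable_funM => //; exact: measurable_shiftB.
have iq k : (\int[lebesgue_rV R n]_x (q k x)%:E = 0)%E.
  have ish : (lebesgue_rV R n).-integrable setT (EFin \o (fun x => f (x + t k *: v))).
    have [mf' ioo] := integrable_norm1 iu.
    apply: norm1_integrable; first exact: measurable_shift_rV.
    by rewrite norm1_shift.
  under eq_integral do rewrite EFinM EFinB.
  rewrite integralZl//; last by apply: integrableB.
  by rewrite integralB_EFin// integral_shift// subee ?mule0// integrable_fin_num.
have D0 x : M < `|x| -> 'D_v f x = 0 by exact: derive_supp.
(* A ball of this radius contains the supports of all the quotients, since [t k <= 1]. *)
pose N := `|M| + `|v| + 1.
have [C C0 fC] := continuous_bounded_on_ball N cdf.
have DC x : `|'D_v f x| <= C.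
  have [xM|xM] := leP `|x| N; first exact: fC.
  rewrite D0 ?normr0// (le_lt_trans _ xM)// /N -addrA.
  by rewrite (le_trans (ler_norm _))// lerDl addr_ge0.
have qC k x : `|q k x| <= C.
  rewrite /q; have [|c _ ->] := @MVT_line f x v (t k) _ df; first by rewrite invr_ge0.
  by rewrite mulrCA mulVf// mulr1.
have q0 k x : N <= `|x| -> q k x = 0.
  move=> Nx; rewrite /q !f0 ?subrr ?mulr0//.
    by apply: le_trans Nx; rewrite /N -addrA (le_trans (ler_norm _))// lerDl addr_ge0.
  have -> : x = (x + t k *: v) - t k *: v by rewrite addrK.
  have : `|x| <= `|x + t k *: v| + `|v|.
    rewrite -{1}(addrK (t k *: v) x) (le_trans (ler_normB _ _))// lerD2l normrZ.
    rewrite ger0_norm ?invr_ge0// -[leRHS]mul1r ler_wpM2r// invf_le1 ?ltr0n//.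
    by rewrite ler1n.
  by have := ler_norm M; rewrite addrK; move: Nx; rewrite /N; lra.
transitivity (limn (fun k => (\int[lebesgue_rV R n]_x (q k x)%:E)%E)); last first.
  by rewrite (funext iq) lim_cst.
apply/esym/cvg_lim => //.
apply: (@dominated_cvg _ _ _ _ _ measurableT _ _ (fun x => (C * \1_[set x : 'rV[R]_n | `|x| <= N] x)%:E)) => //.
- by move=> k; apply/measurable_EFinP.
- move=> x _; apply: cvg_EFin; first exact: nearW.
  have tcvg : t @ \oo --> 0^'.
    move=> A A0; have hA : \forall k \near \oo, t k != 0 -> A (t k).
      exact: (@cvg_harmonic R _ A0).
    by apply: filterS hA => k; apply; exact: t0.
  have qcvg : (fun k => (t k)^-1 *: ((f \o shift x) (t k *: v) - f x)) @ \oo --> 'D_v f x.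
    exact: (cvg_comp _ _ tcvg (df x)).
  rewrite (_ : fine \o _ = (fun k => (t k)^-1 *: ((f \o shift x) (t k *: v) - f x)))//.
  by apply/funext => k /=; rewrite /q [x + _]addrC.
- apply: (@integrable_supp_ball _ (N + 1) C).
  + apply: measurable_funM => //; apply/measurable_indicP; exact: measurable_rV_ball.
  + move=> x; rewrite normrM (ger0_norm C0) ger0_norm// indicE.
    by case: (_ \in _); rewrite ?mulr1 ?mulr0.
  + move=> x Nx; rewrite indicE memNset ?mulr0//= => xN.
    by move: (le_trans Nx xN); rewrite gerDl ler10.
- move=> k x _ /=; rewrite lee_fin indicE.
  have [xN|xN] := leP `|x| N; first by rewrite mem_set ?mulr1.
  by rewrite q0 ?normr0 ?mulr_ge0// ltW.
Qed.

End rV_calculus.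

(** * The coefficients of the horizontal fields *)

Section smooth_lemmas.
Context {R : realType} {V W : normedModType R}.
Implicit Types (f : V -> W).

Lemma smooth_continuous f : smooth f -> continuous f.
Proof. by move=> /(_ 0%N). Qed.

Lemma smooth_differentiable f x : smooth f -> differentiable f x.
Proof. by move=> /(_ 1%N)[+ _]; apply. Qed.

Lemma smooth_derive f v : smooth f -> smooth ('D_v f).
Proof. by move=> sf k; have [_] := sf k.+1; apply. Qed.

Lemma smooth_derive_continuous f v : smooth f -> continuous ('D_v f).
Proof. by move=> sf; exact/smooth_continuous/smooth_derive. Qed.

End smooth_lemmas.

Section hfield_lemmas.
Context {R : realType} (G : stratified_group R).
Local Notation n := (hdim G + sumn (vdims G))%N.
Implicit Types (x : 'rV[R]_n) (j : 'I_n) (k : 'I_(hdim G)).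

Definition hcoef k j x : R := hfield k x ord0 j.

Let gm (z : 'rV[R]_n * 'rV[R]_n) := @gmul R G z.1 z.2.
Let e k : 'rV[R]_n := 'e_(lshift (sumn (vdims G)) k).
Let gk k : 'rV[R]_n * 'rV[R]_n -> 'rV[R]_n := 'D_(0, e k) gm.

(** The field is the restriction to y = 0 of a partial derivative of the group law on the product
    space, so its regularity in x comes from [gmul_smooth]. *)
Let hfieldE k x : hfield k x = gk k (x, 0).
Proof.
by apply: eq_derive_line => h; rewrite /gm /= scaler0 add0r.
Qed.

Let derive_hfieldE k v x : 'D_v (@hfield R G k) x = 'D_(v, 0) (gk k) (x, 0).
Proof.
by apply: eq_derive_line => h; rewrite hfieldE; congr (gk k _); congr pair; rewrite /= scaler0 addr0.
Qed.

Let smooth_gk k : smooth (gk k).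
Proof. exact: smooth_derive (gmul_smooth G). Qed.

Lemma derivable_hfield k v x : derivable (@hfield R G k) x v.
Proof.
have : derivable (gk k) (x, 0) (v, 0).
  by apply: diff_derivable; apply: smooth_differentiable.
apply: eq_derivable_line => h.
by rewrite hfieldE; congr (gk k _); congr pair; rewrite /= scaler0 addr0.
Qed.

Lemma differentiable_hcoef k j x : differentiable (hcoef k j) x.
Proof.
have -> : hcoef k j = (fun M : 'rV[R]_n => M ord0 j) \o (gk k \o (fun x => (x, 0))).
  by apply/funext => y; rewrite /hcoef hfieldE.
apply: differentiable_comp; last exact: differentiable_coord.
apply: differentiable_comp.
  by apply: differentiable_pair => //; exact: differentiable_cst.
exact: smooth_differentiable (smooth_gk k).
Qed.

Lemma derive_hcoef k j v x : 'D_v (hcoef k j) x = 'D_v (@hfield R G k) x ord0 j.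
Proof. by rewrite derive_mx ?mxE//; exact: derivable_hfield. Qed.

Lemma continuous_derive_hcoef k j v : continuous ('D_v (hcoef k j)).
Proof.
have -> : 'D_v (hcoef k j) =
    (fun M : 'rV[R]_n => M ord0 j) \o ('D_(v, 0) (gk k) \o (fun x => (x, 0))).
  by apply/funext => x; rewrite derive_hcoef derive_hfieldE.
move=> x; apply: continuous_comp; last exact: coord_continuous.
apply: continuous_comp; last exact: smooth_derive_continuous.
apply: differentiable_continuous.
by apply: differentiable_pair => //; exact: differentiable_cst.
Qed.

(** Strata are counted from 0 here: dilations scale coordinate j by the power [(wt j).+1]. *)
Let wt j : nat := reshape_index (hdim G :: vdims G) j.

Let dil (l : R) (x : 'rV[R]_n) : 'rV[R]_n := @dilation R (hdim G :: vdims G) l x.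

Let wt_lshift k : wt (lshift (sumn (vdims G)) k) = 0%N.
Proof.
by rewrite /wt /reshape_index /=; have := ltn_ord k; rewrite -subn_eq0 => ->.
Qed.

Let dilE (l : R) x j : dil l x ord0 j = l ^+ (wt j).+1 * x ord0 j.
Proof. by rewrite mxE. Qed.

Let dilM (l : R) x y : 0 < l -> dil l (@gmul R G x y) = gmul (dil l x) (dil l y).
Proof. by move=> l0; exact (@dilationM R G l l0 x y). Qed.

Let dil_addZ (l h : R) x j :
  dil l (h *: 'e_j + x) = (h * l ^+ (wt j).+1) *: 'e_j + dil l x .
Proof.
apply/rowP => i; rewrite !(dilE, mxE) mulrDr; congr (_ + _).
by have [->|_] := eqVneq i j; rewrite ?mulr0// !mulr1 mulrC.
Qed.

Let hcoefE k j x : hcoef k j x = 'D_(e k) (fun y => @gmul R G x y ord0 j) 0.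
Proof.
rewrite /hcoef /hfield /left_invariant_field derive_mx ?mxE//.
apply: (@eq_derivable_line _ _ _ _ _ gm _ _ (x, 0) (0, e k)) => [h|].
  by rewrite /gm /= scaler0 add0r.
by apply: diff_derivable; apply: smooth_differentiable; exact: gmul_smooth.
Qed.

Let differentiable_gmul x j y : differentiable (fun y => @gmul R G x y ord0 j) y.
Proof.
have -> : (fun y => @gmul R G x y ord0 j) =
    (fun M : 'rV[R]_n => M ord0 j) \o (gm \o (fun y => (x, y))) by [].
apply: differentiable_comp; last exact: differentiable_coord.
apply: differentiable_comp.
  by apply: differentiable_pair => //; exact: differentiable_cst.
by apply: smooth_differentiable; exact: gmul_smooth.
Qed.

(** Differentiate [dil l (gmul x y) = gmul (dil l x) (dil l y)] in y at 0 along e_k. This direction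
    has weight 1, which accounts for the extra factor l on both sides. *)
Let hcoef_dil l k j x : 0 < l -> hcoef k j (dil l x) = l ^+ wt j * hcoef k j x.
Proof.
move=> l0; suff : l * hcoef k j (dil l x) = l * (l ^+ wt j * hcoef k j x).
  by move/mulfI; apply; rewrite gt_eqF.
rewrite mulrA -exprS !hcoefE.
transitivity ('D_(l *: e k) (fun y => @gmul R G (dil l x) y ord0 j) 0).
  by rewrite !deriveE// linearZ.
transitivity ('D_(e k) (fun y => l ^+ (wt j).+1 * @gmul R G x y ord0 j) 0).
  apply: eq_derive_line => h; rewrite -dilE; congr (_ ord0 j).
  have -> : h *: (l *: e k) + 0 = dil l (h *: e k + 0).
    rewrite dil_addZ wt_lshift expr1 scalerA; congr (_ + _).
    by apply/rowP => i; rewrite dilE !mxE mulr0.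
  by rewrite dilM.
rewrite (_ : (fun _ => _) = l ^+ (wt j).+1 \*o (fun y => @gmul R G x y ord0 j))//.
by rewrite deriveMl//; apply: diff_derivable.
Qed.

Let cvg_dil0 x : (fun i : nat => dil i.+1%:R^-1 x) @ \oo --> (0 : 'rV[R]_n).
Proof.
apply/cvgrPdist_le => eps eps0.
have : (fun i : nat => i.+1%:R^-1 * `|x|) @ \oo --> (0 : R).
  by rewrite -(mul0r `|x|); apply: cvgMl; exact: cvg_harmonic.
move=> /cvgr0_norm_le /(_ _ eps0); apply: filterS => i xi.
rewrite sub0r normrN; apply: rV_norm_le; first exact: ltW.
move=> j; rewrite dilE normrM; apply: le_trans xi.
rewrite [leRHS]normrM normr_id ler_pM ?coord_le_norm// !ger0_norm ?exprn_ge0//.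
by rewrite exprS -[leRHS]mulr1 ler_wpM2l// exprn_ile1// invf_le1// ler1n.
Qed.

(** Differentiating [hcoef_dil] along e_j gives l (d_j a_kj) (dil l x) = (d_j a_kj) (x). As l tends
    to 0, continuity of the derivative at 0 makes the left side vanish. *)
Lemma derive_hcoef0 k j x : 'D_'e_j (hcoef k j) x = 0.
Proof.
have scale (l : R) : 0 < l ->
    l * 'D_'e_j (hcoef k j) (dil l x) = 'D_'e_j (hcoef k j) x.
  move=> l0; have dc y v : derivable (hcoef k j) y v.
    exact/diff_derivable/differentiable_hcoef.
  have : 'D_(l ^+ (wt j).+1 *: 'e_j) (hcoef k j) (dil l x) =
      'D_'e_j (l ^+ wt j \*o hcoef k j) x.
    symmetry; apply: (@eq_derive_line R _ _ _ (l ^+ wt j \*o hcoef k j) (hcoef k j)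
      x 'e_j (dil l x) (l ^+ (wt j).+1 *: 'e_j)) => h.
    rewrite scalerA -dil_addZ; exact/esym/hcoef_dil.
  have -> : 'D_'e_j (l ^+ wt j \*o hcoef k j) x = l ^+ wt j * 'D_'e_j (hcoef k j) x.
    exact: deriveMl.
  have -> : 'D_(l ^+ (wt j).+1 *: 'e_j) (hcoef k j) (dil l x) =
      l ^+ (wt j).+1 * 'D_'e_j (hcoef k j) (dil l x).
    rewrite deriveE; last exact: differentiable_hcoef.
    by rewrite linearZ deriveE//; exact: differentiable_hcoef.
  rewrite exprSr -mulrA => /mulfI; apply.
  by rewrite expf_neq0// gt_eqF.
have cD := @continuous_derive_hcoef k j 'e_j.
have H : (fun i : nat => i.+1%:R^-1 * 'D_'e_j (hcoef k j) (dil i.+1%:R^-1 x)) @ \oo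
    --> 0 * 'D_'e_j (hcoef k j) 0.
  apply: cvgM; first exact: cvg_harmonic.
  exact: (cvg_comp _ _ (@cvg_dil0 x) (cD 0)).
rewrite mul0r in H; apply: (cvg_unique _ _ H) => //.
rewrite (_ : (fun i : nat => _) = cst ('D_'e_j (hcoef k j) x)); first exact: cvg_cst.
by apply/funext => i; rewrite scale// invr_gt0.
Qed.

(** These coefficients are homogeneous of degree 0 and continuous at 0, hence constant; their value
    at 0 is read off from [gmul 0 = id]. *)
Lemma hcoef_lshift k (i : 'I_(hdim G)) x :
  hcoef k (lshift (sumn (vdims G)) i) x = (i == k)%:R.
Proof.
set j := lshift _ i.
have H : (fun m : nat => hcoef k j (dil m.+1%:R^-1 x)) @ \oo --> hcoef k j 0.
  have hc := differentiable_continuous (@differentiable_hcoef k j 0).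
  exact: (cvg_comp _ _ (@cvg_dil0 x) hc).
have H' : (fun m : nat => hcoef k j (dil m.+1%:R^-1 x)) @ \oo --> hcoef k j x.
  rewrite (_ : (fun _ => _) = cst (hcoef k j x)); first exact: cvg_cst.
  by apply/funext => m; rewrite hcoef_dil ?invr_gt0// wt_lshift expr0 mul1r.
rewrite (cvg_unique _ H' H)// /hcoef /hfield /left_invariant_field.
have -> : @gmul R G 0 = id.
  by apply/funext => y; rewrite -{1}(gone0 G) gmul1x.
by rewrite derive_id !mxE eqxx /j eq_lshift.
Qed.

End hfield_lemmas.

(** * Calculus of C^1 functions *)

Section C1at.
Context {R : realType} {n : nat}.
Implicit Types (u v w : 'rV[R]_n -> R) (x y : 'rV[R]_n) (F : R -> R).

(* Only partial derivatives are required: mollified functions are not shown to be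
   Frechet differentiable. *)
Definition C1at v x := [/\ {for x, continuous v},
  \forall y \near x, forall j, derivable v y 'e_j
  & forall j, {for x, continuous ('D_'e_j v)}].

Lemma C1at_derivable v x j : C1at v x -> derivable v x 'e_j.
Proof. by move=> [_ /nbhs_singleton]. Qed.

Lemma C1at_near v w x : (\forall y \near x, v y = w y) -> C1at v x -> C1at w x.
Proof.
move=> vw [cv dv cdv]; have vx := nbhs_singleton vw.
have vww : \forall y \near x, \forall z \near y, v z = w z by exact: near_join.
split.
- have H : v y @[y --> x] --> w x by rewrite -vx.
  exact: (cvg_trans (near_eq_cvg vw) H).
- apply: filterS2 dv vww => y dy yE j.
  exact: near_eq_derivable (dy j).
- move=> j; have H : 'D_'e_j v y @[y --> x] --> 'D_'e_j w x.
    by rewrite -(near_eq_derive _ vw); exact: cdv.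
  have vw' : \forall y \near x, 'D_'e_j v y = 'D_'e_j w y.
    by apply: filterS vww => y yE; exact: near_eq_derive.
  exact: (cvg_trans (near_eq_cvg vw') H).
Qed.

Lemma C1at_cst (c : R) x : C1at (cst c) x.
Proof.
split => [|| j]; first exact: cst_continuous.
  by apply: (@filterS _ (nbhs x) _ setT) filterT => y _ j; exact: derivable_cst.
rewrite (_ : 'D_'e_j _ = cst 0); first exact: cst_continuous.
by apply/funext => y; rewrite derive_cst.
Qed.

Lemma derive_mul v w x (e : 'rV[R]_n) : derivable v x e -> derivable w x e ->
  'D_e (fun y => v y * w y) x = v x * 'D_e w x + w x * 'D_e v x.
Proof. by move=> dv dw; exact: (deriveM dv dw). Qed.

Lemma C1atM v w x : C1at v x -> C1at w x -> C1at (fun y => v y * w y) x.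
Proof.
move=> [cv dv cdv] [cw dw cdw]; split.
- exact: (cvgM cv cw).
- by apply: filterS2 dv dw => y dy dy' j; exact: derivableM.
- move=> j.
  have vwE : \forall y \near x, v y * 'D_'e_j w y + w y * 'D_'e_j v y =
      'D_'e_j (fun y => v y * w y) y.
    by apply: filterS2 dv dw => y dy dy'; rewrite derive_mul.
  have H : (v y * 'D_'e_j w y + w y * 'D_'e_j v y) @[y --> x] -->
      'D_'e_j (fun y => v y * w y) x.
    rewrite -(nbhs_singleton vwE).
    exact: (cvgD (cvgM cv (cdw j)) (cvgM cw (cdv j))).
  exact: (cvg_trans (near_eq_cvg vwE) H).
Qed.

(** The chain rule is applied on the line through x, since only a directional derivative of v is at
    hand. *)
Lemma is_derive_comp1 F v x (e : 'rV[R]_n) : derivable v x e -> derivable F (v x) 1 ->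
  is_derive x e (F \o v) ('D_1 F (v x) * 'D_e v x).
Proof.
move=> dv dF.
have dl := @is_derive_line _ _ _ v x e 0.
rewrite scale0r addr0 in dl.
have {}dl := dl dv.
have dFv : is_derive ((fun s : R => v (x + s *: e)) 0) 1 F ('D_1 F (v x)).
  by rewrite scale0r addr0; apply: derivableP.
have dc := @is_derive1_comp R F (fun s : R => v (x + s *: e)) 0 _ _ dFv dl.
have E (h : R) : (F \o v) (h *: e + x) = (F \o (fun s : R => v (x + s *: e))) (h *: 1 + 0).
  by rewrite /= addr0 [h *: 1]mulr1 addrC.
apply: DeriveDef.
  exact: (eq_derivable_line E (@ex_derive _ _ _ _ _ _ _ dc)).
by rewrite (eq_derive_line E) (@derive_val _ _ _ _ _ _ _ dc).
Qed.

Lemma C1at_comp F v x : C1at v x -> (\forall t \near v x, derivable F t 1) ->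
  {for v x, continuous ('D_1 F)} -> C1at (F \o v) x.
Proof.
move=> [cv dv cdv] dF cdF.
have dFv : \forall y \near x, derivable F (v y) 1 by exact: (cv _ dF).
split.
- have cF : {for v x, continuous F}.
    apply: differentiable_continuous; apply/derivable1_diffP.
    exact: (nbhs_singleton dF).
  exact: (cvg_comp _ _ cv cF).
- apply: filterS2 dv dFv => y dy dFy j.
  exact: (@ex_derive _ _ _ _ _ _ _ (is_derive_comp1 (dy j) dFy)).
- move=> j.
  have FvE : \forall y \near x, 'D_1 F (v y) * 'D_'e_j v y = 'D_'e_j (F \o v) y.
    apply: filterS2 dv dFv => y dy dFy.
    by rewrite (@derive_val _ _ _ _ _ _ _ (is_derive_comp1 (dy j) dFy)).
  have H : ('D_1 F (v y) * 'D_'e_j v y) @[y --> x] --> 'D_'e_j (F \o v) x.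
    rewrite -(nbhs_singleton FvE).
    have H1 : 'D_1 F (v y) @[y --> x] --> 'D_1 F (v x) by exact: (cvg_comp _ _ cv cdF).
    exact: (cvgM H1 (cdv j)).
  exact: (cvg_trans (near_eq_cvg FvE) H).
Qed.

Lemma derive_coord i j x : 'D_'e_j (fun y : 'rV[R]_n => y ord0 i) x = (i == j)%:R.
Proof.
have := @derive_mx R _ 1 n id x 'e_j (@derivable_id _ _ x _).
by rewrite derive_id => /matrixP/(_ ord0 i); rewrite !mxE eqxx /= => ->.
Qed.

Lemma C1at_coord i x : C1at (fun y => y ord0 i) x.
Proof.
split => [||j]; first exact: coord_continuous.
  by apply: (@filterS _ (nbhs x) _ setT) filterT => y _ j; apply/diff_derivable/differentiable_coord.
have -> : 'D_'e_j (fun y : 'rV[R]_n => y ord0 i) = cst ((i == j)%:R : R).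
  by apply/funext => y; rewrite derive_coord.
exact: cst_continuous.
Qed.

Lemma C1at_differentiable v x : (forall y, differentiable v y) ->
  (forall j, continuous ('D_'e_j v)) -> C1at v x.
Proof.
move=> dv cdv; split => [||j]; first exact: differentiable_continuous.
  by apply: (@filterS _ (nbhs x) _ setT) filterT => y _ j; exact: diff_derivable.
exact: cdv.
Qed.

Lemma integral_C1_derive0 v (j : 'I_n) M : (forall x, C1at v x) ->
  (forall x, M <= `|x| -> v x = 0) ->
  (\int[lebesgue_rV R n]_x ('D_'e_j v x)%:E = 0)%E.
Proof.
move=> Cv; apply: integral_derive0 => [x|x|x].
- exact: C1at_derivable.
- by have [] := Cv x.
- by have [_ _] := Cv x; apply.
Qed.

End C1at.

(** * Damped powers *)

Section damped_power.
Context {R : realType}.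
Implicit Types (t c : R).

Lemma is_derive_powR c t : 0 < t -> is_derive t 1 (@powR R ^~ c) (c * t `^ (c - 1)).
Proof.
move=> t0; have tI : t \in `]0, +oo[ by rewrite in_itv/= andbT.
apply: DeriveDef; first exact: derivable_powR.
by rewrite -derive1E powR_derive1.
Qed.

Lemma continuous_norm_powR c : 0 < c -> continuous (fun t => `|t| `^ c).
Proof.
move=> c0 t; have [->|t0] := eqVneq t 0.
  apply/cvgrPdist_le => e e0; rewrite normr0 powR0 ?gt_eqF//.
  have ec0 : 0 < e `^ c^-1 by exact: powR_gt0.
  have : \forall s \near (0 : R), `|s| <= e `^ c^-1.
    exact: nbhs0_le ec0.
  apply: filterS => s se; rewrite sub0r normrN ger0_norm ?powR_ge0//.
  have -> : e = (e `^ c^-1) `^ c by rewrite -powRrM mulVf ?gt_eqF// powRr1 ?(ltW e0).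
  by apply: ge0_ler_powR => //; rewrite ?nnegrE ?powR_ge0//; exact: ltW.
have cpow : {for `|t|, continuous (@powR R ^~ c)}.
  apply: differentiable_continuous; apply/derivable1_diffP.
  have nt0 : 0 < `|t| by rewrite normr_gt0.
  exact: (@ex_derive _ _ _ _ _ _ _ (is_derive_powR c nt0)).
exact: (cvg_comp _ _ (@norm_continuous _ R^o t) cpow).
Qed.

Context (p d : R).
Hypotheses (p1 : 1 < p) (d0 : 0 < d).

Definition damp t := `|t| / (1 + d * `|t|).

(** A damped |t|^p. By [damp_pow_ge] and [norm_damp_pow'], it and its derivative obey the bounds of
    |t|^p and its derivative with [damp] in place of |t|, so the integration by parts keeps the
    constant p. *)
Definition damp_pow t := `|t| * damp t `^ (p - 1).

(** For t > 0 the last factor is 1 + (p - 1) / (1 + d t). Written with [damp], it is seen to lie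
    between 1 and p. *)
Definition damp_pow' t :=
  Num.sg t * (damp t `^ (p - 1) * (p - (p - 1) * (d * damp t))).

Let den_gt0 t : 0 < 1 + d * `|t|.
Proof. by rewrite ltr_pwDl// mulr_ge0// ltW. Qed.

Lemma damp_ge0 t : 0 <= damp t.
Proof. by rewrite divr_ge0// ltW. Qed.

Lemma damp_le t : damp t <= `|t|.
Proof.
rewrite ler_pdivrMr// -[leLHS]mulr1 ler_wpM2l// lerDl mulr_ge0//; exact: ltW.
Qed.

Lemma dM_damp t : d * damp t = 1 - (1 + d * `|t|)^-1.
Proof. by rewrite /damp; field; rewrite gt_eqF. Qed.

Lemma dM_damp_le1 t : d * damp t <= 1.
Proof. by rewrite dM_damp gerBl invr_ge0 ltW. Qed.

Lemma damp_bounded t : damp t <= d^-1.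
Proof. by rewrite -(ler_pM2l d0) mulfV ?gt_eqF// dM_damp_le1. Qed.

Lemma continuous_damp : continuous damp.
Proof.
move=> t; have c1 : `|s| @[s --> t] --> `|t| by exact: (@norm_continuous _ R^o t).
have c2 : (1 + d * `|s|) @[s --> t] --> 1 + d * `|t|.
  exact: (cvgD (cvg_cst _) (cvgM (cvg_cst _) c1)).
have dn0 : 1 + d * `|t| != 0 by rewrite gt_eqF.
exact: (cvgM c1 (cvgV dn0 c2)).
Qed.

Lemma continuous_damp_powR c : 0 < c -> continuous (fun t => damp t `^ c).
Proof.
move=> c0 t.
have H := cvg_comp _ _ (@continuous_damp t) (@continuous_norm_powR _ c0 (damp t)).
have E : (fun s => damp s `^ c) = (fun s => `|s| `^ c) \o damp.
  by apply/funext => s /=; rewrite ger0_norm ?damp_ge0.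
by rewrite E.
Qed.

Let damp_powR_cvg0 : (damp h `^ (p - 1)) @[h --> (0 : R)] --> (0 : R).
Proof.
have p10 : 0 < p - 1 by rewrite subr_gt0.
have dp0 : damp 0 `^ (p - 1) = 0 by rewrite /damp normr0 mul0r powR0 ?gt_eqF.
by rewrite -[X in _ --> X]dp0; exact: continuous_damp_powR.
Qed.

Lemma damp_pow_ge t : damp t `^ p <= damp_pow t.
Proof.
rewrite -mulr_powRB1 ?damp_ge0//; last exact: lt_trans p1.
by rewrite ler_wpM2r ?powR_ge0 ?damp_le.
Qed.

Lemma damp_pow0 : damp_pow 0 = 0.
Proof. by rewrite /damp_pow normr0 mul0r. Qed.

Lemma damp_pow_even t : damp_pow (- t) = damp_pow t.
Proof. by rewrite /damp_pow /damp normrN. Qed.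

Let is_derive_damp_pow_gt0 t : 0 < t -> is_derive t 1 damp_pow (damp_pow' t).
Proof.
move=> t0; pose g s := s / (1 + d * s).
have dt_gt0 : 0 < 1 + d * t by have := den_gt0 t; rewrite gtr0_norm.
have gt0 : 0 < g t by rewrite divr_gt0.
have dt_neq0 : 1 + d * t != 0 by rewrite gt_eqF.
have dg : is_derive t 1 g ((1 + d * t) ^- 2).
  have dden : is_derive t 1 (fun s => 1 + d * s) d.
    apply: (@is_derive_eq _ _ _ _ _ _ _ _ (is_deriveD (is_derive_cst (1 : R) t 1) (is_deriveZ d (is_derive_id t 1)))).
    by rewrite add0r [_ *: _]mulr1.
  have dinv : is_derive t 1 (fun s => (1 + d * s)^-1) (- (1 + d * t) ^- 2 *: d).
    exact: is_deriveV.
  apply: (is_derive_eq (is_deriveM _ dinv)).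
  by rewrite /GRing.scale /=; field.
have dpg := is_derive1_comp (is_derive_powR (p - 1) gt0) dg.
have dF : is_derive t 1 (fun s => s * g s `^ (p - 1)) (damp_pow' t).
  apply: (is_derive_eq (is_deriveM _ dpg)).
  rewrite /damp_pow' /damp gtr0_sg// gtr0_norm// mul1r -/(g t).
  rewrite /GRing.scale /= mulr1.
  have -> : g t `^ (p - 1) = g t * g t `^ (p - 1 - 1).
    have {1}-> : p - 1 = 1 + (p - 1 - 1) by ring.
    by rewrite [LHS]powRD ?(gt_eqF gt0) ?implybT// powRr1 ?ltW.
  by rewrite /g; field.
apply: near_eq_is_derive dF => //.
have : \forall s \near t, 0 < s by exact: lt_nbhsr.
by apply: filterS => s s0; rewrite /damp_pow /damp gtr0_norm.
Qed.

(** At 0 the difference quotient has as modulus the power p - 1 of the damped h, which tends to 0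
    because p > 1. *)
Let is_derive_damp_pow0 : is_derive (0 : R) 1 damp_pow (damp_pow' 0).
Proof.
have -> : damp_pow' 0 = 0 by rewrite /damp_pow' sgr0 mul0r.
suff H : (fun h : R => h^-1 *: ((damp_pow \o shift 0) (h *: 1) - damp_pow 0)) @ 0^' --> (0 : R).
  by apply: DeriveDef; [apply/cvg_ex; exists 0|exact: cvg_lim H].
have p10 : 0 < p - 1 by rewrite subr_gt0.
have c0 := damp_powR_cvg0.
apply/cvgr0Pnorm_le => e e0.
have : \forall h \near (0 : R), `|damp h `^ (p - 1)| <= e by move/cvgr0Pnorm_le : c0; apply.
move/(nbhs_dnbhs); apply: filterS => h he /=.
rewrite addr0 [h *: 1]mulr1 damp_pow0 subr0 normrM /damp_pow normrM normr_id mulrA.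
have [->|h0] := eqVneq h 0; first by rewrite normr0 mulr0 mul0r ltW.
by rewrite normfV mulVf ?normr_eq0// mul1r.
Qed.

Lemma is_derive_damp_pow t : is_derive t 1 damp_pow (damp_pow' t).
Proof.
have [t0|t0|->] := ltgtP t 0; [|exact: is_derive_damp_pow_gt0|exact: is_derive_damp_pow0].
have nt0 : 0 < - t by rewrite oppr_gt0.
have := is_derive1_comp (is_derive_damp_pow_gt0 nt0) (@is_deriveN _ _ _ id _ _ _ (is_derive_id t 1)).
rewrite (_ : damp_pow \o _ = damp_pow); last first.
  by apply/funext => s /=; rewrite -[RHS]damp_pow_even.
move=> H; apply: (is_derive_eq H).
by rewrite /damp_pow' /damp normrN sgrN; ring.
Qed.

Lemma norm_damp_pow' t : `|damp_pow' t| <= p * damp t `^ (p - 1).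
Proof.
have H0 : 0 <= d * damp t by rewrite mulr_ge0 ?damp_ge0// ltW.
have H1 := dM_damp_le1 t.
rewrite /damp_pow' normrM normr_sg normrM (ger0_norm (powR_ge0 _ _)) mulrCA mulrC.
have := powR_ge0 (damp t) (p - 1); set P := _ `^ _ => P0.
move: (d * damp t) H0 H1 => z H0 H1.
have H2 : 0 <= (p - 1) * z by rewrite mulr_ge0 ?subr_ge0 ?(ltW p1).
have H3 : 0 <= (p - 1) * (1 - z) by rewrite mulr_ge0 ?subr_ge0 ?(ltW p1).
have H4 : 0 <= p - (p - 1) * z.
  by rewrite (le_trans H3)// mulrBr mulr1 lerD2r gerBl.
rewrite ler_wpM2r// ger0_norm// (le_trans (ler_piMl H4 _))//; first by case: (t != 0).
by rewrite gerBl.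
Qed.

Lemma continuous_damp_pow' : continuous damp_pow'.
Proof.
have p10 : 0 < p - 1 by rewrite subr_gt0.
move=> t; have [->|t0] := eqVneq t 0.
  have c0 := damp_powR_cvg0.
  rewrite /continuous_at {2}/damp_pow' sgr0 mul0r.
  apply/cvgr0Pnorm_le => e e0; have ep0 : 0 < e / p by rewrite divr_gt0// (lt_trans _ p1).
  have : \forall h \near (0 : R), `|damp h `^ (p - 1)| <= e / p by move/cvgr0Pnorm_le : c0; apply.
  apply: filterS => h he; apply: (le_trans (norm_damp_pow' h)).
  rewrite mulrC -ler_pdivlMr; last exact: lt_trans p1.
  by apply: le_trans he; exact: ler_norm.
have csg : Num.sg s @[s --> t] --> Num.sg t.
  apply: cvg_near_cst.
  have [t_lt0|t_gt0] := ltP t 0.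
    have : \forall s \near t, s < 0 by exact: lt_nbhsl.
    by apply: filterS => s s0; rewrite !ltr0_sg.
  have : \forall s \near t, 0 < s by apply: lt_nbhsr; rewrite lt_neqAle eq_sym t0.
  by apply: filterS => s s0; rewrite !gtr0_sg// lt_neqAle eq_sym t0.
have c1 := @continuous_damp_powR _ p10 t.
have c2 : (p - (p - 1) * (d * damp s)) @[s --> t] --> p - (p - 1) * (d * damp t).
  exact: (cvgB (cvg_cst _) (cvgM (cvg_cst _) (cvgM (cvg_cst _) (@continuous_damp t)))).
exact: (cvgM csg (cvgM c1 c2)).
Qed.

Lemma derive_damp_pow t : 'D_1 damp_pow t = damp_pow' t.
Proof. exact: (@derive_val _ _ _ _ _ _ _ (is_derive_damp_pow t)). Qed.

End damped_power.

(** * The horizontal integration by parts *)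

Lemma cvg_sum_seq {R : realType} {T I : Type} (F : set_system T) {FF : Filter F}
    (r : seq I) (f : I -> T -> R) (l : I -> R) : (forall i, f i @ F --> l i) ->
  (fun t => \sum_(i <- r) f i t) @ F --> \sum_(i <- r) l i.
Proof.
move=> fl; elim: r => [|i r ih].
  rewrite big_nil (_ : (fun _ => _) = cst 0); first exact: cvg_cst.
  by apply/funext => t; rewrite big_nil.
rewrite big_cons (_ : (fun _ => _) = (fun t => f i t + \sum_(j <- r) f j t)).
  exact: cvgD.
by apply/funext => t; rewrite big_cons.
Qed.

Section C1at_sum.
Context {R : realType} {n : nat}.
Implicit Types (v w : 'rV[R]_n -> R) (x : 'rV[R]_n).

Lemma derive_add v w x (e : 'rV[R]_n) : derivable v x e -> derivable w x e ->
  'D_e (fun y => v y + w y) x = 'D_e v x + 'D_e w x.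
Proof. by move=> dv dw; exact: (deriveD dv dw). Qed.

Lemma C1atD v w x : C1at v x -> C1at w x -> C1at (fun y => v y + w y) x.
Proof.
move=> [cv dv cdv] [cw dw cdw]; split.
- exact: (cvgD cv cw).
- by apply: filterS2 dv dw => y dy dy' j; exact: derivableD.
- move=> j.
  have vwE : \forall y \near x, 'D_'e_j v y + 'D_'e_j w y =
      'D_'e_j (fun y => v y + w y) y.
    by apply: filterS2 dv dw => y dy dy'; rewrite derive_add.
  have H : ('D_'e_j v y + 'D_'e_j w y) @[y --> x] -->
      'D_'e_j (fun y => v y + w y) x.
    by rewrite -(nbhs_singleton vwE); exact: (cvgD (cdv j) (cdw j)).
  exact: (cvg_trans (near_eq_cvg vwE) H).
Qed.

Lemma C1at_sum (I : Type) (r : seq I) (h : I -> 'rV[R]_n -> R) x :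
  (forall i, C1at (h i) x) -> C1at (fun y => \sum_(i <- r) h i y) x.
Proof.
move=> Ch; elim: r => [|i r ih].
  by apply: C1at_near (C1at_cst 0 x); apply: filterE => y; rewrite big_nil.
apply: C1at_near (C1atD (Ch i) ih).
by apply: filterE => y; rewrite big_cons.
Qed.

Lemma C1at_powR v (a : R) x : C1at v x -> 0 < v x -> C1at (fun y => v y `^ a) x.
Proof.
move=> Cv vx0; have n0 : \forall t \near v x, 0 < t by exact: lt_nbhsr.
apply: (@C1at_comp _ _ (@powR R ^~ a)) => //.
  apply: filterS n0 => t t0.
  exact: (@ex_derive _ _ _ _ _ _ _ (is_derive_powR a t0)).
have DE : \forall t \near v x, a * t `^ (a - 1) = 'D_1 (@powR R ^~ a) t.
  apply: filterS n0 => t t0.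
  by rewrite (@derive_val _ _ _ _ _ _ _ (is_derive_powR a t0)).
have cpow : {for v x, continuous (@powR R ^~ (a - 1))}.
  apply: differentiable_continuous; apply/derivable1_diffP.
  exact: (@ex_derive _ _ _ _ _ _ _ (is_derive_powR (a - 1) vx0)).
have H : (a * t `^ (a - 1)) @[t --> v x] --> 'D_1 (@powR R ^~ a) (v x).
  by rewrite -(nbhs_singleton DE); exact: (cvgM (cvg_cst _) cpow).
exact: (cvg_trans (near_eq_cvg DE) H).
Qed.

End C1at_sum.

Section horizontal_calculus.
Context {R : realType} (G : stratified_group R).
Local Notation N := (hdim G).
Local Notation n := (hdim G + sumn (vdims G))%N.
Implicit Types (x : 'rV[R]_n) (v w g : 'rV[R]_n -> R) (k i : 'I_N).

(** Agrees with [hderive] where v is differentiable ([hderiveE]). The form with partial derivatives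
    suits functions that are only [C1at], such as mollified ones. *)
Definition hpartial k v x : R := \sum_j hcoef k j x * 'D_'e_j v x.

Definition hcoord i x : R := x ord0 (lshift (sumn (vdims G)) i).

(** |x'|^2 replaces |x'| in supports and weights, because it is polynomial and thus C^1 also at x' =
    0. *)
Definition hsqnorm x : R := \sum_i hcoord i x ^+ 2.

Definition hradial v x : R := \sum_k hcoord k x * hpartial k v x.

Lemma hnormE (x : gpoint G) : hnorm x = Num.sqrt (hsqnorm x).
Proof. by congr Num.sqrt; apply: eq_bigr => i _; rewrite mxE. Qed.

Lemma hsqnorm_ge0 x : 0 <= hsqnorm x.
Proof. by apply: sumr_ge0 => i _; exact: sqr_ge0. Qed.

Lemma hnorm_powR (x : gpoint G) (a : R) : hnorm x `^ a = hsqnorm x `^ (a / 2).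
Proof. by rewrite hnormE -powR12_sqrt ?hsqnorm_ge0// -powRrM mulrC. Qed.

Lemma hderiveE k v x : differentiable v x -> hderive k v x = hpartial k v x.
Proof. by move=> dv; rewrite /hderive derive_coordE. Qed.

Lemma hpartialM k v w x : C1at v x -> C1at w x ->
  hpartial k (fun y => v y * w y) x = v x * hpartial k w x + w x * hpartial k v x.
Proof.
move=> Cv Cw; rewrite /hpartial !mulr_sumr -big_split/=; apply: eq_bigr => j _.
by rewrite derive_mul; [ring|exact: C1at_derivable|exact: C1at_derivable].
Qed.

Lemma hpartialD k v w x : C1at v x -> C1at w x ->
  hpartial k (fun y => v y + w y) x = hpartial k v x + hpartial k w x.
Proof.
move=> Cv Cw; rewrite /hpartial -big_split/=; apply: eq_bigr => j _.
by rewrite derive_add; [ring|exact: C1at_derivable|exact: C1at_derivable].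
Qed.

Lemma hpartial_comp k (F : R -> R) v x : C1at v x -> derivable F (v x) 1 ->
  hpartial k (F \o v) x = 'D_1 F (v x) * hpartial k v x.
Proof.
move=> Cv dF; rewrite /hpartial !mulr_sumr; apply: eq_bigr => j _.
have H := is_derive_comp1 (@C1at_derivable _ _ v x j Cv) dF.
by rewrite (@derive_val _ _ _ _ _ _ _ H); ring.
Qed.

Lemma near_eq_hpartial k v w x : (\forall y \near x, v y = w y) ->
  hpartial k v x = hpartial k w x.
Proof.
by move=> vw; apply: eq_bigr => j _; rewrite (near_eq_derive _ vw).
Qed.

Lemma hpartial_cst k (c : R) x : hpartial k (cst c) x = 0.
Proof. by rewrite /hpartial big1// => j _; rewrite derive_cst mulr0. Qed.

Lemma C1at_hcoord i x : C1at (hcoord i) x.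
Proof. exact: C1at_coord. Qed.

Lemma hpartial_hcoord k i x : hpartial k (hcoord i) x = (i == k)%:R.
Proof.
rewrite /hpartial (bigD1 (lshift _ i))//= derive_coord eqxx mulr1 hcoef_lshift.
by rewrite big1 ?addr0// => j ji; rewrite derive_coord eq_sym (negbTE ji) mulr0.
Qed.

Lemma C1at_hsqnorm x : C1at hsqnorm x.
Proof.
rewrite /hsqnorm; apply: C1at_sum => i.
under eq_fun do rewrite expr2.
by apply: C1atM; exact: C1at_hcoord.
Qed.

Lemma hpartial_hsqnorm k x : hpartial k hsqnorm x = 2 * hcoord k x.
Proof.
have H (r : seq 'I_N) : hpartial k (fun y => \sum_(i <- r) hcoord i y ^+ 2) x =
    \sum_(i <- r) 2 * hcoord i x * (i == k)%:R.
  elim: r => [|i r ih].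
    rewrite big_nil; transitivity (hpartial k (cst 0) x); last exact: hpartial_cst.
    by apply: near_eq_hpartial; apply: filterE => y; rewrite big_nil.
  rewrite big_cons -ih -(hpartial_hcoord _ _ x).
  transitivity (hpartial k (fun y => hcoord i y * hcoord i y +
      \sum_(i <- r) hcoord i y ^+ 2) x).
    by apply: near_eq_hpartial; apply: filterE => y; rewrite big_cons expr2.
  rewrite hpartialD ?hpartialM; try exact: C1at_hcoord.
  - by ring.
  - by apply: C1atM; exact: C1at_hcoord.
  - apply: C1at_sum => {}i; under eq_fun do rewrite expr2.
    by apply: C1atM; exact: C1at_hcoord.
rewrite /hsqnorm H (bigD1 k)//= eqxx mulr1 big1 ?addr0// => i /negbTE ->.
by rewrite mulr0.
Qed.

Lemma continuous_hpartial k v x : C1at v x -> {for x, continuous (hpartial k v)}.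
Proof.
move=> [_ _ cdv].
apply: (@cvg_sum_seq R _ _ (nbhs x) _ (index_enum _)
  (fun j y => hcoef k j y * 'D_'e_j v y)) => j.
have hc : {for x, continuous (hcoef k j)}.
  exact/differentiable_continuous/differentiable_hcoef.
exact: (cvgM hc (cdv j)).
Qed.

(** As d_j a_kj = 0, the term a_kj d_j g is the partial derivative d_j (a_kj g), whose integral is
    0. *)
Lemma integral_hpartial0 k g M : (forall x, C1at g x) ->
  (forall x, M <= `|x| -> g x = 0) ->
  (lebesgue_rV R n).-integrable setT (EFin \o hpartial k g) /\
  (\int[lebesgue_rV R n]_x (hpartial k g x)%:E = 0)%E.
Proof.
move=> Cg g0.
have Ch x j : C1at (hcoef k j) x.
  apply: C1at_differentiable => [y|i]; first exact: differentiable_hcoef.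
  exact: continuous_derive_hcoef.
have gjE x j : hcoef k j x * 'D_'e_j g x = 'D_'e_j (fun y => hcoef k j y * g y) x.
  rewrite derive_mul; [|exact: C1at_derivable|exact: C1at_derivable].
  by rewrite derive_hcoef0 mulr0 addr0.
have CM j x : C1at (fun y => hcoef k j y * g y) x by exact: C1atM.
have g0M j x : M <= `|x| -> hcoef k j x * g x = 0.
  by move=> /g0 ->; rewrite mulr0.
have ij j : (lebesgue_rV R n).-integrable setT
    (fun x => ('D_'e_j (fun y => hcoef k j y * g y) x)%:E).
  apply: (@integrable_continuous_supp R n _ (M + 1)).
    by move=> x; have [_ _] := CM j x; apply.
  move=> x Mx; apply: (@derive_supp _ _ (fun y => hcoef k j y * g y) 'e_j M (g0M j) x).
  by rewrite (lt_le_trans _ Mx)// ltrDl.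
have E x : (hpartial k g x)%:E =
    (\sum_j ('D_'e_j (fun y => hcoef k j y * g y) x)%:E)%E.
  by rewrite sumEFin; congr EFin; apply: eq_bigr => j _; rewrite gjE.
split.
  rewrite (_ : EFin \o _ = (fun x => \sum_j ('D_'e_j (fun y => hcoef k j y * g y) x)%:E)%E).
    by apply: integrable_sum => // j _; exact: ij.
  by apply/funext => x; rewrite /= E.
under eq_integral do rewrite E.
rewrite integral_sum// big1// => j _.
by rewrite (integral_C1_derive0 j (CM j) (g0M j)).
Qed.

Section weighted.
Variables (a r M : R) (f : 'rV[R]_n -> R).
Hypotheses (r0 : 0 < r) (Cf : forall x, C1at f x)
  (f_hsmall : forall x, hsqnorm x < r -> f x = 0)
  (f_large : forall x, M <= `|x| -> f x = 0).

Let near_hsmall x : hsqnorm x < r -> \forall y \near x, hsqnorm y < r.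
Proof.
move=> xr; have [c _ _] := C1at_hsqnorm x.
exact: (c _ (lt_nbhsl xr)).
Qed.

Let f_near0 x : hsqnorm x < r -> \forall y \near x, f y = cst 0 y.
Proof. by move=> /near_hsmall; apply: filterS => y /f_hsmall. Qed.

Let hradial_hsmall x : hsqnorm x < r -> hradial f x = 0.
Proof.
move=> /f_near0 fx; rewrite /hradial big1// => k _.
by rewrite (near_eq_hpartial k fx) hpartial_cst mulr0.
Qed.

Let w x := hsqnorm x `^ a.

Let Cw x : r <= hsqnorm x -> C1at w x.
Proof.
by move=> rx; apply: C1at_powR; [exact: C1at_hsqnorm|exact: lt_le_trans rx].
Qed.

(** The weight can fail to be continuous only where x' = 0, and g vanishes near those points. *)
Lemma continuous_weighted (g : 'rV[R]_n -> R) :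
  (forall x, hsqnorm x < r -> g x = 0) -> (forall x, {for x, continuous g}) ->
  continuous (fun x => g x * w x).
Proof.
move=> g0 cg x; have [xr|xr] := ltP (hsqnorm x) r.
  have E : \forall y \near x, g y * w y = g x * w x.
    by apply: filterS (near_hsmall xr) => y yr; rewrite !g0// !mul0r.
  exact: (@cvg_near_cst _ R (g x * w x) (fun y => g y * w y) (nbhs x) _ E).
have [cw _ _] := Cw xr.
exact: (cvgM (cg x) cw).
Qed.

Lemma integrable_weighted : (lebesgue_rV R n).-integrable setT (fun x => (f x * w x)%:E).
Proof.
apply: (@integrable_continuous_supp R n _ M) => [|x /f_large ->]; last by rewrite mul0r.
by apply: continuous_weighted => // x; have [] := Cf x.
Qed.

Let hradial_large x : M < `|x| -> hradial f x = 0.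
Proof.
move=> Mx; rewrite /hradial big1// => k _.
by rewrite /hpartial big1 ?mulr0// => j _; rewrite (@derive_supp _ _ f _ M f_large)// mulr0.
Qed.

Lemma integrable_weighted_hradial :
  (lebesgue_rV R n).-integrable setT (fun x => (hradial f x * w x)%:E).
Proof.
apply: (@integrable_continuous_supp R n _ (M + 1)).
  apply: continuous_weighted => // x.
  apply: (@cvg_sum_seq R _ _ (nbhs x) _ (index_enum _)
    (fun k y => hcoord k y * hpartial k f y) (fun k => hcoord k x * hpartial k f x)) => k.
  have [c _ _] := C1at_hcoord k x.
  have c' := @continuous_hpartial k f x (Cf x).
  exact: (cvgM c c').
by move=> x Mx; rewrite hradial_large ?mul0r// (lt_le_trans _ Mx)// ltrDl.
Qed.

(** The exponent a is that of |x'|^2, whence 2 a. The products [g k] are C^1 everywhere, even if the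
    weight is not, because f vanishes near x' = 0. *)
Lemma hradial_by_parts :
  (\int[lebesgue_rV R n]_x (hradial f x * w x)%:E =
   - ((N%:R + 2 * a)%:E * \int[lebesgue_rV R n]_x (f x * w x)%:E))%E.
Proof.
pose g k x := f x * (hcoord k x * w x).
have Cg k x : C1at (g k) x.
  have [xr|xr] := ltP (hsqnorm x) r; last first.
    by apply: C1atM => //; apply: C1atM; [exact: C1at_hcoord|exact: Cw].
  apply: C1at_near (C1at_cst 0 x).
  by apply: filterS (f_near0 xr) => y; rewrite /g => ->; rewrite mul0r.
have g_large k x : M <= `|x| -> g k x = 0 by move=> /f_large; rewrite /g => ->; rewrite mul0r.
have gE x : \sum_k hpartial k (g k) x = hradial f x * w x + (N%:R + 2 * a) * (f x * w x).
  have [xr|xr] := ltP (hsqnorm x) r.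
    rewrite hradial_hsmall// f_hsmall// !(mul0r,mulr0,addr0) big1// => k _.
    rewrite (@near_eq_hpartial k _ (cst 0)) ?hpartial_cst//.
    by apply: filterS (f_near0 xr) => y; rewrite /g => ->; rewrite mul0r.
  have x0 : 0 < hsqnorm x by exact: lt_le_trans xr.
  have wk k : hpartial k w x = a * hsqnorm x `^ (a - 1) * (2 * hcoord k x).
    have dp := is_derive_powR a x0.
    have := @hpartial_comp k (@powR R ^~ a) _ _ (C1at_hsqnorm x) (@ex_derive _ _ _ _ _ _ _ dp).
    by rewrite (@derive_val _ _ _ _ _ _ _ dp) hpartial_hsqnorm.
  have E k : hpartial k (g k) x = hcoord k x * hpartial k f x * w x +
      (f x * w x + 2 * a * f x * hsqnorm x `^ (a - 1) * hcoord k x ^+ 2).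
    rewrite hpartialM//; last by apply: C1atM; [exact: C1at_hcoord|exact: Cw].
    rewrite hpartialM; [|exact: C1at_hcoord|exact: Cw].
    by rewrite hpartial_hcoord eqxx mulr1n wk /w; ring.
  rewrite (eq_bigr _ (fun k _ => E k)) big_split/= -mulr_suml big_split/=.
  rewrite sumr_const card_ord -mulr_sumr -/(hsqnorm x) /hradial; congr (_ + _).
  have -> : w x = hsqnorm x * hsqnorm x `^ (a - 1).
    have E1 : a = 1 + (a - 1) by ring.
    by rewrite /w {1}E1 [LHS]powRD ?(gt_eqF x0) ?implybT// powRr1 ?ltW.
  by rewrite -mulr_natr; ring.
have := fun k => integral_hpartial0 k (Cg k) (g_large k).
move=> H; have /eqP : (\sum_k \int[lebesgue_rV R n]_x (hpartial k (g k) x)%:E = 0)%E.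
  by rewrite big1// => k _; have [] := H k.
rewrite -integral_sum//; last by move=> k; have [] := H k.
have gEE x : (\sum_k (hpartial k (g k) x)%:E =
    (hradial f x * w x)%:E + (N%:R + 2 * a)%:E * (f x * w x)%:E)%E.
  by rewrite sumEFin gE EFinD -EFinM.
under eq_integral do rewrite gEE.
rewrite integralD//; [|exact: integrable_weighted_hradial|].
  rewrite integralZl//; last exact: integrable_weighted.
  set I := (\int[_]_x (f x * w x)%:E)%E; set J := (\int[_]_x (hradial f x * w x)%:E)%E.
  have : I \is a fin_num by apply: integrable_fin_num => //; exact: integrable_weighted.
  have : J \is a fin_num by apply: integrable_fin_num => //; exact: integrable_weighted_hradial.
  move=> /fineK <- /fineK <-; rewrite -EFinM -EFinD -EFinN eqe => /eqP H0.
  by congr EFin; apply/eqP; rewrite -addr_eq0 H0.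
by apply: integrableZl => //; exact: integrable_weighted.
Qed.

End weighted.

End horizontal_calculus.

(** * The damped inequality *)

Section L1_subsequence.
Context d (T : measurableType d) (R : realType)
  (mu : {measure set T -> \bar R}).
Local Open Scope ereal_scope.

(** Norms at most 2^-(i+1) make the series of the |w (s i)| integrable, hence finite almost
    everywhere, so that its terms tend to 0. *)
Lemma norm1_cvg_ae_subseq (w : nat -> T -> R) :
  (forall i, measurable_fun setT (w i)) ->
  (fun i => norm1 mu (w i)) @ \oo --> 0 ->
  exists s : nat -> nat, (forall i, (i <= s i)%N) /\
    {ae mu, forall x, w (s i) x @[i --> \oo] --> (0 : R)%R}.
Proof.
move=> mw w0.
have /choice[s sP] : forall i, exists j, (i <= j)%N /\
    norm1 mu (w j) <= (1 / (2 ^ i.+1)%:R)%:E.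
  move=> i; have e0 : (0 < 1 / (2 ^ i.+1)%:R :> R)%R.
    by rewrite divr_gt0// ltr0n expn_gt0.
  have [j _ jP] := near_cvge0 w0 e0.
  exists (maxn i j); split; first exact: leq_maxl.
  exact/ltW/jP/leq_maxr.
exists s; split=> [i|]; first by have [] := sP i.
pose S x := \sum_(0 <= i <oo) `|w (s i) x|%:E.
have mS i : measurable_fun setT (fun x => `|w (s i) x|%:E).
  exact: measurable_normE.
have S0 x : 0 <= S x by apply: nneseries_ge0 => k _ _; rewrite lee_fin.
have iS : mu.-integrable setT S.
  apply/integrableP; split.
    by apply: ge0_emeasurable_sum => // i x _ _; rewrite lee_fin.
  have -> : \int[mu]_x `|S x| = \int[mu]_x S x.
    by apply: eq_integral => x _; rewrite gee0_abs.
  rewrite integral_nneseries//.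
  apply: (@le_lt_trans _ _ (\sum_(0 <= i <oo) (1 / (2 ^ i.+1)%:R)%:E)).
    by apply: lee_nneseries => [i _ _|i _]; [exact: integral_ge0|have [] := sP i].
  exact: le_lt_trans (epsilon_trick0 xpredT ler01) (ltry _).
apply: filterS (integrable_ae measurableT iS) => x /(_ I) Sx.
have Soo : S x < +oo by rewrite -ge0_fin_numE.
have w0x k : xpredT k -> 0 <= `|w (s k) x|%:E by rewrite lee_fin.
have tail := nneseries_tail_cvg Soo w0x.
have : (fun i => `|w (s i) x|%:E) @ \oo --> 0.
  apply: (@squeeze_cvge _ _ _ _ (cst 0) _ _ _ _ (cvg_cst _) tail).
  apply: nearW => i; rewrite lee_fin normr_ge0/=.
  have := @nneseries_lim_ge R (fun k => `|w (s k) x|%:E) xpredT i i.+1.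
  by rewrite big_nat1; apply => k _ _; exact: w0x.
move=> /fine_cvgP[_ H]; apply/norm_cvg0P.
by have := H.
Qed.

End L1_subsequence.

Section limit_inequality.
Context {R : realType} (G : stratified_group R).
Local Notation N := (hdim G).
Local Notation n := (hdim G + sumn (vdims G))%N.
Local Notation mu := (lebesgue_rV R n).
Implicit Types (u v : 'rV[R]_n -> R) (V : 'I_N -> 'rV[R]_n -> R).

Definition hball M : set 'rV[R]_n := [set x | `|x| <= M].

(* Strong L^1 approximation by C^1 functions supported away from x' = 0; the bound
   r is on |x'|^2. *)
Definition hW11 (r M : R) u V :=
  exists v : nat -> 'rV[R]_n -> R,
  [/\ forall i x, C1at (v i) x,
      forall i x, hsqnorm x < r \/ M <= `|x| -> v i x = 0,
      (fun i => norm1 mu (fun x => v i x - u x)) @ \oo --> 0%E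
    & forall k, (fun i => norm1 mu (fun x => \1_(hball M) x *
        (hpartial k (v i) x - V k x))) @ \oo --> 0%E].

Section smooth_inequality.
Variables (p d a r M : R) (v : 'rV[R]_n -> R).
Hypotheses (p1 : 1 < p) (d0 : 0 < d) (r0 : 0 < r).
Hypotheses (Cv : forall x, C1at v x)
  (v0 : forall x, hsqnorm x < r \/ M <= `|x| -> v x = 0).

Lemma hradial_comp_damp x : hradial (damp_pow p d \o v) x =
  damp_pow' p d (v x) * hradial v x.
Proof.
rewrite /hradial mulr_sumr; apply: eq_bigr => k _.
have dF := is_derive_damp_pow p1 d0 (v x).
have dF' := @ex_derive _ _ _ _ _ _ _ dF.
by rewrite (@hpartial_comp _ _ k (damp_pow p d) v x (Cv x) dF') (derive_damp_pow p1 d0) mulrCA.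
Qed.

Lemma smooth_damped_inequality :
  (`|N%:R + 2 * a|%:E * \int[mu]_x (damp d (v x) `^ p * hsqnorm x `^ a)%:E <=
   p%:E * \int[mu]_x (damp d (v x) `^ (p - 1) * `|hradial v x| * hsqnorm x `^ a)%:E)%E.
Proof.
pose f := damp_pow p d \o v.
have Cf x : C1at f x.
  apply: C1at_comp => //.
    apply: filterE => t.
    exact: (@ex_derive _ _ _ _ _ _ _ (is_derive_damp_pow p1 d0 t)).
  have -> : 'D_1 (damp_pow p d) = damp_pow' p d.
    by apply/funext => t; rewrite (derive_damp_pow p1 d0).
  exact: continuous_damp_pow'.
have f1 x : hsqnorm x < r -> f x = 0.
  by move=> xr; rewrite /f /= v0 ?damp_pow0//; left.
have f2 x : M <= `|x| -> f x = 0.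
  by move=> xr; rewrite /f /= v0 ?damp_pow0//; right.
have i1 := integrable_weighted a r0 Cf f1 f2.
have i2 := integrable_weighted_hradial a r0 Cf f1 f2.
have parts := hradial_by_parts a r0 Cf f1 f2.
have m1 : measurable_fun setT (fun x : 'rV[R]_n => damp d (v x)).
  apply: continuous_measurable_rV => x; have [c _ _] := Cv x.
  exact: (cvg_comp _ _ c (@continuous_damp R d d0 (v x))).
have mq : measurable_fun setT (fun x : 'rV[R]_n => hsqnorm x `^ a).
  have m0 : measurable_fun setT (@hsqnorm R G).
    by apply: continuous_measurable_rV => x; have [c _ _] := C1at_hsqnorm x.
  exact: (measurableT_comp (measurable_powR a) m0).
have mr : measurable_fun setT (hradial v).
  apply: measurable_sum => k; apply: measurable_funM.
    exact: measurable_coord.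
  by apply: continuous_measurable_rV => x; exact: continuous_hpartial.
have damp0 x : 0 <= damp d (v x) by exact: damp_ge0.
have p0 : 0 <= p by rewrite ltW// (lt_trans _ p1).
apply: (@le_trans _ _ (`|N%:R + 2 * a|%:E * \int[mu]_x (f x * hsqnorm x `^ a)%:E)%E).
  apply: lee_wpmul2l; first by rewrite lee_fin.
  apply: ge0_le_integral => //.
  - by move=> x _; rewrite lee_fin mulr_ge0 ?powR_ge0.
  - apply/measurable_EFinP; apply: measurable_funM => //.
    exact: (measurableT_comp (measurable_powR p) m1).
  - by case/integrableP : i1.
  - by move=> x _; rewrite lee_fin ler_wpM2r ?powR_ge0// damp_pow_ge.
have -> : (`|N%:R + 2 * a|%:E * \int[mu]_x (f x * hsqnorm x `^ a)%:E)%E =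
    `|\int[mu]_x (hradial f x * hsqnorm x `^ a)%:E|%E.
  rewrite parts abseN abseM; congr (_ * _)%E.
  rewrite gee0_abs// integral_ge0// => x _; rewrite lee_fin mulr_ge0 ?powR_ge0//.
  by rewrite /f /= /damp_pow mulr_ge0 ?powR_ge0.
apply: (le_trans (le_abse_integral _ _ _)) => //.
  by case/integrableP : i2.
rewrite -ge0_integralZl//; last 2 first.
- apply/measurable_EFinP; apply: measurable_funM => //; apply: measurable_funM.
    exact: (measurableT_comp (measurable_powR (p - 1)) m1).
  exact: measurableT_comp.
- by move=> x _; rewrite lee_fin !mulr_ge0 ?powR_ge0.
apply: ge0_le_integral => //.
- by apply: measurableT_comp => //; case/integrableP : i2.
- apply: measurable_funeM; apply/measurable_EFinP; apply: measurable_funM => //.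
  apply: measurable_funM; last exact: measurableT_comp.
  exact: (measurableT_comp (measurable_powR (p - 1)) m1).
move=> x _; rewrite -EFinM lee_fin hradial_comp_damp normrM (ger0_norm (powR_ge0 _ _)).
rewrite mulrA ler_wpM2r ?powR_ge0// normrM mulrA ler_wpM2r//.
exact: norm_damp_pow'.
Qed.

End smooth_inequality.

End limit_inequality.

(** * The damped inequality for L^1 limits *)

Section limit_passage.
Context {R : realType} (G : stratified_group R).
Local Notation N := (hdim G).
Local Notation n := (hdim G + sumn (vdims G))%N.
Local Notation mu := (lebesgue_rV R n).
Variables (p d a r M : R) (u : 'rV[R]_n -> R) (V : 'I_N -> 'rV[R]_n -> R).
Hypotheses (p1 : 1 < p) (d0 : 0 < d) (r0 : 0 < r).
Hypotheses (mu_ : measurable_fun setT u) (mV : forall k, measurable_fun setT (V k))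
  (V1 : forall k, (norm1 mu (fun x => (\1_(@hball R G M) x * V k x)%R) < +oo)%E)
  (u0 : forall x, hsqnorm x < r \/ M <= `|x| -> u x = 0)
  (uV : hW11 r M u V).

Let B := @hball R G M.
Let K := [set x : 'rV[R]_n | r <= hsqnorm x /\ `|x| <= M].
Let w (x : 'rV[R]_n) : R := hsqnorm x `^ a.
Let Z (x : 'rV[R]_n) : R := \sum_k hcoord k x * V k x.

Let mq : measurable_fun setT (@hsqnorm R G).
Proof. by apply: continuous_measurable_rV => x; have [c _ _] := C1at_hsqnorm x. Qed.

Let mw : measurable_fun setT w.
Proof. exact: (measurableT_comp (measurable_powR a) mq). Qed.

Let mB : measurable B. Proof. exact: measurable_rV_ball. Qed.

Let mZ : measurable_fun setT Z.
Proof.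
by apply: measurable_sum => k; apply: measurable_funM => //; exact: measurable_coord.
Qed.

Lemma weight_bounded : exists2 C, 0 <= C & forall x, K x -> w x <= C.
Proof.
(* One summand for each sign of a. [M ^+ 2 *+ N] bounds |x'|^2, since the norm of x is the maximum
   of its coordinates. *)
exists (r `^ a + (M ^+ 2 *+ N) `^ a); first by rewrite addr_ge0 ?powR_ge0.
move=> x [rx xM].
have xQ : hsqnorm x <= M ^+ 2 *+ N.
  rewrite /hsqnorm -[in leRHS](card_ord N) -sumr_const; apply: ler_sum => i _.
  rewrite -[leLHS]real_normK ?num_real// ler_pXn2r ?nnegrE ?(le_trans _ xM)//.
  exact: coord_le_norm.
have q0 : 0 < hsqnorm x by exact: lt_le_trans rx.
have [a0|a0] := leP 0 a.
  rewrite (@le_trans _ _ ((M ^+ 2 *+ N) `^ a)) ?lerDr ?powR_ge0//.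
  by apply: ge0_ler_powR => //; rewrite nnegrE ?ltW// (lt_le_trans q0).
rewrite (@le_trans _ _ (r `^ a)) ?lerDl ?powR_ge0// /w -(opprK a) powRN (powRN r).
rewrite lef_pV2 ?posrE ?powR_gt0//.
by apply: ge0_ler_powR => //; rewrite ?nnegrE ?oppr_ge0 ltW.
Qed.

Let damp0 t : 0 <= damp d t. Proof. exact: damp_ge0. Qed.

Let damp_powR0 c : 0 < c -> damp d 0 `^ c = 0.
Proof. by move=> c0; rewrite /damp normr0 mul0r powR0// gt_eqF. Qed.

Let damp_powR_le c t : 0 < c -> damp d t `^ c <= d^-1 `^ c.
Proof.
move=> c0; apply: ge0_ler_powR; rewrite ?nnegrE ?damp0 ?damp_bounded ?invr_ge0//.
- exact: ltW.
- exact: ltW.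
Qed.

Let p10 : 0 < p - 1. Proof. by rewrite subr_gt0. Qed.
Let p0 : 0 < p. Proof. exact: lt_trans p1. Qed.

Let K_or x : K x \/ (hsqnorm x < r \/ M <= `|x|).
Proof.
have [xr|xr] := ltP (hsqnorm x) r; first by right; left.
by have [xM|xM] := leP M `|x|; [right; right|left; split => //; exact: ltW].
Qed.

Lemma norm1_hradial_cvg0 (v : nat -> 'rV[R]_n -> R) :
  (forall i x, C1at (v i) x) ->
  (forall k, (fun i => norm1 mu (fun x => \1_B x *
        (hpartial k (v i) x - V k x))) @ \oo --> 0%E) ->
  (fun i => norm1 mu (fun x => \1_B x * (hradial (v i) x - Z x))) @ \oo --> 0%E.
Proof.
move=> Cv vV.
have mX i k : measurable_fun setT (fun x => \1_B x * (hpartial k (v i) x - V k x)).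
  apply: measurable_funM; first exact/measurable_indicP.
  apply: measurable_funB => //; apply: continuous_measurable_rV => x.
  exact: continuous_hpartial.
have mr i : measurable_fun setT (fun x => \1_B x * (hradial (v i) x - Z x)).
  apply: measurable_funM; first exact/measurable_indicP.
  apply: measurable_funB => //; apply: measurable_sum => k; apply: measurable_funM.
    exact: measurable_coord.
  by apply: continuous_measurable_rV => x; exact: continuous_hpartial.
have H : (fun i => `|M|%:E * \sum_k norm1 mu (fun x => (\1_B x *
        (hpartial k (v i) x - V k x))%R))%E @ \oo --> 0%E.
  rewrite -[X in _ --> X](mule0 `|M|%:E); apply: cvgeZl => //.
  have S0 : (\sum_(k < N) (0 : \bar R) = 0)%E by rewrite big1.
  rewrite -[X in _ --> X]S0.
  apply: (@cvg_nnesum nat \oo _ R 'I_N (index_enum _) (fun k i => norm1 mu (fun x => (\1_B x *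
        (hpartial k (v i) x - V k x))%R)) (fun=> 0%E) xpredT) => k _; last exact: vV.
  by apply: nearW => i; exact: norm1_ge0.
apply: (@squeeze_cvge _ _ _ _ (cst 0%E) _ _ _ _ (cvg_cst _) H).
apply: nearW => i; rewrite norm1_ge0/= /norm1 -ge0_integral_sum//; last first.
  by move=> k; exact: measurable_normE.
rewrite -ge0_integralZl//; last 2 first.
- by apply: emeasurable_sum => k _; exact: measurable_normE.
- by move=> x _; apply: sume_ge0 => k _; rewrite lee_fin.
apply: ge0_le_integral => //.
- exact: measurable_normE.
- apply: measurable_funeM; apply: emeasurable_sum => k _; exact: measurable_normE.
move=> x _; rewrite sumEFin -EFinM lee_fin.
have [xB|xB] := boolP (x \in B); last first.
  by rewrite indicE (negbTE xB) !mul0r normr0 mulr_ge0// sumr_ge0.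
rewrite indicE xB mul1r /hradial /Z -sumrB (le_trans (ler_norm_sum _ _ _))//.
rewrite mulr_sumr ler_sum// => k _; rewrite mul1r -mulrBr normrM ler_wpM2r//.
move: xB; rewrite inE => xM.
by rewrite (le_trans (coord_le_norm _ _))// (le_trans xM)// ler_norm.
Qed.

(** Off [K] the damped functions vanish; on [K] both their powers and the weight are bounded. This
    dominates the integrands along an almost everywhere convergent subsequence, and it bounds the
    cost of replacing [hradial (v i)] by [Z] by a constant times an L^1 norm. *)
Lemma damped_inequality :
  (`|N%:R + 2 * a|%:E * \int[mu]_x (damp d (u x) `^ p * w x)%:E <=
   p%:E * \int[mu]_x (damp d (u x) `^ (p - 1) * `|Z x| * w x)%:E)%E.
Proof.
have [v [Cv v0 vu vV]] := uV.
have mv i : measurable_fun setT (v i).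
  by apply: continuous_measurable_rV => x; have [] := Cv i x.
have [s [ile ae_s]] := norm1_cvg_ae_subseq (fun i => measurable_funB (mv i) mu_) vu.
have [C C0 wC] := weight_bounded.
have soo : s @ \oo --> \oo.
  move=> A [k _ kA]; exists k => // i /= ki; apply: kA => /=.
  exact: leq_trans ki (ile i).
have ZV := norm1_hradial_cvg0 Cv vV.
have mdamp c g : measurable_fun setT g -> measurable_fun setT (fun x : 'rV[R]_n => damp d (g x) `^ c).
  move=> mg; have m1 : measurable_fun setT (damp d).
    by apply: continuous_measurable_fun; exact: (continuous_damp d0).
  exact: (measurableT_comp (measurable_powR c) (measurableT_comp m1 mg)).
have dcvg c : 0 < c -> {ae mu, forall x,
    damp d (v (s i) x) `^ c @[i --> \oo] --> damp d (u x) `^ c}.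
  move=> c0; apply: filterS ae_s => x xs.
  have {xs}xs : v (s i) x @[i --> \oo] --> u x.
    have H : (v (s i) x - u x + u x) @[i --> \oo] --> 0 + u x.
      exact: (cvgD xs (cvg_cst (u x))).
    have E : (fun i => v (s i) x) = (fun i => v (s i) x - u x + u x).
      by apply/funext => i; rewrite subrK.
    by rewrite E -[X in _ --> X]add0r.
  exact: (cvg_comp _ _ xs (@continuous_damp_powR R d d0 c c0 (u x))).
have wK c g x : 0 < c -> (forall x, hsqnorm x < r \/ M <= `|x| -> g x = 0) ->
    damp d (g x) `^ c * w x <= d^-1 `^ c * C * \1_B x.
  move=> c0 g0; have [Kx|xK] := K_or x; last first.
    by rewrite g0// damp_powR0// mul0r !mulr_ge0 ?powR_ge0.
  rewrite indicE mem_set ?mulr1; last by have [] := Kx.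
  by rewrite ler_pM ?powR_ge0 ?wC// damp_powR_le.
pose f i x := damp d (v (s i) x) `^ p * w x.
(* The gradient factor is already the limit [Z], which gives [g] a fixed dominating function; the
   difference from the true integrand is controlled by [h] below. *)
pose g i x := damp d (v (s i) x) `^ (p - 1) * `|Z x| * w x.
have iB : mu.-integrable setT (EFin \o (fun x => d^-1 `^ p * C * \1_B x)).
  apply: (@integrable_supp_ball _ _ _ (M + 1) (d^-1 `^ p * C)).
  - by apply: measurable_funM => //; exact/measurable_indicP.
  - move=> x; rewrite normrM ger0_norm ?mulr_ge0 ?powR_ge0// ger0_norm// indicE.
    by case: (_ \in _); rewrite ?mulr1 ?mulr0// mulr_ge0 ?powR_ge0.
  - move=> x Mx; rewrite indicE memNset ?mulr0// => xM.
    by move: (le_trans Mx xM); rewrite gerDl ler10.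
have iZ : mu.-integrable setT (EFin \o (fun x => d^-1 `^ (p - 1) * C * (\1_B x * `|Z x|))).
  set c := d^-1 `^ (p - 1) * C; have c0 : 0 <= c by rewrite mulr_ge0 ?powR_ge0.
  have iV k : mu.-integrable setT (EFin \o (fun x => \1_B x * V k x)).
    by apply: norm1_integrable => //; apply: measurable_funM => //; exact/measurable_indicP.
  apply: (@le_integrable _ _ _ _ _ measurableT _
    (fun x => \sum_k (c * `|M|)%:E * `|(\1_B x * V k x)%:E|)%E).
  - apply/measurable_EFinP; apply: measurable_funM => //; apply: measurable_funM.
      exact/measurable_indicP.
    exact: measurableT_comp.
  - move=> x _ /=; rewrite ger0_norm ?mulr_ge0 ?powR_ge0//.
    rewrite (eq_bigr (fun k => (c * `|M| * `|\1_B x * V k x|)%:E))//.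
    rewrite sumEFin/= lee_fin -mulr_sumr (le_trans _ (ler_norm _))// -mulrA ler_wpM2l//.
    have [xB|xB] := boolP (x \in B); last first.
      by rewrite indicE (negbTE xB) !mul0r mulr_ge0// sumr_ge0.
    rewrite indicE xB mul1r /Z (le_trans (ler_norm_sum _ _ _))//.
    rewrite mulr_sumr ler_sum// => k _; rewrite mul1r normrM ler_wpM2r//.
    move: xB; rewrite inE => xM.
    by rewrite (le_trans (coord_le_norm _ _))// (le_trans xM)// ler_norm.
  - apply: (integrable_sum measurableT) => k _; apply: integrableZl => //.
    exact: integrable_abse (iV k).
have [_ _ fcvg] : [/\ mu.-integrable setT (fun x => (damp d (u x) `^ p * w x)%:E),
    (fun i => \int[mu]_x `|(f i x)%:E - (damp d (u x) `^ p * w x)%:E|)%E @ \oo --> 0%E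
  & (fun i => \int[mu]_x (f i x)%:E)%E @ \oo --> (\int[mu]_x (damp d (u x) `^ p * w x)%:E)%E].
  apply: (dominated_convergence measurableT _ _ _ iB).
  - by move=> i; apply/measurable_EFinP; apply: measurable_funM => //; exact: mdamp.
  - by apply/measurable_EFinP; apply: measurable_funM => //; exact: mdamp.
  - apply: filterS (dcvg _ p0) => x xs _; apply: cvg_EFin; first exact: nearW.
    exact: (cvgM xs (cvg_cst _)).
  - apply: aeW => x i _ /=; rewrite lee_fin ger0_norm ?mulr_ge0 ?powR_ge0//.
    by apply: (wK p (v (s i))) => //; exact: v0.
have [ig _ gcvg] : [/\ mu.-integrable setT (fun x => (damp d (u x) `^ (p - 1) * `|Z x| * w x)%:E),
    (fun i => \int[mu]_x `|(g i x)%:E - (damp d (u x) `^ (p - 1) * `|Z x| * w x)%:E|)%E @ \oo --> 0%E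
  & (fun i => \int[mu]_x (g i x)%:E)%E @ \oo --> (\int[mu]_x (damp d (u x) `^ (p - 1) * `|Z x| * w x)%:E)%E].
  apply: (dominated_convergence measurableT _ _ _ iZ).
  - move=> i; apply/measurable_EFinP; apply: measurable_funM => //; apply: measurable_funM.
      exact: mdamp.
    exact: measurableT_comp.
  - apply/measurable_EFinP; apply: measurable_funM => //; apply: measurable_funM.
      exact: mdamp.
    exact: measurableT_comp.
  - apply: filterS (dcvg _ p10) => x xs _; apply: cvg_EFin; first exact: nearW.
    exact: (cvgM (cvgM xs (cvg_cst _)) (cvg_cst _)).
  - apply: aeW => x i _ /=; rewrite lee_fin ger0_norm ?mulr_ge0 ?powR_ge0//.
    rewrite /g mulrAC mulrA ler_wpM2r//.
    by apply: (wK (p - 1) (v (s i))) => //; exact: v0.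
pose h i := norm1 mu (fun x => \1_B x * (hradial (v i) x - Z x)).
have step i : (`|N%:R + 2 * a|%:E * \int[mu]_x (f i x)%:E <=
    p%:E * (\int[mu]_x (g i x)%:E + (d^-1 `^ (p - 1) * C)%:E * h (s i)))%E.
  apply: (le_trans (smooth_damped_inequality a p1 d0 r0 (Cv (s i)) (v0 (s i)))).
  apply: lee_wpmul2l; first by rewrite lee_fin ltW.
  have c0 : 0 <= d^-1 `^ (p - 1) * C by rewrite mulr_ge0 ?powR_ge0.
  have mr : measurable_fun setT (hradial (v (s i))).
    apply: measurable_sum => k; apply: measurable_funM; first exact: measurable_coord.
    by apply: continuous_measurable_rV => x; exact: continuous_hpartial.
  have mh : measurable_fun setT (fun x => \1_B x * (hradial (v (s i)) x - Z x)).
    apply: measurable_funM; first exact/measurable_indicP.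
    exact: measurable_funB.
  have mg : measurable_fun setT (g i).
    apply: measurable_funM => //; apply: measurable_funM; first exact: mdamp.
    exact: measurableT_comp.
  have mgE : measurable_fun setT (fun x => (g i x)%:E) by exact/measurable_EFinP.
  have g0 x : 0 <= g i x by rewrite /g !mulr_ge0 ?powR_ge0.
  rewrite /h /norm1 -ge0_integralZl//; last exact: measurable_normE.
  rewrite -ge0_integralD//.
  - apply: ge0_le_integral => //.
    + by move=> x _; rewrite lee_fin !mulr_ge0 ?powR_ge0.
    + apply/measurable_EFinP; apply: measurable_funM => //; apply: measurable_funM.
        exact: mdamp.
      exact: measurableT_comp.
    + by apply: emeasurable_funD => //; apply: measurable_funeM; exact: measurable_normE.
    move=> x _; rewrite -EFinM -EFinD lee_fin /g.
    have := wK (p - 1) (v (s i)) x p10 (v0 (s i)).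
    move=> Hw; rewrite ![_ * `|_| * w x]mulrAC.
    set D := damp d (v (s i) x) `^ (p - 1) * w x in Hw *.
    rewrite normrM (ger0_norm (_ : 0 <= \1_B x))// mulrA.
    apply: (@le_trans _ _ (D * (`|Z x| + `|hradial (v (s i)) x - Z x|))).
      rewrite ler_wpM2l//; first by rewrite mulr_ge0 ?powR_ge0.
      rewrite -{1}(subrKC (Z x) (hradial _ _)); exact: ler_normD.
    by rewrite mulrDr lerD2l ler_wpM2r.
  - by move=> x _; rewrite lee_fin.
  - by move=> x _; rewrite mule_ge0// lee_fin.
  - by apply: measurable_funeM; exact: measurable_normE.
have Lc : (fun i => `|N%:R + 2 * a|%:E * \int[mu]_x (f i x)%:E)%E @ \oo -->
    (`|N%:R + 2 * a|%:E * \int[mu]_x (damp d (u x) `^ p * w x)%:E)%E.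
  exact: cvgeZl.
have hc : (fun i => (d^-1 `^ (p - 1) * C)%:E * h (s i))%E @ \oo --> 0%E.
  rewrite -[X in _ --> X](mule0 (d^-1 `^ (p - 1) * C)%:E).
  have hs : (fun i => h (s i)) @ \oo --> 0%E.
    by apply: (@cvg_comp _ _ _ s h \oo \oo (nbhs 0%E)).
  exact: (cvgeZl _ hs).
have Rc : (fun i => p%:E * (\int[mu]_x (g i x)%:E + (d^-1 `^ (p - 1) * C)%:E * h (s i)))%E @ \oo -->
    (p%:E * \int[mu]_x (damp d (u x) `^ (p - 1) * `|Z x| * w x)%:E)%E.
  apply: cvgeZl => //; rewrite -[X in _ --> X]adde0; apply: cvgeD => //.
    by rewrite fin_num_adde_defl.
rewrite -(cvg_lim _ Lc)// -(cvg_lim _ Rc)//; apply: lee_lim.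
- by apply/cvg_ex; eexists; exact: Lc.
- by apply/cvg_ex; eexists; exact: Rc.
- exact: nearW.
Qed.

End limit_passage.

(** * Mollification *)

Section mollification.
Context {R : realType} {n : nat}.
Local Notation mu := (lebesgue_rV R n).
Implicit Types (g k : 'rV[R]_n -> R) (x y z v : 'rV[R]_n) (e C : R).

Lemma derive_scale k (c : R) v x : differentiable k x -> 'D_(c *: v) k x = c * 'D_v k x.
Proof. by move=> dk; rewrite !deriveE// linearZ. Qed.

Lemma integrable_mul_bounded g k C : mu.-integrable setT (EFin \o g) ->
  measurable_fun setT k -> (forall x, `|k x| <= C) ->
  mu.-integrable setT (EFin \o (fun x => g x * k x)).
Proof.
move=> ig mk kC; have := @integrableMl _ _ _ mu _ measurableT _ k ig mk.
apply; exists C; split; first exact: num_real.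
by move=> y Cy x _ /=; rewrite (le_trans (kC x))// ltW.
Qed.

Lemma integrable_affine g e (b : 'rV[R]_n) : e != 0 ->
  mu.-integrable setT (EFin \o g) ->
  mu.-integrable setT (EFin \o (fun x => g (e *: x + b))).
Proof.
move=> e0 /integrable_norm1[mg goo]; apply: norm1_integrable.
  by apply: (measurableT_comp mg); exact: measurable_addZ_rV.
rewrite /norm1 (ge0_integral_affine b e0 (f := fun x => `|g x|%:E))//.
  by rewrite lte_mul_pinfty// lee_fin exprn_ge0// invr_ge0.
exact: measurable_normE.
Qed.

Lemma Rintegral_affine g e (b : 'rV[R]_n) : e != 0 ->
  mu.-integrable setT (EFin \o g) ->
  \int[mu]_x g (e *: x + b) = `|e|^-1 ^+ n * \int[mu]_x g x.
Proof.
move=> e0 ig; rewrite /Rintegral integral_affine// fineM//.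
exact: integrable_fin_num.
Qed.

(** The kernel is neither normalised nor assumed nonnegative, so that d_j rho is covered as well;
    [hmollify] adds the factor e^-n. *)
Definition mollify k e g x := \int[mu]_y (g y * k (e^-1 *: (x - y))).

Lemma mollifyE k e g x C : e != 0 -> mu.-integrable setT (EFin \o g) ->
  measurable_fun setT k -> (forall x, `|k x| <= C) ->
  mollify k e g x = `|e| ^+ n * \int[mu]_z (g (x - e *: z) * k z).
Proof.
move=> e0 ig mk kC.
have ish : mu.-integrable setT (EFin \o (fun z => g (x - e *: z))).
  have ne0 : - e != 0 by rewrite oppr_eq0.
  have := integrable_affine x ne0 ig.
  by under eq_fun do rewrite scaleNr addrC.
have ce0 : - e^-1 != 0 by rewrite oppr_eq0 invr_eq0.
have := Rintegral_affine (e^-1 *: x) ce0 (integrable_mul_bounded ish mk kC).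
rewrite normrN normfV invrK => <-; apply: eq_Rintegral => y _.
have -> : - e^-1 *: y + e^-1 *: x = e^-1 *: (x - y).
  by rewrite scaleNr addrC -scalerBr.
by rewrite scalerA mulfV// scale1r subKr.
Qed.

Lemma measurable_mollify_kernel k e x : measurable_fun setT k ->
  measurable_fun setT (fun y : 'rV[R]_n => k (e^-1 *: (x - y))).
Proof.
move=> mk; apply: (measurableT_comp mk).
have := measurable_addZ_rV (- e^-1) (e^-1 *: x).
by under eq_fun do rewrite scaleNr addrC -scalerBr.
Qed.

(** For integrable g, a Lipschitz kernel makes the mollification Lipschitz in x. *)
Lemma continuous_mollify k e g C Lp : mu.-integrable setT (EFin \o g) ->
  measurable_fun setT k -> (forall x, `|k x| <= C) ->
  0 <= Lp -> (forall x y, `|k x - k y| <= Lp * `|x - y|) ->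
  continuous (mollify k e g).
Proof.
move=> ig mk kC Lp0 kL x.
have ik x' : mu.-integrable setT (EFin \o (fun y => g y * k (e^-1 *: (x' - y)))).
  by apply: (@integrable_mul_bounded _ _ C) => //; exact: measurable_mollify_kernel.
have ng : mu.-integrable setT (EFin \o (fun y => `|g y|)) by exact: integrable_norm.
pose I := \int[mu]_y `|g y|.
have I0 : 0 <= I by apply: Rintegral_ge0.
have bnd x' : `|mollify k e g x - mollify k e g x'| <= Lp * `|e^-1| * I * `|x - x'|.
  rewrite /mollify -RintegralB//.
  apply: (le_trans (le_normr_Rintegral _ _)) => //.
    exact: (integrableB measurableT (ik x) (ik x')).
  rewrite mulrAC -RintegralZl//; apply: le_Rintegral => //.
  - apply: integrable_norm; exact: (integrableB measurableT (ik x) (ik x')).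
  - exact: (integrableZl measurableT _ ng).
  move=> y _; rewrite -mulrBr normrM mulrC ler_wpM2r// (le_trans (kL _ _))//.
  rewrite -scalerBr normrZ -mulrA ler_wpM2l// ler_wpM2l//.
  by rewrite opprB addrA subrK.
apply: (@cvgrPdist_le _ R^o _ (nbhs x) (nbhs_filter x) (mollify k e g) _).2 => eps eps0.
set D := Lp * `|e^-1| * I + 1.
have D0 : 0 < D by rewrite ltr_wpDl// !mulr_ge0.
have : \forall x' \near x, `|x - x'| <= eps / D.
  by apply: cvgr_dist_le (@cvg_id _ (nbhs x)) _ _; rewrite divr_gt0.
move=> near_x; near=> x'; apply: (le_trans (bnd x')).
have xx' : `|x - x'| <= eps / D by near: x'; exact: near_x.
rewrite (@le_trans _ _ (D * `|x - x'|))//.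
  by rewrite ler_wpM2r// lerDl.
by rewrite mulrC -ler_pdivlMr.
Unshelve. all: by end_near. Qed.

Lemma derive_mollify k e g x v C C' : mu.-integrable setT (EFin \o g) ->
  (forall x, differentiable k x) -> (forall x, `|k x| <= C) ->
  measurable_fun setT ('D_v k) -> (forall x, `|'D_v k x| <= C') ->
  is_derive x v (mollify k e g) (e^-1 * mollify ('D_v k) e g x).
Proof.
move=> ig dk kC mdk dkC.
have mk : measurable_fun setT k.
  by apply: continuous_measurable_rV => y; exact: differentiable_continuous.
pose f (t : R) y := g y * k (e^-1 *: (x - y) + t *: (e^-1 *: v)).
have fE t : \int[mu]_y f t y = mollify k e g (t *: v + x).
  apply: eq_Rintegral => y _; rewrite /f; congr (_ * k _).
  by rewrite [t *: _]scalerA [t * _]mulrC -scalerA -scalerDr addrC addrA.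
have df (t : R) y : is_derive t (1 : R) (f ^~ y) (g y * (e^-1 * 'D_v k (e^-1 *: (x - y) + t *: (e^-1 *: v)))).
  have dkl := is_derive_line (diff_derivable (v := e^-1 *: v) (dk (e^-1 *: (x - y) + t *: (e^-1 *: v)))).
  have -> : e^-1 * 'D_v k (e^-1 *: (x - y) + t *: (e^-1 *: v)) =
      'D_(e^-1 *: v) k (e^-1 *: (x - y) + t *: (e^-1 *: v)).
    by rewrite derive_scale.
  exact: (is_deriveZ (g y) dkl).
(* The derivative along v is that of a one-parameter integral at t = 0; any open interval around 0
   would do. *)
have H := @cvg_differentiation_under_integral R _ _ mu f setT measurableT 0 (-1) 1.
have {}H : h^-1 *: (\int[mu]_y f (h + 0) y - \int[mu]_y f 0 y) @[h --> 0^'] -->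
    \int[mu]_y (partial1of2 f 0 y).
  apply: (H _ _ _ (fun y => `|g y| * (`|e^-1| * C'))).
  - by rewrite /= in_itv/= ltrN10 ltr01.
  - move=> t _; apply: (@integrable_mul_bounded _ _ C) => //.
    apply: (measurableT_comp mk).
    rewrite (_ : (fun _ => _) =
      (fun y => - e^-1 *: y + (e^-1 *: x + t *: (e^-1 *: v)))).
      exact: measurable_addZ_rV.
    by apply/funext => y; rewrite scaleNr scalerBr addrA [- _ + _]addrC.
  - by move=> t y _ _; exact: (@ex_derive _ _ _ _ _ _ _ (df t y)).
  - by move=> y; rewrite !mulr_ge0// (le_trans _ (dkC 0)).
  - apply: (@integrable_mul_bounded (fun y => `|g y|) (cst (`|e^-1| * C'))
      `| `|e^-1| * C' |) => //.
    exact: (integrable_norm ig).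
  - move=> t y _ _; rewrite partial1of2E.
    rewrite (@derive_val _ _ _ _ _ _ _ (df t y)) !normrM.
    by rewrite ler_wpM2l// ler_wpM2l.
have DE : \int[mu]_y (partial1of2 f 0 y) = e^-1 * mollify ('D_v k) e g x.
  rewrite /mollify -RintegralZl//; last first.
    apply: (@integrable_mul_bounded g (fun y => 'D_v k (e^-1 *: (x - y))) C') => //.
    exact: (measurable_mollify_kernel e x mdk).
  apply: eq_Rintegral => y _; rewrite partial1of2E.
  by rewrite (@derive_val _ _ _ _ _ _ _ (df 0 y)) scale0r addr0 mulrCA.
have growthE : (fun h : R => h^-1 *: ((mollify k e g \o shift x) (h *: v) - mollify k e g x)) =
    (fun h : R => h^-1 *: (\int[mu]_y f (h + 0) y - \int[mu]_y f 0 y)).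
  by apply/funext => h /=; rewrite !fE addr0 scale0r add0r.
rewrite DE in H; apply: DeriveDef.
  by rewrite /derivable growthE; apply/cvg_ex; eexists; exact: H.
by rewrite /derive growthE; apply/cvg_lim.
Qed.

Lemma measurable_shift_kernel e : measurable_fun setT
  (fun q : 'rV[R]_n * 'rV[R]_n => q.1 - e *: q.2).
Proof.
apply: measurable_fun_rV => i; under eq_fun do rewrite !mxE.
apply: measurable_funB.
  exact: (measurableT_comp (measurable_coord i) measurable_fst).
apply: measurable_funM => //.
exact: (measurableT_comp (measurable_coord i) measurable_snd).
Qed.

Section mollify_error.
Variables (k g : 'rV[R]_n -> R) (C M : R).
Hypotheses (k0 : forall z, 0 <= k z) (mk : measurable_fun setT k)
  (ik : mu.-integrable setT (EFin \o k))
  (ig : mu.-integrable setT (EFin \o g)) (g_large : forall x, M <= `|x| -> g x = 0).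

(** A common majorant: with k = rho it bounds the error of mollifying g, and with a kernel built
    from the |d_j rho| it bounds the commutators. *)
Definition mollify_error e x : \bar R :=
  (\int[mu]_z (k z * `|g (x - e *: z) - g x|)%:E)%E.

Let mg : measurable_fun setT g. Proof. by have [] := integrable_norm1 ig. Qed.

Let F e (q : 'rV[R]_n * 'rV[R]_n) := (k q.2 * `|g (q.1 - e *: q.2) - g q.1|)%:E.

Let mF e : measurable_fun setT (F e).
Proof.
apply/measurable_EFinP; apply: measurable_funM.
  exact: (measurableT_comp mk measurable_snd).
apply: measurableT_comp => //; apply: measurable_funB.
  exact: (measurableT_comp mg (measurable_shift_kernel e)).
exact: (measurableT_comp mg measurable_fst).
Qed.

Let F0 e q : (0 <= F e q)%E.
Proof. by rewrite lee_fin mulr_ge0. Qed.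

Lemma measurable_mollify_error e : measurable_fun setT (mollify_error e).
Proof. exact: (measurable_fun_fubini_tonelli_F (m2 := mu) (F e) (mF e) (F0 e)). Qed.

Lemma mollify_error_ge0 e x : (0 <= mollify_error e x)%E.
Proof. by apply: integral_ge0 => z _; rewrite lee_fin mulr_ge0. Qed.

(** By Tonelli the integral is that of k (z) times the L^1 distance of g to its translate by - e z.
    This distance tends to 0 for each z and is at most twice the norm of g. *)
Lemma mollify_error_cvg0 (e : nat -> R) : e @ \oo --> (0 : R) ->
  (fun i => \int[mu]_x mollify_error (e i) x)%E @ \oo --> 0%E.
Proof.
move=> e0; have cg := shift_continuous_integrable ig g_large.
have E i : (\int[mu]_x mollify_error (e i) x =
    \int[mu]_z ((k z)%:E * shift_dist g (- (e i *: z))))%E.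
  rewrite (fubini_tonelli (m1 := mu) (m2 := mu) (F (e i)) (mF (e i)) (F0 (e i))).
  apply: eq_integral => z _; rewrite /F /= /shift_dist /norm1 -ge0_integralZl//.
    by apply: measurable_normE; exact: measurable_shiftB.
  by rewrite lee_fin.
rewrite (funext E) -(integral0 mu setT).
have goo := (integrable_norm1 ig).2.
have gfin : norm1 mu g \is a fin_num by rewrite ge0_fin_numE// norm1_ge0.
apply: (@dominated_cvg _ _ _ _ _ measurableT _ _
  (fun z => (norm1 mu g + norm1 mu g) * (k z)%:E)%E).
- move=> i; apply: emeasurable_funM; first exact/measurable_EFinP.
  pose D (q : 'rV[R]_n * 'rV[R]_n) := (`|g (q.1 - e i *: q.2) - g q.1|%:E)%E.
  have D0 q : (0 <= D q)%E by rewrite lee_fin.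
  have mD : measurable_fun setT D.
    apply/measurable_EFinP; apply: measurableT_comp => //; apply: measurable_funB.
      exact: (measurableT_comp mg (measurable_shift_kernel (e i))).
    exact: (measurableT_comp mg measurable_fst).
  exact: (measurable_fun_fubini_tonelli_G (m1 := mu) D mD D0).
- move=> z _; rewrite -[X in _ --> X](mule0 (k z)%:E); apply: cvgeZl => //.
  have H : (fun i => - (e i *: z)) @ \oo --> - ((0 : R) *: z).
    by apply: cvgN; apply: cvgZr_tmp; exact: e0.
  by rewrite scale0r oppr0 in H; exact: cg.
- by move=> z _; apply: fin_numM => //; rewrite fin_numD gfin.
- have -> : (norm1 mu g + norm1 mu g = (fine (norm1 mu g + norm1 mu g))%:E)%E.
    by rewrite fineK// fin_numD gfin.
  exact: integrableZl.
- move=> i z _; rewrite gee0_abs ?mule_ge0 ?lee_fin ?shift_dist_ge0//.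
  by rewrite muleC lee_wpmul2r ?lee_fin// shift_dist_le.
Qed.

End mollify_error.

End mollification.

(** * Smooth functions and compact supports *)

Section smooth_closure.
Context {R : realType} {n : nat}.
Local Notation V := 'rV[R]_n.
Implicit Types (f g : V -> R^o).

Lemma CkD k f g : Ck k f -> Ck k g -> Ck k (fun x => f x + g x : R^o).
Proof.
elim: k f g => [|k ih] f g /=.
  by move=> cf cg x; exact: (cvgD (cf x) (cg x)).
move=> [df cf] [dg cg]; split=> [x|v]; first exact: differentiableD.
rewrite (_ : 'D_v _ = (fun x => 'D_v f x + 'D_v g x)); first exact: ih.
by apply/funext => x; rewrite -deriveD//; exact: diff_derivable.
Qed.

Lemma CkM k f g : smooth f -> smooth g -> Ck k (fun x => f x * g x : R^o).
Proof.
elim: k f g => [|k ih] f g sf sg /=.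
  have cf : continuous (f : V -> R) := smooth_continuous sf.
  have cg : continuous (g : V -> R) := smooth_continuous sg.
  by move=> x; exact: (cvgM (cf x) (cg x)).
have df x := smooth_differentiable x sf.
have dg x := smooth_differentiable x sg.
split=> [x|v]; first exact: differentiableM.
rewrite (_ : 'D_v _ = (fun x => f x * 'D_v g x + g x * 'D_v f x)).
  by apply: CkD; apply: ih => //; exact: smooth_derive.
by apply/funext => x; rewrite (deriveM (f := f) (g := g))//; exact: diff_derivable.
Qed.

Lemma Ck_cst k (c : R^o) : Ck k (cst c : V -> R^o).
Proof.
elim: k c => [|k ih] c /=; first exact: cst_continuous.
split=> [x|v]; first exact: differentiable_cst.
have -> : 'D_v (cst c : V -> R^o) = cst 0 by apply/funext => x; exact: derive_cst.
exact: ih.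
Qed.

Lemma Ck_addZ k f (a : R) (b : V) : smooth f -> Ck k (fun x => f (a *: x + b)).
Proof.
have dA x : differentiable (fun x : V => a *: x + b) x.
  by apply: differentiableD => //; apply: differentiableZ.
elim: k f => [|k ih] f sf /=.
  move=> x; have cA := differentiable_continuous (dA x).
  have cf := smooth_continuous sf (x := a *: x + b).
  exact: (cvg_comp _ _ cA cf).
split=> [x|v].
  apply: (differentiable_comp (f := fun x : V => a *: x + b) (dA x)).
  exact: smooth_differentiable.
have -> : 'D_v (fun x => f (a *: x + b)) = (fun x => 'D_(a *: v) f (a *: x + b)).
  by apply/funext => x; rewrite derive_addZ.
exact: (ih _ (smooth_derive (a *: v) sf)).
Qed.

Lemma Cc_infty_supp (U : set V) f : Cc_infty U (f : V -> R) ->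
  exists2 L, 0 < L & forall x, L <= `|x| -> f x = 0.
Proof.
move=> [_ /compact_sub_ball[L L0 suppL] _]; exists (L + 1); first exact: ltr_wpDr.
move=> x Lx; apply/eqP; apply: contraPT Lx => fx0.
have /suppL /= : closure [set x | f x != 0] x by exact: subset_closure.
by move=> xL; apply/negP; rewrite -ltNge (le_lt_trans xL)// ltrDl.
Qed.

Lemma Cc_inftyT f L : smooth f -> (forall x, L <= `|x| -> f x = 0) ->
  Cc_infty [set: V] (f : V -> R).
Proof.
move=> sf f0; split => //.
apply: (subclosed_compact (@closed_closure _ _) (@compact_rV_ball R n L)).
have cB : closed [set x : V | `|x| <= L].
  rewrite (_ : [set _ | _] = (@Num.norm _ V) @^-1` [set t | t <= L]) //.
  by apply: closed_comp => [x _|]; [exact: norm_continuous|exact: closed_le].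
rewrite [X in _ `<=` X](closure_id _).1//; apply: closure_subset => x /= fx0.
by rewrite leNgt; apply: contra fx0 => /ltW /f0 ->.
Qed.

Lemma bounded_continuous_supp (f : V -> R) L : continuous f ->
  (forall x, L <= `|x| -> f x = 0) -> exists2 C, 0 <= C & forall x, `|f x| <= C.
Proof.
move=> cf f0; have [C C0 fC] := continuous_bounded_on_ball L cf.
exists C => // x; have [xL|xL] := leP `|x| L; first exact: fC.
by rewrite f0 ?normr0// ltW.
Qed.

Lemma lipschitz_smooth_supp f L : smooth f -> (forall x, L <= `|x| -> f x = 0) ->
  exists2 C, 0 <= C & forall x y, `|f x - f y| <= C * `|x - y|.
Proof.
move=> sf f0.
have D0 j x : L + 1 <= `|x| -> 'D_'e_j f x = 0.
  by move=> Lx; apply: (@derive_supp R n f 'e_j L f0 x); rewrite (lt_le_trans _ Lx)// ltrDl.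
have /choice[C CP] : forall j : 'I_n, exists C, 0 <= C /\ forall x, `|'D_'e_j f x| <= C.
  move=> j; have [C C0 CP] := bounded_continuous_supp (smooth_derive_continuous sf) (D0 j).
  by exists C.
exists ((\sum_j C j) *+ n); first by rewrite mulrn_wge0// sumr_ge0// => j _; have [] := CP j.
move=> x y; apply: (@rV_lipschitz _ _ f (Num.max `|x| `|y|)).
- by rewrite sumr_ge0// => j _; have [] := CP j.
- by move=> z; exact: smooth_differentiable.
- move=> z j _; have [_ /(_ z) /le_trans] := CP j; apply.
  by rewrite (bigD1 j)//= lerDl sumr_ge0// => i _; have [] := CP i.
- by rewrite le_max lexx.
- by rewrite le_max lexx orbT.
Qed.

(** The square of a nonzero test function, divided by its integral, is a mollifying kernel. The
    function f of the theorem will be used for this. *)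
Lemma exists_bump (U : set V) f x0 : Cc_infty U (f : V -> R) -> f x0 != 0 ->
  exists rho : V -> R^o, exists L, [/\ 0 < L, smooth rho, forall x, 0 <= (rho x : R),
    forall x, L <= `|x| -> rho x = 0 & \int[lebesgue_rV R n]_x (rho x : R) = 1].
Proof.
move=> fC fx0; have [L L0 f0] := Cc_infty_supp fC; have [sf _ _] := fC.
have cf : continuous (f : V -> R) := smooth_continuous sf.
pose g x : R := (f x : R) * f x.
have cg : continuous g by move=> x; exact: (cvgM (cf x) (cf x)).
have g0 x : 0 <= g x by rewrite /g -expr2 sqr_ge0.
have g_large x : L <= `|x| -> g x = 0 by move=> /f0; rewrite /g => ->; rewrite mul0r.
have ig := integrable_continuous_supp cg g_large.
pose c := \int[lebesgue_rV R n]_x g x.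
have c0 : 0 < c.
  have gx0 : 0 < g x0 by rewrite lt_neqAle g0 andbT eq_sym mulf_neq0.
  have gx2 : g x0 / 2 < g x0 by rewrite ltr_pdivrMr// mulr_natr mulr2n ltrDl.
  have /nbhs_ballP[d /= d0 dg] : \forall x \near x0, g x0 / 2 < g x.
    exact: (cg x0 _ (lt_nbhsr gx2)).
  (* On this cube around x0 the square g stays above half of its value at x0, and the cube has
     positive measure; hence c > 0. *)
  pose D := [set x : V | forall i, ball (x0 ord0 i) d (x ord0 i)].
  have mD : measurable D.
    apply: (@measurable_rV_box R n (fun i => ball (x0 ord0 i) d)) => i.
    exact: measurable_ball.
  have muD : lebesgue_rV R n D = ((d *+ 2) ^+ n)%:E.
    rewrite (@lebesgue_rV_box R n (fun i => ball (x0 ord0 i) d)); last first.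
      by move=> i; exact: measurable_ball.
    rewrite -[X in _ = (_ ^+ X)%:E](card_ord n) -prodr_const -prodEFin; apply: eq_bigr => i _.
    by rewrite lebesgue_measure_ball// ltW.
  have : ((g x0 / 2 * (d *+ 2) ^+ n)%:E <= \int[lebesgue_rV R n]_x (g x)%:E)%E.
    rewrite EFinM -muD -integral_cst//.
    apply: (@le_trans _ _ (\int[lebesgue_rV R n]_(x in D) (g x)%:E)%E).
      apply: ge0_le_integral => //.
      - by move=> x _; rewrite lee_fin divr_ge0.
      - by apply/measurable_funTS/measurable_EFinP; exact: continuous_measurable_rV.
      - move=> x Dx; rewrite lee_fin ltW//; apply: dg.
        rewrite -ball_normE/=; apply: rV_norm_lt => // i; rewrite !mxE.
        by have := Dx i; rewrite -ball_normE.
    apply: ge0_subset_integral => //.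
      by apply/measurable_EFinP; exact: continuous_measurable_rV.
    by move=> x _; rewrite lee_fin.
  rewrite -[leRHS]fineK ?lee_fin; last exact: integrable_fin_num.
  apply: lt_le_trans.
  by rewrite mulr_gt0 ?divr_gt0// exprn_gt0// mulr2n addr_gt0.
exists (fun x => cst (c^-1 : R^o) x * (fun x => f x * f x : R^o) x), L; split => //.
- move=> k; apply: CkM; first by move=> ?; exact: Ck_cst.
  by move=> ?; exact: CkM.
- by move=> x; apply: mulr_ge0; [rewrite invr_ge0 ltW|exact: g0].
- by move=> x Lx; rewrite -/(g x) g_large// mulr0.
- by rewrite /= (RintegralZl (f := g))// mulVf ?gt_eqF.
Qed.

End smooth_closure.

(** * Mollification of weak horizontal gradients *)

Section horizontal_mollification.
Context {R : realType} (G : stratified_group R).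
Local Notation N := (hdim G).
Local Notation n := (hdim G + sumn (vdims G))%N.
Local Notation mu := (lebesgue_rV R n).
Variables (rho : 'rV[R]_n -> R^o) (L : R).
Hypotheses (L0 : 0 < L) (srho : smooth rho) (rho0 : forall x, 0 <= (rho x : R))
  (rho_large : forall x, L <= `|x| -> rho x = 0)
  (rho1 : \int[mu]_x (rho x : R) = 1).

Variables (u : 'rV[R]_n -> R) (r M : R).
Hypotheses (r0 : 0 < r) (iu : mu.-integrable setT (EFin \o u))
  (u0 : forall x, hsqnorm x < r \/ M <= `|x| -> u x = 0).

Let drho j : 'rV[R]_n -> R := 'D_'e_j rho.

Let crho : continuous (rho : 'rV[R]_n -> R). Proof. exact: smooth_continuous srho. Qed.

Let mrho : measurable_fun setT (rho : 'rV[R]_n -> R).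
Proof. exact: continuous_measurable_rV. Qed.

Let cdrho j : continuous (drho j).
Proof. exact: smooth_continuous (smooth_derive _ srho). Qed.

Let mdrho j : measurable_fun setT (drho j).
Proof. exact: continuous_measurable_rV. Qed.

Let drho_large j x : L < `|x| -> drho j x = 0.
Proof. by move=> Lx; apply: (@derive_supp R n rho 'e_j L rho_large x). Qed.

Let drho_large1 j x : L + 1 <= `|x| -> drho j x = 0.
Proof. by move=> Lx; apply: drho_large; rewrite (lt_le_trans _ Lx)// ltrDl. Qed.

Let rhoB : exists2 C, 0 <= C & forall x, `|rho x : R| <= C.
Proof. exact: bounded_continuous_supp rho_large. Qed.

Let drhoB j : exists2 C, 0 <= C & forall x, `|drho j x| <= C.
Proof. exact: bounded_continuous_supp (drho_large1 j). Qed.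

Let drhoL j : exists2 C, 0 <= C & forall x y, `|drho j x - drho j y| <= C * `|x - y|.
Proof. exact: (lipschitz_smooth_supp (smooth_derive _ srho) (drho_large1 j)). Qed.

Definition hmollify (e : R) x : R := (e ^+ n)^-1 * mollify (rho : 'rV[R]_n -> R) e u x.

Lemma is_derive_hmollify e j x : is_derive x 'e_j (hmollify e)
  ((e ^+ n)^-1 * (e^-1 * mollify (drho j) e u x)).
Proof.
have [C _ rC] := rhoB; have [C' _ dC] := drhoB j.
have dm := @derive_mollify R n (rho : 'rV[R]_n -> R) e u x 'e_j C C' iu
  (fun y => smooth_differentiable y srho) rC (mdrho j) dC.
exact: (is_deriveZ (e ^+ n)^-1 dm).
Qed.

Lemma derive_hmollify e j x :
  'D_'e_j (hmollify e) x = (e ^+ n)^-1 * (e^-1 * mollify (drho j) e u x).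
Proof. exact: (@derive_val _ _ _ _ _ _ _ (is_derive_hmollify e j x)). Qed.

Lemma C1at_hmollify e x : C1at (hmollify e) x.
Proof.
split.
- have [C _ rC] := rhoB; have [Lp Lp0 rL] := lipschitz_smooth_supp srho rho_large.
  have cm := @continuous_mollify R n (rho : 'rV[R]_n -> R) e u C Lp iu mrho rC Lp0 rL x.
  exact: (cvgM (cvg_cst _) cm).
- apply: (@filterS _ (nbhs x) _ setT) filterT => y _ j.
  exact: (@ex_derive _ _ _ _ _ _ _ (is_derive_hmollify e j y)).
- move=> j; have [C _ rC] := drhoB j; have [Lp Lp0 rL] := drhoL j.
  have cm := @continuous_mollify R n (drho j) e u C Lp iu (mdrho j) rC Lp0 rL x.
  have -> : 'D_'e_j (hmollify e) =
      (fun y => (e ^+ n)^-1 * (e^-1 * mollify (drho j) e u y)).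
    by apply/funext => y; rewrite derive_hmollify.
  exact: (cvgM (cvg_cst _) (cvgM (cvg_cst _) cm)).
Qed.

Lemma hmollifyE e x : 0 < e -> hmollify e x = \int[mu]_z (u (x - e *: z) * rho z).
Proof.
move=> e0; have [C _ rC] := rhoB.
rewrite /hmollify (@mollifyE R n (rho : 'rV[R]_n -> R) e u x C)// ?gt_eqF// (gtr0_norm e0).
by rewrite mulrA mulVf ?mul1r// expf_neq0// gt_eqF.
Qed.

Lemma integrable_shift_mul (g k : 'rV[R]_n -> R) e x C : 0 < e ->
  mu.-integrable setT (EFin \o g) -> measurable_fun setT k ->
  (forall z, `|k z| <= C) ->
  mu.-integrable setT (EFin \o (fun z => g (x - e *: z) * k z)).
Proof.
move=> e0 ig mk kC; apply: (@integrable_mul_bounded R n (fun z => g (x - e *: z)) k C) => //.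
have ne0 : - e != 0 by rewrite oppr_eq0 gt_eqF.
have := integrable_affine x ne0 ig.
by under eq_fun do rewrite scaleNr addrC.
Qed.

Lemma Rintegral_eq0 (g : 'rV[R]_n -> R) : (forall x, g x = 0) -> \int[mu]_x g x = 0.
Proof. by move=> g0; rewrite /Rintegral integral0_eq// => x _; rewrite g0. Qed.

(** By (A - B)^2 <= 2 A^2 + 2 B^2 in each coordinate, |x' - e z'|^2 <= 2 |x'|^2 + 2 N (e L)^2 for
    |z| <= L, which is below r/2 + r/2. This is the origin of r / 4. *)
Lemma hmollify_supp e x : 0 < e -> e * L <= 1 -> (e * L) ^+ 2 *+ N *+ 2 <= r / 2 ->
  hsqnorm x < r / 4 \/ M + 1 <= `|x| -> hmollify e x = 0.
Proof.
move=> e0 eL1 eLr hx; rewrite hmollifyE//; apply: Rintegral_eq0 => z.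
have [Lz|zL] := leP L `|z|; first by rewrite rho_large// mulr0.
have ezL : `|e *: z| <= e * L.
  by rewrite normrZ (gtr0_norm e0) ler_wpM2l// ltW.
rewrite u0 ?mul0r//; case: hx => [xr|xM]; [left|right].
  apply: (@le_lt_trans _ _ (2 * hsqnorm x + (e * L) ^+ 2 *+ N *+ 2)).
    have -> : (e * L) ^+ 2 *+ N *+ 2 = \sum_(i < N) 2 * (e * L) ^+ 2.
      by rewrite sumr_const card_ord mulr_natl mulrnAC.
    rewrite /hsqnorm mulr_sumr -big_split/=; apply: ler_sum => i _.
    have -> : hcoord i (x - e *: z) = hcoord i x - hcoord i (e *: z).
      by rewrite /hcoord !mxE.
    have : hcoord i (e *: z) ^+ 2 <= (e * L) ^+ 2.
      rewrite -[leLHS]real_normK ?num_real// ler_pXn2r ?nnegrE ?mulr_ge0 ?(ltW e0) ?(ltW L0)//.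
      exact: le_trans (coord_le_norm _ _) ezL.
    have := sqr_ge0 (hcoord i x + hcoord i (e *: z)).
    set A := hcoord i x; set B := hcoord i (e *: z); set D := (e * L) ^+ 2.
    by rewrite sqrrD sqrrB; lra.
  by move: xr eLr; move: (hsqnorm x) (_ *+ N *+ 2) => A D; lra.
have := ler_normB (x - e *: z) (- (e *: z)).
by rewrite opprK subrK normrN; lra.
Qed.

Lemma continuous_subZ e x : continuous (fun z : 'rV[R]_n => x - e *: z).
Proof.
have -> : (fun z : 'rV[R]_n => x - e *: z) = (fun z => - e *: z + x).
  by apply/funext => z; rewrite scaleNr addrC.
move=> z; apply: differentiable_continuous.
by apply: differentiableD => //; apply: differentiableZ.
Qed.

Lemma integrable_sumR (I : Type) (s : seq I) (g : I -> 'rV[R]_n -> R) :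
  (forall i, mu.-integrable setT (EFin \o g i)) ->
  mu.-integrable setT (EFin \o (fun x => \sum_(i <- s) g i x)).
Proof.
move=> ig; rewrite (_ : EFin \o _ = (fun x => \sum_(i <- s) (g i x)%:E)%E).
  by apply: integrable_sum => // i _; exact: ig.
by apply/funext => x; rewrite /= sumEFin.
Qed.

Lemma Rintegral_sum (I : Type) (s : seq I) (g : I -> 'rV[R]_n -> R) :
  (forall i, mu.-integrable setT (EFin \o g i)) ->
  \int[mu]_x (\sum_(i <- s) g i x) = \sum_(i <- s) \int[mu]_x g i x.
Proof.
move=> ig; elim: s => [|i s ih].
  by rewrite big_nil Rintegral_eq0// => x; rewrite big_nil.
rewrite big_cons -ih -RintegralD//; last exact: integrable_sumR.
by apply: eq_Rintegral => x _; rewrite big_cons.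
Qed.

Lemma EFin_norm_Rintegral_le (g h : 'rV[R]_n -> R) :
  mu.-integrable setT (EFin \o g) -> measurable_fun setT h ->
  (forall z, `|g z| <= h z) -> (`|\int[mu]_z g z|%:E <= \int[mu]_z (h z)%:E)%E.
Proof.
move=> ig mh gh; rewrite EFin_normr_Rintegral//.
apply: (le_trans (le_abse_integral _ _ _)) => //; first by case/integrableP : ig.
apply: ge0_le_integral => //.
- by apply: measurableT_comp => //; case/integrableP : ig.
- by apply/measurable_EFinP.
- by move=> z _; rewrite lee_fin.
Qed.

Lemma measurable_error_kernel (k g : 'rV[R]_n -> R) e x : measurable_fun setT k ->
  measurable_fun setT g ->
  measurable_fun setT (fun z : 'rV[R]_n => k z * `|g (x - e *: z) - g x|).
Proof.
move=> mk mg; apply: measurable_funM => //; apply: measurableT_comp => //.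
apply: measurable_funB => //; apply: (measurableT_comp mg).
have := measurable_addZ_rV (- e) x.
by under eq_fun do rewrite scaleNr addrC.
Qed.

Let mu_ : measurable_fun setT u. Proof. by have [] := integrable_norm1 iu. Qed.

Let irho : mu.-integrable setT (EFin \o (rho : 'rV[R]_n -> R)).
Proof. exact: integrable_continuous_supp rho_large. Qed.

Lemma mollify_difference (g : 'rV[R]_n -> R) e x : 0 < e ->
  mu.-integrable setT (EFin \o g) ->
  (`|\int[mu]_z (g (x - e *: z) * rho z) - g x|%:E <=
   mollify_error (rho : 'rV[R]_n -> R) g e x)%E.
Proof.
move=> e0 ig; have [C _ rC] := rhoB; have [mg _] := integrable_norm1 ig.
have i1 := @integrable_shift_mul g (rho : 'rV[R]_n -> R) e x C e0 ig mrho rC.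
have i2 : mu.-integrable setT (EFin \o (fun z => g x * (rho z : R))).
  exact: (integrableZl measurableT (g x) irho).
have {1}-> : g x = \int[mu]_z (g x * rho z).
  by rewrite (RintegralZl (f := rho : 'rV[R]_n -> R))// rho1 mulr1.
rewrite -RintegralB//; apply: EFin_norm_Rintegral_le.
- exact: (integrableB measurableT i1 i2).
- exact: measurable_error_kernel.
- by move=> z; rewrite -mulrBl normrM (ger0_norm (rho0 z)) mulrC.
Qed.

Section gradient.
Variables (k : 'I_N) (Vk : 'rV[R]_n -> R).
Hypotheses (mVk : measurable_fun setT Vk)
  (iVk : forall K, compact K -> mu.-integrable K (EFin \o Vk))
  (weak : forall psi, Cc_infty [set: 'rV[R]_n] psi ->
    (\int[mu]_x (u x * hderive (k : 'I_(hdim G)) (psi : gpoint G -> R) x)%:E =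
     - \int[mu]_x (Vk x * psi x)%:E)%E).

Let a j : 'rV[R]_n -> R := hcoef k j.

(** [Vk] is only locally integrable. Its mollifications are evaluated at |x| <= M + 1 with a kernel
    of radius e L <= 1, so the cut at M + 2 does not affect them. *)
Definition hcut x := \1_(@hball R G (M + 2)) x * Vk x.

Let mball T : measurable (@hball R G T). Proof. exact: measurable_rV_ball. Qed.

Lemma integrable_hcut : mu.-integrable setT (EFin \o hcut).
Proof.
have := iVk (@compact_rV_ball R n (M + 2)).
move/(integrable_mkcond _ (mball (M + 2))); congr (_.-integrable _ _).
apply/funext => x; rewrite /patch /hcut /=; case: ifPn => xB.
  by rewrite indicE xB mul1r.
by rewrite indicE (negbTE xB) mul0r.
Qed.

Lemma continuous_hcoef j : continuous (a j).
Proof. by move=> x; exact/differentiable_continuous/differentiable_hcoef. Qed.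

Let ua j x := u x * a j x.

Lemma integrable_hcoef_mul j : mu.-integrable setT (EFin \o ua j).
Proof.
have [C C0 aC] := continuous_bounded_on_ball M (@continuous_hcoef j).
pose b x := \1_(@hball R G M) x * a j x.
have -> : EFin \o ua j = EFin \o (fun x => u x * b x).
  apply/funext => x; rewrite /= /ua /b; congr EFin.
  have [xM|xM] := leP M `|x|; first by rewrite u0 ?mul0r//; right.
  by rewrite indicE mem_set ?mul1r// /hball /= ltW.
apply: (@integrable_mul_bounded R n u b C) => //.
  apply: measurable_funM; first exact/measurable_indicP.
  by apply: continuous_measurable_rV; exact: continuous_hcoef.
move=> x; rewrite /b indicE; have [xB|xB] := boolP (x \in _).
  by rewrite mul1r aC//; move: xB; rewrite inE.
by rewrite mul0r normr0.
Qed.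

(** The weak gradient is tested with psi (y) = rho ((x - y) / e). The derivative X_k psi (y) is -
    1/e times the sum of the a_j (y) (d_j rho) ((x - y) / e), and the bounds on e and x keep the
    support of psi in the ball of radius M + 2. *)
Lemma mollify_weak e x : 0 < e -> e * L <= 1 -> `|x| <= M + 1 ->
  \int[mu]_z (hcut (x - e *: z) * rho z) =
  e^-1 * \sum_j \int[mu]_z (ua j (x - e *: z) * drho j z).
Proof.
move=> e0 eL1 xM; have [C _ rC] := rhoB.
pose psi : 'rV[R]_n -> R^o := fun y => rho ((- e^-1) *: y + e^-1 *: x).
have psiE y : psi y = rho (e^-1 *: (x - y)).
  by rewrite /psi scaleNr addrC -scalerBr.
have spsi : smooth psi by move=> i; exact: Ck_addZ.
have psi_large y : M + 2 <= `|y| -> psi y = 0.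
  move=> My; rewrite psiE rho_large// normrZ gtr0_norm ?invr_gt0//.
  rewrite mulrC ler_pdivlMr// mulrC (le_trans eL1)//.
  by have := ler_normB x (x - y); rewrite subKr; lra.
have Cpsi := Cc_inftyT spsi psi_large.
have dpsi y : differentiable psi y by exact: smooth_differentiable.
have hpsi y : hderive k (psi : gpoint G -> R) y =
    - (e^-1 * \sum_j a j y * drho j (e^-1 *: (x - y))).
  rewrite hderiveE// /hpartial -mulNr mulr_sumr; apply: eq_bigr => j _.
  rewrite /psi derive_addZ derive_scale; last exact: smooth_differentiable.
  by rewrite scaleNr addrC -scalerBr; rewrite mulrCA.
have H : \int[mu]_y (u y * hderive k (psi : gpoint G -> R) y) =
    - \int[mu]_y (Vk y * psi y).
  by rewrite /Rintegral (weak Cpsi) fineN.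
have HV : \int[mu]_y (Vk y * psi y) = mollify (rho : 'rV[R]_n -> R) e hcut x.
  apply: eq_Rintegral => y _; rewrite -psiE /hcut.
  have [My|yM] := ltP (M + 2) `|y|; first by rewrite psi_large ?mulr0// ltW.
  by rewrite indicE mem_set ?mul1r.
have imol j : mu.-integrable setT (EFin \o (fun y => ua j y * drho j (e^-1 *: (x - y)))).
  have [C' _ dC] := drhoB j.
  apply: (@integrable_mul_bounded R n (ua j) (fun y => drho j (e^-1 *: (x - y))) C') => //.
    exact: integrable_hcoef_mul.
  exact: measurable_mollify_kernel.
have HU : \int[mu]_y (u y * hderive k (psi : gpoint G -> R) y) =
    - (e^-1 * \sum_j mollify (drho j) e (ua j) x).
  rewrite /mollify -Rintegral_sum// -mulNr -RintegralZl//; last exact: integrable_sumR.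
  apply: eq_Rintegral => y _; rewrite hpsi mulrN mulrCA mulNr; congr (- (_ * _)).
  by rewrite mulr_sumr; apply: eq_bigr => j _; rewrite mulrA.
have {H HU HV}E3 : e^-1 * \sum_j mollify (drho j) e (ua j) x =
    mollify (rho : 'rV[R]_n -> R) e hcut x.
  exact: (oppr_inj (etrans (esym HU) (etrans H (congr1 -%R HV)))).
have en0 : e ^+ n != 0 by rewrite expf_neq0// gt_eqF.
have mollE (g q : 'rV[R]_n -> R) B : mu.-integrable setT (EFin \o g) ->
    measurable_fun setT q -> (forall z, `|q z| <= B) ->
    mollify q e g x = e ^+ n * \int[mu]_z (g (x - e *: z) * q z).
  move=> ig mq qB; have := @mollifyE R n q e g x B _ ig mq qB.
  by rewrite (gtr0_norm e0); apply; rewrite gt_eqF.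
have E1 : \sum_j mollify (drho j) e (ua j) x =
    e ^+ n * \sum_j \int[mu]_z (ua j (x - e *: z) * drho j z).
  rewrite mulr_sumr; apply: eq_bigr => j _; have [C' _ dC] := drhoB j.
  exact: (mollE _ _ C' (integrable_hcoef_mul j) (mdrho j) dC).
have E2 := mollE _ _ C integrable_hcut mrho rC.
apply: (mulfI en0).
exact: (etrans (esym E2) (etrans (esym E3)
  (etrans (congr1 (fun t => e^-1 * t) E1) (mulrCA _ _ _)))).
Qed.

Let continuous_mul (f g : 'rV[R]_n -> R) : continuous f -> continuous g ->
  continuous (fun x => f x * g x).
Proof. by move=> cf cg z; exact: (cvgM (cf z) (cg z)). Qed.

Lemma continuous_increment e x j : continuous (fun z : 'rV[R]_n => a j x - a j (x - e *: z)).
Proof.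
move=> z; have caA : a j (x - e *: w) @[w --> z] --> a j (x - e *: z).
  exact: (cvg_comp _ _ (@continuous_subZ e x z) (@continuous_hcoef j (x - e *: z))).
exact: (cvgB (cvg_cst (a j x)) caA).
Qed.

(* [derive_hcoef0] makes the kernels d_j rho (z) (a_j (x) - a_j (x - e z)) have mean
   zero. *)
Lemma commutator_mean0 e x j :
  \int[mu]_z ((a j x - a j (x - e *: z)) * drho j z) = 0.
Proof.
pose b (z : 'rV[R]_n) := a j x - a j (x - e *: z).
have bE : b = (fun z => a j x - a j (- e *: z + x)).
  by apply/funext => z; rewrite /b scaleNr [- (e *: z) + x]addrC.
have da y : differentiable (a j) y by exact: differentiable_hcoef.
have aN z : derivable (fun z => a j (- e *: z + x)) z 'e_j.
  by apply: derivable_addZ; exact: diff_derivable.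
have db z : derivable b z 'e_j by rewrite bE; exact: derivableB.
have Db z : 'D_'e_j b z = 0.
  rewrite bE (deriveB (f := cst (a j x)) (g := fun z => a j (- e *: z + x)))//.
  by rewrite derive_cst derive_addZ derive_scale// derive_hcoef0 mulr0 subrr.
have dr z : derivable (rho : 'rV[R]_n -> R) z 'e_j.
  exact: diff_derivable (smooth_differentiable z srho).
have Dbr : 'D_'e_j (fun z => b z * (rho z : R)) = (fun z => b z * drho j z).
  by apply/funext => z; rewrite derive_mul// Db mulr0 addr0.
have H := @integral_derive0 R n (fun z => b z * (rho z : R)) 'e_j L.
have H0 : (\int[mu]_z ('D_'e_j (fun z => b z * (rho z : R)) z)%:E = 0)%E.
  apply: H.
  - by move=> z; exact: (derivableM (db z) (dr z)).
  - exact: (continuous_mul (@continuous_increment e x j) crho).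
  - by rewrite Dbr; exact: (continuous_mul (@continuous_increment e x j) (@cdrho j)).
  - by move=> z /rho_large ->; rewrite mulr0.
rewrite /Rintegral -[RHS]/(fine 0%E); congr fine; apply: etrans H0.
by apply: eq_integral => z _; exact: (congr1 (fun g : _ -> R => (g z)%:E) (esym Dbr)).
Qed.

Let integrable_commutator e x j : mu.-integrable setT
  (EFin \o (fun z => (a j x - a j (x - e *: z)) * drho j z)).
Proof.
apply: (@integrable_continuous_supp R n _ (L + 1)); last first.
  by move=> z /drho_large1 ->; rewrite mulr0.
exact: (continuous_mul (@continuous_increment e x j) (@cdrho j)).
Qed.

Let integrable_commutator_mul e x j : 0 < e -> mu.-integrable setT
  (EFin \o (fun z => (u (x - e *: z) - u x) *
    (e^-1 * (a j x - a j (x - e *: z)) * drho j z))).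
Proof.
move=> e0.
have i1 : mu.-integrable setT (EFin \o (fun z => u (x - e *: z) * drho j z)).
  by have [C _ dC] := drhoB j; exact: (@integrable_shift_mul u (drho j) e x C).
have i2 : mu.-integrable setT (EFin \o (fun z => ua j (x - e *: z) * drho j z)).
  have [C _ dC] := drhoB j; apply: (@integrable_shift_mul (ua j) (drho j) e x C) => //.
  exact: integrable_hcoef_mul.
rewrite (_ : (fun z => _) = (fun z => e^-1 * (a j x * (u (x - e *: z) * drho j z) -
    ua j (x - e *: z) * drho j z - u x * ((a j x - a j (x - e *: z)) * drho j z)))).
  have i5 := integrableZl measurableT (a j x) i1.
  have i6 := integrableZl measurableT (u x) (@integrable_commutator e x j).
  have i7 := integrableB measurableT (integrableB measurableT i5 i2) i6.
  exact: (integrableZl measurableT e^-1 i7).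
by apply/funext => z; rewrite /ua; ring.
Qed.

(** The left side is the commutator of X_k with the mollification. [mollify_weak] turns it into an
    integral of u (x - e z) against the kernels of [commutator_mean0], and mean zero allows u (x) to
    be subtracted. *)
Lemma hpartial_hmollify_sub e x : 0 < e -> e * L <= 1 -> `|x| <= M + 1 ->
  hpartial k (hmollify e) x - \int[mu]_z (hcut (x - e *: z) * rho z) =
  \int[mu]_z (\sum_j (u (x - e *: z) - u x) *
    (e^-1 * (a j x - a j (x - e *: z)) * drho j z)).
Proof.
move=> e0 eL1 xM; rewrite mollify_weak//.
have i1 j : mu.-integrable setT (EFin \o (fun z => u (x - e *: z) * drho j z)).
  by have [C _ dC] := drhoB j; exact: (@integrable_shift_mul u (drho j) e x C).
have i2 j : mu.-integrable setT (EFin \o (fun z => ua j (x - e *: z) * drho j z)).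
  have [C _ dC] := drhoB j; apply: (@integrable_shift_mul (ua j) (drho j) e x C) => //.
  exact: integrable_hcoef_mul.
have i3 j := @integrable_commutator e x j.
have i4 j := @integrable_commutator_mul e x j e0.
rewrite Rintegral_sum// mulr_sumr /hpartial -sumrB; apply: eq_bigr => j _.
have -> : 'D_'e_j (hmollify e) x = e^-1 * \int[mu]_z (u (x - e *: z) * drho j z).
  have [C _ dC] := drhoB j.
  rewrite derive_hmollify (@mollifyE R n (drho j) e u x C)// ?(gtr0_norm e0) ?gt_eqF//.
  by rewrite mulrCA [_ * (e ^+ n * _)]mulrA mulVf ?mul1r// expf_neq0// gt_eqF.
have i5 : mu.-integrable setT (EFin \o (fun z => a j x * (u (x - e *: z) * drho j z))).
  exact: (integrableZl measurableT _ (i1 j)).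
have i6 : mu.-integrable setT (EFin \o (fun z => u x * ((a j x - a j (x - e *: z)) * drho j z))).
  exact: (integrableZl measurableT _ (i3 j)).
have i7 : mu.-integrable setT (EFin \o (fun z => a j x * (u (x - e *: z) * drho j z) -
    ua j (x - e *: z) * drho j z)).
  exact: (integrableB measurableT i5 (i2 j)).
have E : \int[mu]_z ((u (x - e *: z) - u x) *
      (e^-1 * (a j x - a j (x - e *: z)) * drho j z)) =
    \int[mu]_z (e^-1 * (a j x * (u (x - e *: z) * drho j z) -
    ua j (x - e *: z) * drho j z - u x * ((a j x - a j (x - e *: z)) * drho j z))).
  by apply: eq_Rintegral => z _; rewrite /ua; ring.
rewrite E RintegralZl//; last exact: (integrableB measurableT i7 i6).
rewrite RintegralB// RintegralB// RintegralZl// RintegralZl// commutator_mean0.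
by rewrite -/(a j x); ring.
Qed.

(** [D] is a Lipschitz constant of all a_j on the ball of radius M + 2, which contains x and x - e
    z. On the support of d_j rho the increment of a_j is thus at most D e L; this cancels the factor
    1/e and leaves a kernel [kap] that does not depend on e. *)
Lemma hpartial_hmollify_error : exists kap : 'rV[R]_n -> R,
  [/\ forall z, 0 <= kap z, measurable_fun setT kap,
      mu.-integrable setT (EFin \o kap)
    & forall e x, 0 < e -> e * L <= 1 -> `|x| <= M + 1 ->
      (`|hpartial k (hmollify e) x - Vk x|%:E <=
       mollify_error (rho : 'rV[R]_n -> R) hcut e x + mollify_error kap u e x)%E].
Proof.
have /choice[C CP] : forall q : 'I_n * 'I_n, exists C, 0 <= C /\
    forall x, `|x| <= M + 2 -> `|'D_'e_(q.2) (a q.1) x| <= C.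
  move=> q; have [C C0 CP] := continuous_bounded_on_ball (M + 2)
    (@continuous_derive_hcoef R G k q.1 'e_(q.2)).
  by exists C.
pose D := (\sum_q C q) *+ n.
have D0 : 0 <= D by rewrite mulrn_wge0// sumr_ge0// => q _; have [] := CP q.
have aL j x y : `|x| <= M + 2 -> `|y| <= M + 2 -> `|a j x - a j y| <= D * `|x - y|.
  apply: (@rV_lipschitz _ _ (a j) (M + 2)).
  - by rewrite sumr_ge0// => q _; have [] := CP q.
  - by move=> z; exact: differentiable_hcoef.
  - move=> z i zM; have [_ /(_ z zM) /le_trans] := CP (j, i); apply.
    by rewrite (bigD1 (j, i))//= lerDl sumr_ge0// => q _; have [] := CP q.
pose kap z := \sum_j D * L * `|drho j z|.
have kap0 z : 0 <= kap z by rewrite sumr_ge0// => j _; rewrite !mulr_ge0// ltW.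
have mkap : measurable_fun setT kap.
  apply: measurable_sum => j; apply: measurable_funM => //.
  exact: measurableT_comp.
exists kap; split => //.
  apply: integrable_sumR => j.
  have ij : mu.-integrable setT (EFin \o (fun z => `|drho j z|)).
    apply: (@integrable_continuous_supp R n _ (L + 1)) => [z|z /drho_large1 ->].
      exact: (cvg_comp _ _ (@cdrho j z) (@norm_continuous _ R^o (drho j z))).
    by rewrite normr0.
  exact: (integrableZl measurableT (D * L) ij).
move=> e x e0 eL1 xM.
have -> : hpartial k (hmollify e) x - Vk x =
    (\int[mu]_z (hcut (x - e *: z) * rho z) - hcut x) +
    (hpartial k (hmollify e) x - \int[mu]_z (hcut (x - e *: z) * rho z)).
  rewrite /hcut indicE mem_set ?mul1r; first by ring.
  by rewrite /hball /=; lra.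
rewrite hpartial_hmollify_sub//.
apply: (@le_trans _ _ (`|\int[mu]_z (hcut (x - e *: z) * rho z) - hcut x|%:E +
  `|\int[mu]_z (\sum_j (u (x - e *: z) - u x) *
    (e^-1 * (a j x - a j (x - e *: z)) * drho j z))|%:E)%E).
  by rewrite -EFinD lee_fin ler_normD.
apply: leeD; first by apply: mollify_difference => //; exact: integrable_hcut.
apply: EFin_norm_Rintegral_le.
- by apply: integrable_sumR => j; exact: integrable_commutator_mul.
- exact: measurable_error_kernel.
move=> z; rewrite /kap mulr_suml (le_trans (ler_norm_sum _ _ _))//.
apply: ler_sum => j _; rewrite normrM mulrC ler_wpM2r// normrM.
have [Lz|zL] := ltP L `|z|; first by rewrite drho_large// normr0 !mulr0.
rewrite ler_wpM2r// normrM (gtr0_norm (_ : 0 < e^-1)) ?invr_gt0//.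
rewrite mulrC ler_pdivrMr// (le_trans (aL _ _ _ _ _))//.
- by lra.
- rewrite (le_trans (ler_normB _ _))// normrZ (gtr0_norm e0).
  have : e * `|z| <= e * L by rewrite ler_wpM2l// ltW.
  by lra.
- rewrite opprB addrCA subrr addr0 normrZ (gtr0_norm e0) -mulrA ler_wpM2l//.
  by rewrite mulrC ler_wpM2r// ltW.
Qed.

End gradient.

End horizontal_mollification.

(** * Approximation and support of weak gradients *)

Section weak_gradient.
Context {R : realType} (G : stratified_group R).
Local Notation N := (hdim G).
Local Notation n := (hdim G + sumn (vdims G))%N.
Local Notation mu := (lebesgue_rV R n).
Variables (rho : 'rV[R]_n -> R^o) (L : R).
Hypotheses (L0 : 0 < L) (srho : smooth rho) (rho0 : forall x, 0 <= (rho x : R))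
  (rho_large : forall x, L <= `|x| -> rho x = 0)
  (rho1 : \int[mu]_x (rho x : R) = 1).

Variables (u : 'rV[R]_n -> R) (V : 'I_N -> 'rV[R]_n -> R) (r M : R).
Hypotheses (r0 : 0 < r) (iu : mu.-integrable setT (EFin \o u))
  (u0 : forall x, hsqnorm x < r \/ M <= `|x| -> u x = 0)
  (mV : forall k, measurable_fun setT (V k))
  (iV : forall k K, compact K -> mu.-integrable K (EFin \o V k))
  (weak : forall k psi, Cc_infty [set: 'rV[R]_n] psi ->
    (\int[mu]_x (u x * hderive (k : 'I_(hdim G)) (psi : gpoint G -> R) x)%:E =
     - \int[mu]_x (V k x * psi x)%:E)%E).

(** Makes e L <= 1, then (e L)^2 <= e L <= r / (4 (N + 1)), and so 2 N (e L)^2 <= r / 2 as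
    [hmollify_supp] requires. *)
Let eta : R := Num.min 1 (r / (4 * N.+1%:R)) / L.

Let e_ (i : nat) : R := eta * i.+1%:R^-1.

Let v_ i := hmollify rho u (e_ i).

Let eta0 : 0 < eta.
Proof. by rewrite /eta divr_gt0// lt_min ltr01/= divr_gt0// mulr_gt0. Qed.

Let e0 i : 0 < e_ i. Proof. by rewrite mulr_gt0. Qed.

Let e_eta i : e_ i * L <= Num.min 1 (r / (4 * N.+1%:R)).
Proof.
rewrite -ler_pdivlMr// -/eta /e_ ler_piMr ?(ltW eta0)//.
by rewrite invf_le1// ler1n.
Qed.

Let eL1 i : e_ i * L <= 1.
Proof. by rewrite (le_trans (e_eta i))// ge_min lexx. Qed.

Let eLr i : (e_ i * L) ^+ 2 *+ N *+ 2 <= r / 2.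
Proof.
have eL0 : 0 <= e_ i * L by rewrite mulr_ge0// ltW.
have eLs : (e_ i * L) ^+ 2 <= r / (4 * N.+1%:R).
  rewrite expr2 (@le_trans _ _ (e_ i * L))// ?ler_piMr//.
  by rewrite (le_trans (e_eta i))// ge_min lexx orbT.
apply: (@le_trans _ _ (r / (4 * N.+1%:R) *+ N.+1 *+ 2)).
  rewrite lerMn2r/= (@le_trans _ _ (r / (4 * N.+1%:R) *+ N))//.
    by rewrite lerMn2r eLs orbT.
  by rewrite ler_wpMn2l// divr_ge0// ?mulr_ge0// ltW.
rewrite -mulrnA -mulr_natr le_eqVlt; apply/orP; left; apply/eqP.
have : N.+1%:R != 0 :> R by rewrite pnatr_eq0.
by rewrite mulnC -[in X in _ * X]mulr_natr => ?; field.
Qed.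

Let e_cvg : e_ @ \oo --> (0 : R).
Proof.
have -> : (0 : R) = eta * 0 by rewrite mulr0.
exact: (cvgM (cvg_cst eta) cvg_harmonic).
Qed.

Let Cv i x : C1at (v_ i) x.
Proof. exact: (C1at_hmollify srho rho_large iu). Qed.

Let v0 i x : hsqnorm x < r / 4 \/ M + 1 <= `|x| -> v_ i x = 0.
Proof. exact: (hmollify_supp L0 srho rho_large iu u0 (e0 i) (eL1 i) (eLr i)). Qed.

Let mrho : measurable_fun setT (rho : 'rV[R]_n -> R).
Proof. exact: continuous_measurable_rV (smooth_continuous srho). Qed.

Let irho : mu.-integrable setT (EFin \o (rho : 'rV[R]_n -> R)).
Proof. exact: (integrable_continuous_supp (smooth_continuous srho) rho_large). Qed.

Let mv i : measurable_fun setT (v_ i).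
Proof. by apply: continuous_measurable_rV => x; have [] := Cv i x. Qed.

Let mhv k i : measurable_fun setT (hpartial k (v_ i)).
Proof. by apply: continuous_measurable_rV => x; exact: continuous_hpartial (Cv i x). Qed.

Let mball T : measurable (@hball R G T). Proof. exact: measurable_rV_ball. Qed.

Lemma norm1_hmollify_cvg0 :
  (fun i => norm1 mu (fun x => v_ i x - u x)) @ \oo --> 0%E.
Proof.
have [mu' _] := integrable_norm1 iu.
have uL x : M <= `|x| -> u x = 0 by move=> Mx; apply: u0; right.
have er := mollify_error_cvg0 rho0 mrho irho iu uL e_cvg.
apply: (squeeze_cvge _ (@cvg_cst _ _ _ _ _) er); apply: nearW => i.
rewrite norm1_ge0/=; apply: ge0_le_integral => //.
- by apply: measurable_normE; exact: measurable_funB.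
- exact: (measurable_mollify_error rho0 mrho iu (e_ i)).
- move=> x _; rewrite /v_ (hmollifyE srho rho_large iu)//.
  exact: (mollify_difference srho rho0 rho_large rho1).
Qed.

(** Any T >= M may stand for M, since u also vanishes beyond T. [hW11] asks for a single ball,
    [weak_hgrad_ae0] for an exhaustion by balls. *)
Lemma norm1_hpartial_hmollify_cvg0 k T : M <= T ->
  (fun i => norm1 mu (fun x => \1_(hball (T + 1)) x *
    (hpartial k (v_ i) x - V k x))) @ \oo --> 0%E.
Proof.
move=> MT.
have uT x : hsqnorm x < r \/ T <= `|x| -> u x = 0.
  by case=> [?|Tx]; apply: u0; [left|right; exact: le_trans Tx].
have uL x : T <= `|x| -> u x = 0 by move=> Mx; apply: uT; right.
have [kap [kap0 mkap ikap er]] := hpartial_hmollify_error L0 srho rho0 rho_large rho1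
  iu uT (iV k) (weak k).
have ih := @integrable_hcut R G T (V k) (iV k).
have hL x : T + 3 <= `|x| -> hcut T (V k) x = 0.
  move=> Tx; rewrite /hcut indicE memNset ?mul0r// /hball /=; lra.
have c1 := mollify_error_cvg0 rho0 mrho irho ih hL e_cvg.
have c2 := mollify_error_cvg0 kap0 mkap ikap iu uL e_cvg.
have c3 : (fun i => \int[mu]_x mollify_error (rho : 'rV[R]_n -> R) (hcut T (V k)) (e_ i) x +
    \int[mu]_x mollify_error kap u (e_ i) x)%E @ \oo --> 0%E.
  have X := cvgeD (isT : 0 +? 0)%E c1 c2; rewrite adde0 in X.
  exact: (X _).
apply: (squeeze_cvge _ (@cvg_cst _ _ _ _ _) c3); apply: nearW => i.
have m1 := measurable_mollify_error rho0 mrho ih (e_ i).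
have m2 := measurable_mollify_error kap0 mkap iu (e_ i).
rewrite norm1_ge0/= -ge0_integralD//; try by move=> x _; exact: mollify_error_ge0.
apply: ge0_le_integral => //.
- apply: measurable_normE; apply: measurable_funM; first exact/measurable_indicP.
  exact: measurable_funB.
- exact: emeasurable_funD.
move=> x _; rewrite indicE; have [xT|xT] := boolP (x \in _).
  by rewrite mul1r; apply: er => //; move: xT; rewrite inE.
by rewrite mul0r normr0 adde_ge0// mollify_error_ge0.
Qed.

Lemma hW11_mollify : hW11 (r / 4) (M + 1) u V.
Proof.
exists v_; split => //; first exact: norm1_hmollify_cvg0.
by move=> k; exact: norm1_hpartial_hmollify_cvg0.
Qed.

(** On the open set [off] all the [v_ i] vanish, hence so do their horizontal derivatives, and these
    tend to [V k] in L^1 on every large ball. *)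
Lemma weak_hgrad_ae0 k :
  {ae mu, forall x, hsqnorm x < r / 4 \/ M + 1 < `|x| -> V k x = 0}.
Proof.
pose off : set 'rV[R]_n := [set x | hsqnorm x < r / 4] `|` [set x | M + 1 < `|x|].
have chs : continuous (@hsqnorm R G) by move=> x; have [] := C1at_hsqnorm x.
have ooff : open off.
  apply: openU.
    exact: (open_comp (D := [set t : R | t < r / 4]) (fun x _ => chs x) (@open_lt _ _)).
  exact: (open_comp (D := [set t : R | M + 1 < t]) (fun x _ => @norm_continuous _ _ x) (@open_gt _ _)).
have moff : measurable off by exact: open_measurable_rV.
have voff i x : off x -> hpartial k (v_ i) x = 0.
  move=> ox; rewrite -(hpartial_cst k 0 x); apply: near_eq_hpartial.
  have := open_nbhs_nbhs (conj ooff ox); apply: filterS => y [oy|oy].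
    by rewrite v0//; left.
  by rewrite v0//; right; exact: ltW.
pose W T x := \1_(hball (M + T%:R + 1)) x * (\1_off x * V k x).
have mW T : measurable_fun setT (W T).
  by apply: measurable_funM; [exact/measurable_indicP|apply: measurable_funM => //; exact/measurable_indicP].
have W0 T : norm1 mu (W T) = 0%E.
  have MT : M <= M + T%:R by rewrite lerDl.
  have c := norm1_hpartial_hmollify_cvg0 k MT.
  apply/eqP; rewrite eq_le norm1_ge0 andbT.
  refine (cvge_ge _ c); apply: nearW => i; apply: le_norm1 => //.
    by apply: measurable_funM; [exact/measurable_indicP|exact: measurable_funB].
  move=> x; rewrite /W !normrM ler_wpM2l// indicE.
  have [/set_mem xo|_] := boolP (x \in off); last by rewrite normr0 mul0r.
  by rewrite voff// normr1 mul1r sub0r normrN.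
have WE T : {ae mu, forall x, W T x = 0}.
  have /(ae_eq_integral_abs mu measurableT) : measurable_fun setT (EFin \o W T).
    exact/measurable_EFinP.
  move=> [H _]; have := H (W0 T); apply: filterS => x /(_ I) [] //.
have := ae_foralln WE; apply: filterS => x Wx ox.
pose T := (Num.truncn (`|x| - M)).+1.
have xT : `|x| <= M + T%:R + 1.
  by have := truncnS_gt (`|x| - M); rewrite -/T; lra.
have := Wx T; rewrite /W !indicE !mem_set// ?mul1r//.
Qed.

End weak_gradient.

(** * The inequalities of Caffarelli-Kohn-Nirenberg and Hardy type *)

Section hardy.
Context {R : realType} (G : stratified_group R).
Local Notation N := (hdim G).
Local Notation n := (hdim G + sumn (vdims G))%N.
Local Notation mu := (lebesgue_rV R n).

(** From 0 <= sum (B a_i - C b_i)^2 = B (A B - C^2), where A, B and C are the three sums; if B = 0,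
    every b_i is 0. *)
Lemma sum_mul_le_sqrt (I : finType) (a b : I -> R) :
  `|\sum_i a i * b i| <= Num.sqrt (\sum_i a i ^+ 2) * Num.sqrt (\sum_i b i ^+ 2).
Proof.
set A := \sum_i a i ^+ 2; set B := \sum_i b i ^+ 2; set C := \sum_i a i * b i.
have A0 : 0 <= A by apply: sumr_ge0 => i _; exact: sqr_ge0.
have B0 : 0 <= B by apply: sumr_ge0 => i _; exact: sqr_ge0.
rewrite -sqrtrM// -sqrtr_sqr ler_sqrt ?mulr_ge0//.
have : 0 <= \sum_i (B * a i - C * b i) ^+ 2 by apply: sumr_ge0 => i _; exact: sqr_ge0.
have -> : \sum_i (B * a i - C * b i) ^+ 2 = B * (A * B - C ^+ 2).
  transitivity (\sum_i (B ^+ 2 * a i ^+ 2 - 2 * B * C * (a i * b i) + C ^+ 2 * b i ^+ 2)).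
    by apply: eq_bigr => i _; ring.
  rewrite big_split sumrB/= -!mulr_sumr -/A -/B -/C; ring.
move: B0; rewrite le_eqVlt => /orP[/eqP B0 _|B0]; last by rewrite pmulr_rge0// subr_ge0.
have b0 i : b i = 0.
  apply/eqP; rewrite -sqrf_eq0; apply/eqP.
  apply: (@psumr_eq0P _ _ predT (fun i => b i ^+ 2)) => // j _.
  exact: sqr_ge0.
by rewrite /C big1 ?expr0n ?mulr_ge0// -?B0// => i _; rewrite b0 mulr0.
Qed.

Lemma wLnorm_pow p a (f : gpoint G -> R) : p != 0 ->
  (wLnorm p a f `^ p = \int[mu]_x ((`|f x| / hnorm x `^ a) `^ p)%:E)%E.
Proof.
move=> p0; apply: etrans (poweR_Lnorm _ _ p0) _; apply: eq_integral => x _.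
by rewrite abse_EFin poweR_EFin normrM normfV (ger0_norm (powR_ge0 _ _)).
Qed.

Lemma wLnorm_ge0 p a (f : gpoint G -> R) : (0 <= wLnorm p a f)%E.
Proof. exact: Lnorm_ge0. Qed.

Lemma wLnorm_root p a (f : gpoint G -> R) : p != 0 ->
  (wLnorm p a f = (wLnorm p a f `^ p) `^ p^-1)%E.
Proof. by move=> p0; rewrite -poweRrM mulfV// poweRe1// wLnorm_ge0. Qed.

(** Of the a + b + 1 powers of 1/q, one is absorbed by |Z| <= q e, a go to the gradient e, and b go
    to the factor with power p - 1. *)
Lemma ckn_pointwise (p a b q w Z e : R) : 1 < p -> 0 < q -> 0 <= w -> 0 <= e ->
  `|Z| <= q * e ->
  w `^ (p - 1) * `|Z| * q `^ (- (a + b + 1)) <=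
  e / q `^ a * (w / q `^ (b / (p - 1))) `^ (p - 1).
Proof.
move=> p1 q0 w0 e0 Ze.
have pn : p - 1 != 0 by rewrite subr_eq0 gt_eqF.
rewrite powRM ?invr_ge0 ?powR_ge0// -!powRN -powRrM mulNr divfK//.
apply: (@le_trans _ _ (w `^ (p - 1) * (q * e) * q `^ (- (a + b + 1)))).
  by rewrite ler_wpM2r ?powR_ge0// ler_wpM2l ?powR_ge0.
have -> : q `^ (- (a + b + 1)) = q `^ (- a) * q `^ (- b) * q^-1.
  rewrite -powRD; last by rewrite (gt_eqF q0) implybT.
  rewrite -(powR_inv1 (ltW q0)) -powRD; last by rewrite (gt_eqF q0) implybT.
  by congr (_ `^ _); ring.
rewrite le_eqVlt; apply/orP; left; apply/eqP.
have qn : q != 0 by rewrite gt_eqF.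
by field.
Qed.

Variables (p r M : R) (u : 'rV[R]_n -> R) (V : 'I_N -> 'rV[R]_n -> R).
Hypotheses (p1 : 1 < p) (r0 : 0 < r).
Hypotheses (mu_ : measurable_fun setT u) (mV : forall k, measurable_fun setT (V k))
  (V1 : forall k, (norm1 mu (fun x => (\1_(@hball R G M) x * V k x)%R) < +oo)%E)
  (u0 : forall x, hsqnorm x < r \/ M <= `|x| -> u x = 0)
  (uV : hW11 r M u V).

Let vn (x : gpoint G) : R := enorm (\row_k V k x).

Let p0 : 0 < p. Proof. exact: lt_trans p1. Qed.
Let pn0 : p != 0. Proof. by rewrite gt_eqF. Qed.

Lemma measurable_hnorm : measurable_fun setT (@hnorm R G : 'rV[R]_n -> R).
Proof.
have mq : measurable_fun setT (@hsqnorm R G).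
  by apply: continuous_measurable_rV => x; have [c _ _] := C1at_hsqnorm x.
rewrite (_ : @hnorm R G = fun x => Num.sqrt (hsqnorm x)); last first.
  by apply/funext => x; rewrite hnormE.
by apply: measurableT_comp mq; apply: continuous_measurable_fun; exact: sqrt_continuous.
Qed.

Lemma measurable_hweight (g : 'rV[R]_n -> R) a : measurable_fun setT g ->
  measurable_fun setT (fun x : 'rV[R]_n => g x / (hnorm (x : gpoint G)) `^ a).
Proof.
move=> mg; rewrite (_ : (fun x => _) = fun x => g x * hnorm (x : gpoint G) `^ (- a)).
  by apply: measurable_funM => //; exact: (measurableT_comp (measurable_powR (- a)) measurable_hnorm).
by apply/funext => x; rewrite powRN.
Qed.

Lemma measurable_enorm (W : 'rV[R]_n -> 'rV[R]_N) :
  (forall k, measurable_fun setT (fun x => W x ord0 k)) ->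
  measurable_fun setT (fun x => enorm (W x)).
Proof.
move=> mW; apply: (measurableT_comp (f := @Num.sqrt R)).
  by apply: continuous_measurable_fun; exact: sqrt_continuous.
by apply: measurable_sum => k; exact: measurable_funX.
Qed.

Let mvn : measurable_fun setT vn.
Proof. by apply: measurable_enorm => k; under eq_fun do rewrite mxE; exact: mV. Qed.

Let mdamp d : 0 < d -> measurable_fun setT (fun x => damp d (u x)).
Proof.
move=> d0; apply: (measurableT_comp _ mu_).
by apply: continuous_measurable_fun => x; exact: continuous_damp.
Qed.

Lemma damped_ckn d a b : 0 < d ->
  ((`|N%:R - (a + b + 1)| / p)%:E *
     wLnorm p ((a + b + 1) / p) (fun x : gpoint G => damp d (u x)) `^ p <=
   wLnorm p a vn *
     wLnorm p (b / (p - 1)) (fun x : gpoint G => damp d (u x)) `^ (p - 1))%E.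
Proof.
move=> d0; set s := a + b + 1.
pose w (x : 'rV[R]_n) := damp d (u x).
have w0 x : 0 <= w x by exact: damp_ge0.
(* The weight is a power of |x'|^2, hence - s / 2 in place of - s. *)
have := damped_inequality (- (s / 2)) p1 d0 r0 mu_ mV V1 uV.
have -> : N%:R + 2 * (- (s / 2)) = N%:R - s by rewrite mulrN mulrC divfK.
have -> : (\int[mu]_x (damp d (u x) `^ p * hsqnorm x `^ (- (s / 2)))%:E =
    wLnorm p (s / p) (fun x : gpoint G => damp d (u x)) `^ p)%E.
  rewrite wLnorm_pow//; apply: eq_integral => x _; congr EFin.
  rewrite (ger0_norm (w0 x)) -powRN [RHS]powRM ?powR_ge0//.
  rewrite -powRrM mulNr divfK//.
  by rewrite hnorm_powR mulNr.
set J := (\int[mu]_x _)%E; set I := (_ `^ p)%E => H.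
have I0 : (0 <= I)%E by exact: poweR_ge0.
have {}H : ((`|N%:R - s| / p)%:E * I <= J)%E.
  have J0 : (0 <= J)%E by apply: integral_ge0 => x _; rewrite lee_fin !mulr_ge0 ?powR_ge0.
  rewrite mulrC EFinM -muleA (@le_trans _ _ (p^-1%:E * (p%:E * J))%E)//.
    by apply: lee_wpmul2l => //; rewrite lee_fin invr_ge0 ltW.
  by rewrite muleA -EFinM mulVf// mul1e.
apply: (le_trans H).
pose F x := vn x / hnorm (x : gpoint G) `^ a.
pose H' x := (w x / hnorm (x : gpoint G) `^ (b / (p - 1))) `^ (p - 1).
have mF : measurable_fun setT F by exact: measurable_hweight.
have mH : measurable_fun setT H'.
  exact: (measurableT_comp (measurable_powR (p - 1)) (measurable_hweight _ (mdamp d0))).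
have p10 : 0 < p - 1 by rewrite subr_gt0.
have q0 : 0 < p / (p - 1) by rewrite divr_gt0.
have pq : p^-1 + (p / (p - 1))^-1 = 1.
  by rewrite invf_div -{1}[p^-1]mul1r -mulrDl addrC subrK mulfV.
have := hoelder mu mF mH p0 q0 pq; rewrite Lnorm1.
have -> : ('N[mu]_(p / (p - 1))%:E[EFin \o H'] =
    wLnorm p (b / (p - 1)) (fun x : gpoint G => damp d (u x)) `^ (p - 1))%E.
  have E2 : (\int[mu]_x (`|(EFin \o H') x| `^ (p / (p - 1))) =
      wLnorm p (b / (p - 1)) (fun x : gpoint G => damp d (u x)) `^ p)%E.
    apply: etrans (esym (wLnorm_pow _ _ pn0)); apply: eq_integral => x _.
    rewrite /comp abse_EFin poweR_EFin; congr EFin.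
    rewrite ger0_norm ?powR_ge0// -powRrM mulrCA mulfV ?mulr1 ?gt_eqF//.
    by rewrite (ger0_norm (w0 x)).
  rewrite unlock E2 -poweRrM invf_div; congr (_ `^ _)%E.
  by rewrite mulrC divfK.
apply: le_trans; apply: ge0_le_integral => //.
- by move=> x _; rewrite lee_fin mulr_ge0 ?powR_ge0// mulr_ge0 ?powR_ge0.
- apply/measurable_EFinP; apply: measurable_funM; last first.
    apply: (measurableT_comp (measurable_powR _)).
    by apply: continuous_measurable_rV => x; have [c _ _] := C1at_hsqnorm x.
  apply: measurable_funM.
    exact: (measurableT_comp (measurable_powR _) (mdamp d0)).
  apply: measurableT_comp => //; apply: measurable_sum => k.
  by apply: measurable_funM => //; exact: measurable_coord.
- by apply: measurableT_comp => //; apply/measurable_EFinP; exact: measurable_funM.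
move=> x _; have F0 : 0 <= F x by rewrite divr_ge0 ?powR_ge0// sqrtr_ge0.
have FH0 : 0 <= F x * H' x by rewrite mulr_ge0 ?powR_ge0.
rewrite /= lee_fin (ger0_norm FH0).
(* Where u vanishes so does the damped factor, whatever the weight; elsewhere |x'| > 0, as u
   vanishes for small |x'|. *)
have [ux|ux] := eqVneq (u x) 0.
  by rewrite ux /damp normr0 mul0r powR0 ?gt_eqF// !mul0r.
have qx : 0 < hnorm (x : gpoint G).
  rewrite hnormE sqrtr_gt0 (lt_le_trans r0)// leNgt; apply/negP => xr.
  by move: ux; rewrite u0 ?eqxx//; left.
rewrite -mulNr -(hnorm_powR (x : gpoint G)); apply: ckn_pointwise => //; [exact: w0|exact: sqrtr_ge0|].
rewrite hnormE /vn /enorm /hsqnorm.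
have -> : \sum_k (\row_k V k x) ord0 k ^+ 2 = \sum_k V k x ^+ 2.
  by apply: eq_bigr => k _; rewrite mxE.
exact: sum_mul_le_sqrt.
Qed.

(* Fatou as the damping parameter tends to 0. *)
Lemma wLnorm_damp_le a c (B : \bar R) : 0 <= c -> (forall d, 0 < d ->
    (c%:E * wLnorm p a (fun x : gpoint G => damp d (u x)) `^ p <= B)%E) ->
  (c%:E * wLnorm p a (u : gpoint G -> R) `^ p <= B)%E.
Proof.
move=> c0 dB; pose d_ (i : nat) : R := i.+1%:R^-1.
pose g i (x : 'rV[R]_n) :=
  (c * (`|damp (d_ i) (u x)| / hnorm (x : gpoint G) `^ a) `^ p)%:E.
have d0 i : 0 < d_ i by rewrite invr_gt0.
have g0 i x : (0 <= g i x)%E by rewrite lee_fin mulr_ge0 ?powR_ge0.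
have mh (h : 'rV[R]_n -> R) : measurable_fun setT h ->
    measurable_fun setT (fun x => (`|h x| / hnorm (x : gpoint G) `^ a) `^ p).
  move=> mh; apply: (measurableT_comp (measurable_powR p)); apply: measurable_hweight.
  exact: measurableT_comp.
have mg i : measurable_fun setT (g i).
  by apply/measurable_EFinP; apply: measurable_funM => //; exact: (mh _ (mdamp (d0 i))).
have mc (h : 'rV[R]_n -> R) : (forall x, 0 <= h x) -> measurable_fun setT h ->
    (c%:E * \int[mu]_x (h x)%:E = \int[mu]_x (c * h x)%:E)%E.
  move=> h0 mh'; rewrite -ge0_integralZl//; first exact/measurable_EFinP.
  by move=> x _; rewrite lee_fin.
have gB i : (\int[mu]_x g i x <= B)%E.
  apply: le_trans (dB (d_ i) (d0 i)); rewrite wLnorm_pow// mc//.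
    by move=> x; exact: powR_ge0.
  exact: (mh _ (mdamp (d0 i))).
have gcvg x : (fun i => g i x) @ \oo -->
    (c * (`|u x| / hnorm (x : gpoint G) `^ a) `^ p)%:E.
  have dE i : damp (d_ i) (u x) = `|u x| * (1 + d_ i * `|u x|)^-1 by [].
  have dcvg : (fun i => damp (d_ i) (u x)) @ \oo --> `|u x|.
    have c1 : (fun i => 1 + d_ i * `|u x|) @ \oo --> 1 + 0 * `|u x|.
      exact: (cvgD (cvg_cst _) (cvgM cvg_harmonic (cvg_cst _))).
    have n1 : 1 + 0 * `|u x| != 0 :> R by rewrite mul0r addr0 oner_neq0.
    have c2 := cvgM (cvg_cst `|u x|) (cvgV n1 c1).
    rewrite mul0r addr0 invr1 mulr1 in c2.
    exact: c2.
  have c3 : (fun i => damp (d_ i) (u x) / hnorm (x : gpoint G) `^ a) @ \oo -->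
      `|u x| / hnorm (x : gpoint G) `^ a.
    exact: (cvgM dcvg (cvg_cst _)).
  have c4 := cvg_comp _ _ c3 (@continuous_norm_powR _ _ p0 (`|u x| / hnorm (x : gpoint G) `^ a)).
  have c5 := cvgM (cvg_cst c) c4.
  apply: cvg_EFin; first exact: nearW.
  rewrite (_ : fine \o _ = fun i => c * `|damp (d_ i) (u x) / hnorm (x : gpoint G) `^ a| `^ p).
    rewrite ger0_norm in c5; last by rewrite divr_ge0 ?powR_ge0.
    exact: c5.
  apply/funext => i; rewrite /= (normrM (damp (d_ i) (u x)) (_ `^ _)^-1) normfV.
  by rewrite (ger0_norm (powR_ge0 _ _)).
rewrite wLnorm_pow// mc; [|by move=> x; exact: powR_ge0|exact: mh].
rewrite (eq_integral (fun x => limn_einf (g^~ x))); last first.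
  by move=> x _; have [-> _] := cvg_limn_einf_sup (gcvg x).
apply: (le_trans (fatou mu measurableT mg (fun i x _ => g0 i x))).
rewrite limn_einf_lim; apply: lime_le; first exact: is_cvg_einfs.
apply: nearW => i; apply: le_trans (gB i); apply: ereal_inf_lbound.
by exists i => /=.
Qed.

Lemma ge0_le_poweR (x y : \bar R) q : (0 <= x)%E -> (x <= y)%E -> 0 <= q ->
  (x `^ q <= y `^ q)%E.
Proof.
move=> x0 xy q0; apply: gt0_ler_poweR => //; rewrite in_itv/= ?x0 leey//.
by rewrite (le_trans x0 xy).
Qed.

(** The finiteness that lets [hardy] cancel a power of this norm: the damped function is at most 1/d
    and lives on a bounded set where the weight is bounded. *)
Lemma wLnorm_damp_lty d a : 0 < d ->
  (wLnorm p a (fun x : gpoint G => damp d (u x)) < +oo)%E.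
Proof.
move=> d0; rewrite (wLnorm_root _ _ pn0) wLnorm_pow//; apply: poweR_lty.
have [C C0 CP] := @weight_bounded R G (- (a * p / 2)) r M r0.
pose D := d^-1 `^ p * C.
have D0 : 0 <= D by rewrite mulr_ge0 ?powR_ge0.
have mb : measurable (@hball R G M) by exact: measurable_rV_ball.
apply: (@le_lt_trans _ _ (\int[mu]_x (D%:E * (\1_(@hball R G M) x)%:E))%E); last first.
  rewrite ge0_integralZl//; last exact/measurable_EFinP/measurable_indicP.
  rewrite integral_indic// setIT lte_mul_pinfty ?lee_fin//.
  exact: lebesgue_rV_ball_fin.
apply: ge0_le_integral => //.
- by move=> x _; rewrite lee_fin powR_ge0.
- apply/measurable_EFinP/(measurableT_comp (measurable_powR p)); apply: measurable_hweight.
  by apply: measurableT_comp => //; exact: mdamp.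
- by apply: measurable_funeM; exact/measurable_EFinP/measurable_indicP.
move=> x _; rewrite -EFinM lee_fin.
have [ux|ux] := eqVneq (u x) 0.
  by rewrite ux /damp normr0 mul0r normr0 mul0r powR0// mulr_ge0.
have rx : r <= hsqnorm x.
  by rewrite leNgt; apply/negP => xr; move: ux; rewrite u0 ?eqxx//; left.
have xM : `|x| <= M.
  by rewrite leNgt; apply/negP => Mx; move: ux; rewrite u0 ?eqxx//; right; exact: ltW.
rewrite indicE mem_set// mulr1 -powRN powRM ?powR_ge0// -powRrM hnorm_powR.
rewrite (ger0_norm (damp_ge0 d0 _)) ler_pM ?powR_ge0//.
  by rewrite ge0_ler_powR ?nnegrE ?damp_ge0 ?invr_ge0 ?damp_bounded// ltW.
by rewrite mulNr mulNr; exact: CP.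
Qed.

(** With the exponents a0 - 1 and (p - 1) a0, [damped_ckn] has W^p on the left and Y W^(p-1) on the
    right for the same finite damped norm W. The power W^(p-1) is cancelled before d tends to 0; W =
    0 and Y = +oo are treated apart. *)
Lemma hardy a0 : N%:R - p * a0 != 0 ->
  (wLnorm p a0 (u : gpoint G -> R) <=
   (p / `|N%:R - p * a0|)%:E * wLnorm p (a0 - 1) vn)%E.
Proof.
move=> Na; have p10 : 0 < p - 1 by rewrite subr_gt0.
have c0 : 0 < `|N%:R - p * a0| / p by rewrite divr_gt0// normr_gt0.
pose W d := wLnorm p a0 (fun x : gpoint G => damp d (u x)).
set Y := wLnorm p (a0 - 1) vn.
have Y0 : (0 <= Y)%E by exact: wLnorm_ge0.
have Wle d : 0 < d -> (W d <= (p / `|N%:R - p * a0|)%:E * Y)%E.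
  move=> d0; have := damped_ckn (a0 - 1) ((p - 1) * a0) d0.
  have -> : a0 - 1 + (p - 1) * a0 + 1 = p * a0 by ring.
  rewrite [p * a0 / p]mulrC mulKf// [(p - 1) * a0 / _]mulrC mulKf ?gt_eqF//.
  rewrite -/(W d) -/Y.
  have Wf := wLnorm_damp_lty a0 d0; have W0 := wLnorm_ge0 p a0 (fun x => damp d (u x)).
  rewrite -/(W d) in Wf W0.
  have WE : W d = (fine (W d))%:E by rewrite fineK// ge0_fin_numE.
  move: W0; rewrite WE; move: (fine (W d)) => w; rewrite lee_fin.
  rewrite le_eqVlt => /orP[/eqP <- _|w0].
    by rewrite mule_ge0// lee_fin divr_ge0// ltW.
  rewrite !poweR_EFin; move: Y0; case: Y => [y y0|_ _|//]; last first.
    by rewrite gt0_muley ?leey// lte_fin divr_gt0// normr_gt0.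
  rewrite -!EFinM !lee_fin => H.
  have wE : w `^ p = w * w `^ (p - 1).
    rewrite -{2}(powRr1 (ltW w0)) -powRD; last by rewrite (gt_eqF w0) implybT.
    by rewrite addrC subrK.
  move: H; rewrite wE mulrA ler_pM2r ?powR_gt0// => H.
  rewrite -invf_div mulrC ler_pdivlMr//; last by rewrite mulrC.
have B0 : (0 <= (p / `|N%:R - p * a0|)%:E * Y)%E.
  by rewrite mule_ge0// lee_fin divr_ge0// ltW.
have := @wLnorm_damp_le a0 1 (((p / `|N%:R - p * a0|)%:E * Y) `^ p)%E ler01.
rewrite mul1e => H.
have rootE x : (0 <= x)%E -> x = ((x `^ p) `^ p^-1)%E.
  by move=> x0; rewrite -poweRrM mulfV// poweRe1.
rewrite (wLnorm_root a0 _ pn0) [X in (_ <= X)%E](rootE _ B0).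
apply: ge0_le_poweR; [exact: poweR_ge0| |by rewrite invr_ge0 ltW].
apply: H => d d0; rewrite mul1e; apply: ge0_le_poweR; [exact: wLnorm_ge0| |exact: ltW].
exact: Wle.
Qed.

(** On the right the damped norm is at most the undamped one; on the left d tends to 0. *)
Lemma ckn a b : ((`|N%:R - (a + b + 1)| / p)%:E *
     wLnorm p ((a + b + 1) / p) (u : gpoint G -> R) `^ p <=
   wLnorm p a vn * wLnorm p (b / (p - 1)) (u : gpoint G -> R) `^ (p - 1))%E.
Proof.
apply: wLnorm_damp_le => [|d d0]; first by rewrite divr_ge0// ltW.
apply: (le_trans (damped_ckn a b d0)); apply: lee_wpmul2l; first exact: wLnorm_ge0.
apply: ge0_le_poweR; [exact: wLnorm_ge0| |by rewrite subr_ge0 ltW].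
rewrite (wLnorm_root (b / (p - 1)) _ pn0) [X in (_ <= X)%E](wLnorm_root _ _ pn0).
apply: ge0_le_poweR; [exact: poweR_ge0| |by rewrite invr_ge0 ltW].
rewrite !(wLnorm_pow _ _ pn0); apply: ge0_le_integral => //.
- by move=> x _; rewrite lee_fin powR_ge0.
- apply/measurable_EFinP/(measurableT_comp (measurable_powR p)); apply: measurable_hweight.
  by apply: measurableT_comp => //; exact: mdamp.
- apply/measurable_EFinP/(measurableT_comp (measurable_powR p)); apply: measurable_hweight.
  exact: measurableT_comp.
move=> x _; rewrite lee_fin ge0_ler_powR ?nnegrE ?divr_ge0 ?powR_ge0 ?(ltW p0)//.
by rewrite ler_wpM2r ?invr_ge0 ?powR_ge0// (ger0_norm (damp_ge0 d0 _)) damp_le.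
Qed.

End hardy.

(** * The Hardy inequality for weak gradients *)

Section weak_hardy.
Context {R : realType} (G : stratified_group R).
Local Notation N := (hdim G).
Local Notation n := (hdim G + sumn (vdims G))%N.
Local Notation mu := (lebesgue_rV R n).
Variables (rho : 'rV[R]_n -> R^o) (L : R).
Hypotheses (L0 : 0 < L) (srho : smooth rho) (rho0 : forall x, 0 <= (rho x : R))
  (rho_large : forall x, L <= `|x| -> rho x = 0)
  (rho1 : \int[mu]_x (rho x : R) = 1).

Variables (u : 'rV[R]_n -> R) (W : gpoint G -> 'rV[R]_N) (r M : R).
Hypotheses (r0 : 0 < r)
  (u0 : {ae mu, forall x, hsqnorm x < r \/ M < `|x| -> u x = 0})
  (uW : is_weak_hgrad (u : gpoint G -> R) W).

Let S : set 'rV[R]_n := [set x | r <= hsqnorm x] `&` @hball R G M.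

(** A version of u that vanishes everywhere off [S]: the support of u is known only up to null sets,
    while the approximation asks for pointwise vanishing. *)
Let u' x := \1_S x * u x.

Let V (k : 'I_N) (x : 'rV[R]_n) : R := W x ord0 k.

Let mS : measurable S.
Proof.
apply: measurableI; last exact: measurable_rV_ball.
have chs : continuous (@hsqnorm R G) by move=> x; have [] := C1at_hsqnorm x.
have mhs : measurable_fun setT (@hsqnorm R G) by exact: continuous_measurable_rV.
have := mhs measurableT _ (measurable_itv `[r, +oo[); rewrite setTI.
congr measurable; apply/seteqP; split => x /=; rewrite in_itv/= andbT//.
Qed.

Let mu_ : measurable_fun setT u. Proof. by have [[]] := uW. Qed.

Let mu' : measurable_fun setT u'.
Proof. by apply: measurable_funM => //; exact/measurable_indicP. Qed.

Let u'E : {ae mu, forall x, u' x = u x}.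
Proof.
apply: filterS u0 => x ux; rewrite /u' indicE; have [_|xS] := boolP (x \in S).
  by rewrite mul1r.
rewrite mul0r ux//; apply/orP; rewrite -[_ || _]negbK negb_or -leNgt -leNgt.
by apply: contra xS => /andP[rx xM]; rewrite inE.
Qed.

Let u'0 x : hsqnorm x < r \/ M + 1 <= `|x| -> u' x = 0.
Proof.
move=> h; rewrite /u' indicE memNset ?mul0r// => -[/= rx xM].
by case: h => [|Mx]; [rewrite ltNge rx|move: xM; rewrite /hball/=; lra].
Qed.

Let iu' : mu.-integrable setT (EFin \o u').
Proof.
have [[_ iu] _] := uW; have mB := @measurable_rV_ball R n M.
have := iu _ (@compact_rV_ball R n M) => /(integrable_mkcond _ mB) iB.
have [//|mB' nB] := @integrable_norm1 _ _ _ mu (fun x => \1_(@hball R G M) x * u x).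
  move: iB; congr (_.-integrable _ _); apply/funext => x.
  rewrite /patch /hball /= indicE; case: ifP => _; last by rewrite mul0r.
  by rewrite mul1r.
apply: norm1_integrable => //; apply: le_lt_trans nB; apply: le_norm1 => // x.
rewrite /u' !normrM ler_wpM2r// !indicE; have [/set_mem[_ xB]|_] := boolP (x \in S).
  by rewrite mem_set.
by rewrite normr0.
Qed.

Let mV k : measurable_fun setT (V k).
Proof. by have [_ /(_ k) [[]]] := uW. Qed.

Let iV k K : compact K -> mu.-integrable K (EFin \o V k).
Proof. by have [_ /(_ k) [[_ +] _]] := uW; apply. Qed.

Let weak k psi : Cc_infty [set: 'rV[R]_n] psi ->
    (\int[mu]_x (u' x * hderive (k : 'I_(hdim G)) (psi : gpoint G -> R) x)%:E =
     - \int[mu]_x (V k x * psi x)%:E)%E.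
Proof.
move=> Cpsi; have [_ /(_ k) [_ /(_ psi Cpsi) H]] := uW.
apply: etrans H; have [spsi _ _] := Cpsi.
have mh : measurable_fun setT (hderive k (psi : gpoint G -> R) : 'rV[R]_n -> R).
  have -> : (hderive k (psi : gpoint G -> R) : 'rV[R]_n -> R) = hpartial k psi.
    by apply/funext => x; apply: hderiveE; exact: (smooth_differentiable x spsi).
  apply: measurable_sum => j; apply: measurable_funM; apply: continuous_measurable_rV.
    exact: continuous_hcoef.
  exact: smooth_derive_continuous spsi.
apply: (ae_eq_integral (mu := mu)) => //.
- by apply/measurable_EFinP; exact: measurable_funM.
- by apply/measurable_EFinP; exact: measurable_funM.
- by apply: filterS u'E => x -> _.
Qed.

(** Passes the support condition on to |W| for the next step of the iteration. The margins r / 4 and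
    M + 2 come from the mollification; worsening them finitely often is harmless. *)
Lemma weak_hgrad_supp : exists r' M', 0 < r' /\
  {ae mu, forall x, hsqnorm x < r' \/ M' < `|x| -> enorm (W x) = 0}.
Proof.
exists (r / 4), (M + 1 + 1); split; first by rewrite divr_gt0.
have H k := weak_hgrad_ae0 L0 srho rho0 rho_large rho1 r0 iu' u'0 mV iV weak k.
have := @filter_forall _ _ _ _ (ae_filter_ringOfSetsType mu) H.
apply: filterS => x Vx xoff; rewrite /enorm big1 ?sqrtr0// => k _.
by have -> : W x ord0 k = 0 := Vx k xoff; rewrite expr0n.
Qed.

Lemma hardy_weak_hgrad p a0 : 1 < p -> N%:R - p * a0 != 0 ->
  (wLnorm p a0 (u : gpoint G -> R) <=
   (p / `|N%:R - p * a0|)%:E * wLnorm p (a0 - 1) (fun x => enorm (W x)))%E.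
Proof.
move=> p1 Na; have pn0 : p != 0 by rewrite gt_eqF// (lt_trans _ p1).
have uV := hW11_mollify L0 srho rho0 rho_large rho1 r0 iu' u'0 mV iV weak.
have r40 : 0 < r / 4 by rewrite divr_gt0.
have u'0' x : hsqnorm x < r / 4 \/ M + 1 + 1 <= `|x| -> u' x = 0.
  case=> [xr|xM]; apply: u'0; [left|right].
    by move: r0 xr; move: (hsqnorm x) => t; lra.
  by move: xM; move: `|x| => t; lra.
have V1 k : (norm1 mu (fun x => (\1_(@hball R G (M + 1 + 1)) x * V k x)%R) < +oo)%E.
  have := @integrable_hcut R G M (V k) (iV k) => /integrable_norm1[_].
  by rewrite /hcut (_ : M + 1 + 1 = M + 2)//; ring.
have := hardy p1 r40 mu' mV V1 u'0' uV Na.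
have -> : wLnorm p a0 (u' : gpoint G -> R) = wLnorm p a0 (u : gpoint G -> R).
  rewrite (wLnorm_root _ _ pn0) [RHS](wLnorm_root _ _ pn0); congr (_ `^ _)%E.
  rewrite !(wLnorm_pow _ _ pn0); apply: (ae_eq_integral (mu := mu)) => //.
  - apply/measurable_EFinP/(measurableT_comp (measurable_powR p)).
    by apply: measurable_hweight; exact: measurableT_comp.
  - apply/measurable_EFinP/(measurableT_comp (measurable_powR p)).
    by apply: measurable_hweight; exact: measurableT_comp.
  - by apply: filterS u'E => x -> _.
have -> : (fun x : gpoint G => enorm (\row_k V k x)) = (fun x => enorm (W x)).
  by apply/funext => x; congr enorm; apply/rowP => k; rewrite mxE.
by [].
Qed.

End weak_hardy.

(** * Iteration *)

Section smooth_hardy.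
Context {R : realType} (G : stratified_group R).
Local Notation N := (hdim G).
Local Notation n := (hdim G + sumn (vdims G))%N.
Local Notation mu := (lebesgue_rV R n).
Variable f : 'rV[R]_n -> R^o.
Hypothesis fC : Cc_infty [set x : gpoint G | lsubmx x != 0] (f : gpoint G -> R).

(** The image of the support under |x'|^2 is compact and misses 0, hence it misses a neighbourhood
    of 0. *)
Lemma Cc_infty_hsupp : exists r M, 0 < r /\
  forall x : 'rV[R]_n, hsqnorm x < r \/ M <= `|x| -> f x = 0.
Proof.
have [M _ fM] := Cc_infty_supp fC; have [_ cK KU] := fC.
set K := closure _ in cK KU.
have chs : continuous (@hsqnorm R G) by move=> x; have [] := C1at_hsqnorm x.
have cH : compact (@hsqnorm R G @` K).
  by apply: continuous_compact cK; exact: continuous_subspaceT.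
have oH : open (~` (@hsqnorm R G @` K)) by rewrite openC; exact: compact_closed cH.
have H0 : (~` (@hsqnorm R G @` K)) 0.
  move=> [x Kx x0]; have /eqP := KU _ Kx; apply; apply/rowP => i; rewrite !mxE.
  have := @psumr_eq0P _ _ predT (fun i => hcoord i x ^+ 2)
    (fun i _ => sqr_ge0 _) x0 i isT.
  by move/eqP; rewrite sqrf_eq0 => /eqP.
have /nbhs_ballP[r /= r0 rH] := open_nbhs_nbhs (conj oH H0).
exists r, M; split => // x [xr|]; last exact: fM.
apply/eqP/negP => /negP fx; apply: (rH (hsqnorm x)).
  by rewrite /ball/= sub0r normrN ger0_norm// hsqnorm_ge0.
by exists x => //; apply: subset_closure.
Qed.

Variables (r M : R).
Hypotheses (r0 : 0 < r) (f0 : forall x : 'rV[R]_n, hsqnorm x < r \/ M <= `|x| -> f x = 0).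

Let V (k : 'I_N) : 'rV[R]_n -> R := hderive k (f : gpoint G -> R).

Let sf : smooth f. Proof. by have [] := fC. Qed.

Let VE k : V k = hpartial k (f : 'rV[R]_n -> R).
Proof. by apply/funext => x; apply: hderiveE; exact: (smooth_differentiable x sf). Qed.

Let Cf x : C1at (f : 'rV[R]_n -> R) x.
Proof.
split.
- exact: smooth_continuous sf x.
- apply: (@filterS _ (nbhs x) _ setT) filterT => y _ j.
  exact: diff_derivable (smooth_differentiable y sf).
- by move=> j; exact: (smooth_derive_continuous (v := 'e_j) sf).
Qed.

Let cV k : continuous (V k).
Proof. by rewrite VE => x; exact: continuous_hpartial (Cf x). Qed.

Let V0 k x : hsqnorm x < r \/ M < `|x| -> V k x = 0.
Proof.
move=> h; rewrite VE -(hpartial_cst k 0 x); apply: near_eq_hpartial.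
pose off : set 'rV[R]_n := [set x | hsqnorm x < r] `|` [set x | M < `|x|].
have chs : continuous (@hsqnorm R G) by move=> y; have [] := C1at_hsqnorm y.
have ooff : open off.
  apply: openU.
    exact: (open_comp (D := [set t : R | t < r]) (fun x _ => chs x) (@open_lt _ _)).
  exact: (open_comp (D := [set t : R | M < t]) (fun x _ => @norm_continuous _ _ x) (@open_gt _ _)).
have := open_nbhs_nbhs (conj ooff h); apply: filterS => y [oy|oy].
  by rewrite f0//; left.
by rewrite f0//; right; exact: ltW.
Qed.

Let mf : measurable_fun setT (f : 'rV[R]_n -> R).
Proof. exact: continuous_measurable_rV (smooth_continuous sf). Qed.

Let mV k : measurable_fun setT (V k).
Proof. exact: continuous_measurable_rV. Qed.

Let V1 k : (norm1 mu (fun x => (\1_(@hball R G M) x * V k x)%R) < +oo)%E.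
Proof.
have VL x : M + 1 <= `|x| -> V k x = 0 by move=> xM; apply: V0; right; lra.
have [_ nV] := integrable_norm1 (integrable_continuous_supp (@cV k) VL).
apply: le_lt_trans nV; apply: le_norm1 => //.
  by apply: measurable_funM => //; apply/measurable_indicP; exact: measurable_rV_ball.
move=> x; rewrite normrM ler_piMl// indicE.
by case: (_ \in _); rewrite ?normr1 ?normr0.
Qed.

(** f is itself C^1, so the constant sequence approximates it. *)
Let fV : hW11 r M (f : 'rV[R]_n -> R) V.
Proof.
exists (fun=> f); split => //.
  rewrite (_ : (fun _ : nat => _) = cst 0%E); first exact: cvg_cst.
  by apply/funext => i; apply: integral0_eq => x _; rewrite subrr normr0.
move=> k; rewrite (_ : (fun _ : nat => _) = cst 0%E); first exact: cvg_cst.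
apply/funext => i; apply: integral0_eq => x _.
by rewrite VE subrr mulr0 normr0.
Qed.

Lemma smooth_hgrad_supp x : hsqnorm x < r \/ M < `|x| ->
  enorm (hgrad (f : gpoint G -> R) x) = 0.
Proof.
move=> h; rewrite /enorm big1 ?sqrtr0// => k _; rewrite mxE.
by have -> : hderive k (f : gpoint G -> R) x = 0 := V0 k h; rewrite expr0n.
Qed.

Lemma smooth_hardy p a0 : 1 < p -> N%:R - p * a0 != 0 ->
  (wLnorm p a0 (f : gpoint G -> R) <=
   (p / `|N%:R - p * a0|)%:E *
   wLnorm p (a0 - 1) (fun x => enorm (hgrad (f : gpoint G -> R) x)))%E.
Proof. by move=> p1 Na; exact: (hardy p1 r0 mf mV V1 f0 fV Na). Qed.

Lemma smooth_ckn p a b : 1 < p -> ((`|N%:R - (a + b + 1)| / p)%:E *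
     wLnorm p ((a + b + 1) / p) (f : gpoint G -> R) `^ p <=
   wLnorm p a (fun x => enorm (hgrad (f : gpoint G -> R) x)) *
   wLnorm p (b / (p - 1)) (f : gpoint G -> R) `^ (p - 1))%E.
Proof. by move=> p1; exact: (ckn p1 r0 mf mV V1 f0 fV a b). Qed.

End smooth_hardy.

(** * Iterating along the absolute horizontal gradients *)

Section iterated_hardy.
Context {R : realType} (G : stratified_group R).
Local Notation N := (hdim G).
Local Notation n := (hdim G + sumn (vdims G))%N.
Local Notation mu := (lebesgue_rV R n).
Variables (p : R) (f : gpoint G -> R) (x0 : gpoint G).
Hypotheses (p1 : 1 < p) (fC : Cc_infty [set x : gpoint G | lsubmx x != 0] f)
  (fx0 : f x0 != 0).

(** Only the existence of some r and M is carried along, since each weak gradient changes both. *)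
Lemma abs_hgrad_supp m u : is_abs_hgrad f m u -> (0 < m)%N -> exists r M, 0 < r /\
  {ae mu, forall x, hsqnorm x < r \/ M < `|x| -> u x = 0}.
Proof.
elim=> [//|_|{}m {}u W _ /(_ isT)[r [M [r0 u0]]] uW _].
  have [r [M [r0 f0]]] := Cc_infty_hsupp fC.
  exists r, M; split => //; apply: aeW => x.
  exact: (smooth_hgrad_supp fC f0).
have [rho [L [L0 srho rho0 rho_large rho1]]] := exists_bump fC fx0.
exact: (weak_hgrad_supp L0 srho rho0 rho_large rho1 r0 u0 uW).
Qed.

Lemma hardy_abs_hgrad m u W a0 : is_abs_hgrad f m.+1 u -> is_weak_hgrad u W ->
  N%:R - p * a0 != 0 ->
  (wLnorm p a0 u <=
   (p / `|N%:R - p * a0|)%:E * wLnorm p (a0 - 1) (fun x => enorm (W x)))%E.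
Proof.
move=> fu uW Na; have [r [M [r0 u0]]] := abs_hgrad_supp fu isT.
have [rho [L [L0 srho rho0 rho_large rho1]]] := exists_bump fC fx0.
exact: (hardy_weak_hgrad L0 srho rho0 rho_large rho1 r0 u0 uW p1 Na).
Qed.

Lemma A_alpha0 a : A_alpha N p a 0 = 1.
Proof. by rewrite /A_alpha big_ord0 expr0 invr1 mulr1. Qed.

Lemma A_alphaS a m : A_alpha N p a m.+1 =
  A_alpha N p a m * (p / `|N%:R - p * (a - m%:R)|).
Proof. by rewrite /A_alpha big_ord_recr/= exprSr invfM mulrACA. Qed.

Lemma A_alpha_ge0 a m : 0 <= A_alpha N p a m.
Proof.
rewrite mulr_ge0 ?exprn_ge0 ?(ltW (lt_trans ltr01 p1))// invr_ge0.
by apply: prodr_ge0 => i _.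
Qed.

Lemma prod_neq0S (a : R) m :
  \prod_(j < m.+1) `|N%:R - p * (a - j%:R)| != 0 ->
  \prod_(j < m) `|N%:R - p * (a - j%:R)| != 0 /\ N%:R - p * (a - m%:R) != 0.
Proof. by rewrite big_ord_recr/= mulf_eq0 negb_or normr_eq0 => /andP[]. Qed.

Lemma A_alpha_step a m (X Y Z : \bar R) :
  (X <= (A_alpha N p a m)%:E * Y)%E ->
  (Y <= (p / `|N%:R - p * (a - m%:R)|)%:E * Z)%E ->
  (X <= (A_alpha N p a m.+1)%:E * Z)%E.
Proof.
move=> XY YZ; apply: (le_trans XY); rewrite A_alphaS (EFinM (A_alpha N p a m)) -muleA.
by apply: lee_wpmul2l => //; rewrite lee_fin A_alpha_ge0.
Qed.

Let pn0 : p != 0. Proof. by rewrite gt_eqF// (lt_trans ltr01). Qed.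

Let subS (a : R) m : a - m.+1%:R = a - m%:R - 1.
Proof. by rewrite -natr1 opprD addrA. Qed.

Lemma iterated_hardy b m u : is_abs_hgrad f m u ->
  \prod_(j < m) `|N%:R - p * (b - j%:R)| != 0 ->
  (wLnorm p b f <= (A_alpha N p b m)%:E * wLnorm p (b - m%:R) u)%E.
Proof.
elim=> [_|/prod_neq0S[_ Nb]|{}m {}u W fu ih uW /prod_neq0S[Hm Nb]].
(* Order 0 is |f| rather than f, with the same norm. *)
- rewrite A_alpha0 mul1e subr0 (wLnorm_root b f pn0).
  rewrite [X in (_ <= X)%E](wLnorm_root b _ pn0).
  rewrite !(wLnorm_pow _ _ pn0).
  rewrite le_eqVlt; apply/orP; left; apply/eqP.
  apply: (congr1 (fun t => t `^ p^-1)%E).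
  by apply: eq_integral => x _; rewrite normr_id.
- apply: (@A_alpha_step _ _ _ (wLnorm p (b - 0) f)).
    by rewrite A_alpha0 mul1e subr0.
  have [r [M [r0 f0]]] := Cc_infty_hsupp fC.
  by rewrite subS; exact: (smooth_hardy fC r0 f0 p1 Nb).
- apply: (A_alpha_step (ih Hm)); rewrite [b - m.+2%:R]subS.
  exact: (hardy_abs_hgrad fu uW Nb).
Qed.

(** The iteration starts from |nabla_H f|, the first factor given by [smooth_ckn]; therefore m
    factors of the constant lead to the gradient of order m + 1. *)
Lemma iterated_hardy_hgrad a m u : is_abs_hgrad f m.+1 u ->
  \prod_(j < m) `|N%:R - p * (a - j%:R)| != 0 ->
  (wLnorm p a (fun x => enorm (hgrad f x)) <=
   (A_alpha N p a m)%:E * wLnorm p (a - m%:R) u)%E.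
Proof.
(* Naming the index m + 1 keeps m general in the induction on [is_abs_hgrad]. *)
have [m' m'E] : exists m', m' = m.+1 by exists m.+1.
rewrite -m'E => fu; elim: fu m m'E => [//|m [<-] _|{}m' {}u W fu ih uW m [<-]].
  by rewrite A_alpha0 mul1e subr0.
move=> /prod_neq0S[Hm Na].
apply: (A_alpha_step (ih _ erefl Hm)); rewrite subS.
exact: (hardy_abs_hgrad fu uW Na).
Qed.

(** Since c > 0, the constant passes through the infimum even if there is no version u and the
    infimum is +oo. *)
Lemma le_wLnorm_hgrad (X : \bar R) c a m : (0 < c) ->
  (forall u, is_abs_hgrad f m u -> X <= c%:E * wLnorm p a u)%E ->
  (X <= c%:E * wLnorm_hgrad p a m f)%E.
Proof.
move=> c0 H; rewrite -ereal_inf_pZl//; apply: le_ereal_inf_tmp => _ [_ [u fu <-] <-].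
exact: H.
Qed.

Lemma A_alpha_gt0 a m : \prod_(j < m) `|N%:R - p * (a - j%:R)| != 0 ->
  0 < A_alpha N p a m.
Proof.
move=> H; rewrite lt_neqAle A_alpha_ge0 andbT eq_sym mulf_neq0 ?invr_eq0//.
by rewrite expf_neq0// gt_eqF// (lt_trans ltr01).
Qed.

End iterated_hardy.

(** The second factor of [smooth_ckn] carries the power p - 1, so its constant is that of the
    iteration started at beta / (p - 1), raised to p - 1. *)
Lemma A_betaE (R : realType) (N : nat) (p beta : R) k : 0 < p ->
  A_beta N p beta k = A_alpha N p (beta / (p - 1)) k `^ (p - 1).
Proof.
move=> p0; rewrite /A_beta /A_alpha; set P := \prod_(j < k) _.
have P0 : 0 <= P by exact: prodr_ge0.
rewrite powRM ?exprn_ge0 ?invr_ge0 ?(ltW p0)// powRrM powR_mulrn ?(ltW p0)//.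
by rewrite -(powR_inv1 P0) -powRrM mulN1r.
Qed.

Theorem proposition3p3 (R : realType) (G : stratified_group R) (p : R)
    (p_gt1 : 1 < p) (k m : nat) (alpha beta gamma : R)
    (gammaE : gamma = alpha + beta + 1)
    (alpha_neq0 : \prod_(j < m) `|(hdim G)%:R - p * (alpha - j%:R)| != 0)
    (beta_neq0 : \prod_(j < k) `|(hdim G)%:R - p * (beta / (p - 1) - j%:R)| != 0)
    (f : gpoint G -> R) (f_Cc : Cc_infty [set x : gpoint G | lsubmx x != 0] f) :
  ((`|(hdim G)%:R - gamma| / p)%:E * wLnorm p (gamma / p) f `^ p <=
   (A_alpha (hdim G) p alpha m * A_beta (hdim G) p beta k)%:E *
   wLnorm_hgrad p (alpha - m%:R) m.+1 f *
   wLnorm_hgrad p (beta / (p - 1) - k%:R) k f `^ (p - 1))%E.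
Proof.
have p0 : 0 < p by exact: lt_trans p_gt1.
have inf_ge0 a l : (0 <= wLnorm_hgrad p a l f)%E.
  by apply: le_ereal_inf_tmp => _ [u _ <-]; exact: wLnorm_ge0.
have Aa0 := A_alpha_gt0 p_gt1 alpha_neq0.
have Ab0 := A_alpha_gt0 p_gt1 beta_neq0.
rewrite (A_betaE _ _ _ p0).
(* The mollifier is made from f, so the case f = 0 is settled directly. *)
have [/existsNP[x0 /eqP fx0]|f0] := pselect (~ forall x, f x = 0); last first.
  have {}f0 x : f x = 0 by apply: contrapT => fx; apply: f0 => H; exact: fx.
  rewrite wLnorm_pow ?gt_eqF// integral0_eq ?mule0; last first.
    by move=> x _; rewrite f0 normr0 mul0r powR0// gt_eqF.
  by rewrite !mule_ge0 ?poweR_ge0// lee_fin mulr_ge0 ?powR_ge0// ltW.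
have [r [M [r0 fr]]] := Cc_infty_hsupp f_Cc.
have H1 := le_wLnorm_hgrad Aa0
  (fun u fu => iterated_hardy_hgrad p_gt1 f_Cc fx0 fu alpha_neq0).
have H2 := le_wLnorm_hgrad Ab0
  (fun u fu => iterated_hardy p_gt1 f_Cc fx0 fu beta_neq0).
rewrite gammaE; apply: (le_trans (smooth_ckn f_Cc r0 fr alpha beta p_gt1)).
rewrite EFinM -poweR_EFin -muleA muleACA -poweRM ?lee_fin ?(ltW Ab0)//.
apply: lee_pmul H1 _; [exact: wLnorm_ge0|exact: poweR_ge0|].
by apply: ge0_le_poweR H2 _; [exact: wLnorm_ge0|rewrite subr_ge0 ltW].
Qed.
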